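(* The robust recoverable matroid basis problem with interval second-stage costs (RR MB under scenario set $\mathcal{U}^m$), defined below, can be solved in polynomial time: there is a polynomial-time algorithm which, given the input, outputs a basis $X\in\Phi$ attaining the minimum in $$\min_{X\in \Phi} \Big(\sum_{e\in X} C_e + \max_{S\in \mathcal{U}^m}\min_{Y\in \Phi^k_{X}} \sum_{e\in Y} c_e^S\Big),$$ together with a basis $Y\in\Phi^k_X$ attaining the inner minimum for the worst-case scenario.
   Context: Input: a matroid $M=(E,\mathcal{I})$ on a nonempty finite ground set $E$, $|E|=m$, given so that independence of any subset of $E$ can be tested in polynomial time; for each $e\in E$ a nonnegative first-stage cost $C_e$ and a second-stage uncertainty interval $[c_e,c_e+d_e]$ with $c_e\ge0$, $d_e\ge 0$; and a recovery parameter $k\in\{0,\dots,r_M(E)\}$, where $r_M(U)=\max\{|W|: W\subseteq U, W\in\mathcal{I}\}$ is the rank function. $\Phi$ is the set of all bases (inclusion-maximal independent sets) of $M$. For $X\in\Phi$, $\Phi^k_X=\{Y\in\Phi: |Y\setminus X|\le k\}$. A scenario is a vector $S=(c^S_e)_{e\in E}$ and $\mathcal{U}^m=\prod_{e\in E}[c_e,c_e+d_e]$. *)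

(* Defs.v *)
From HB Require Import structures.
From mathcomp Require Import all_boot all_order all_algebra.

Set Implicit Arguments.
Unset Strict Implicit.
Unset Printing Implicit Defensive.

Import Order.TTheory GRing.Theory Num.Theory.

Local Open Scope ring_scope.

Record matroid (E : finType) := Matroid {
  indep : {set E} -> bool;
  indep_set0 : indep set0;
  indep_sub : forall A B : {set E}, A \subset B -> indep B -> indep A;
  indep_augment : forall A B : {set E}, indep A -> indep B ->
    (#|A| < #|B|)%N -> exists2 e, e \in B :\: A & indep (e |: A)
}.

Section Matroid.
Variables (E : finType) (M : matroid E).

Definition rank (U : {set E}) : nat :=
  \max_(W : {set E} | (W \subset U) && indep M W) #|W|.

Definition bases : {set {set E}} := [set X | maxset (indep M) X].

Definition recoveries (k : nat) (X : {set E}) : {set {set E}} :=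
  [set Y in bases | #|Y :\: X| <= k]%N.

End Matroid.

Section RobustRecoverable.
Variables (R : realFieldType) (E : finType) (M : matroid E).
Variables (C c d : E -> R) (k : nat).

Definition cost (w : E -> R) (X : {set E}) : R := \sum_(e in X) w e.

Definition scenario (S : E -> R) : Prop := forall e, c e <= S e <= c e + d e.

(* The minimum over [recoveries M k X]; for a basis X this set contains X, so
   that [arg min] is a genuine minimizer. *)
Definition recovery_value (S : E -> R) (X : {set E}) : R :=
  cost S [arg min_(Y < X in recoveries M k X) cost S Y]%O.

Definition worst_scenario (X : {set E}) (S : E -> R) : Prop :=
  scenario S /\
  forall S', scenario S' -> recovery_value S' X <= recovery_value S X.

(* The maximum over the infinite scenario set is required to be attained. *)
Definition robust_value (X : {set E}) (v : R) : Prop :=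
  exists2 S, worst_scenario X S & v = cost C X + recovery_value S X.

(* The last clause is required for every worst-case scenario; the second one
   provides the existence of such a scenario. *)
Definition rr_solution (X Y : {set E}) : Prop :=
  [/\ X \in bases M,
      exists2 v, robust_value X v &
        forall X', X' \in bases M -> exists2 v', robust_value X' v' & v <= v',
      Y \in recoveries M k X
    & forall S, worst_scenario X S -> cost S Y = recovery_value S X].

End RobustRecoverable.

(* Model of computation: programs transform binary trees with integer leaves.
   A basic operation is charged the number of bits of its argument and of its
   result, and duplicating the current value is charged its size; hence the
   time is polynomially related to that of a Turing machine. *)

Inductive data := Atom of int | Node of data & data.

Definition bits (z : int) : nat := (trunc_log 2 `|z|%N).+1.

Fixpoint dsize (v : data) : nat :=
  match v with
  | Atom z => (bits z).+1
  | Node v1 v2 => (dsize v1 + dsize v2).+1%N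
  end.

Inductive prim :=
  | OpId | OpConst of int | OpFst | OpSnd | OpIsNode
  | OpAdd | OpSub | OpMul | OpLeq.

Definition enc_bool (b : bool) : data := Atom (b : nat)%:Z.

(* Operations applied to an argument of the wrong shape return [Atom 0]. *)
Definition prim_eval (o : prim) (v : data) : data :=
  match o, v with
  | OpId, _ => v
  | OpConst z, _ => Atom z
  | OpFst, Node v1 _ => v1
  | OpSnd, Node _ v2 => v2
  | OpIsNode, Node _ _ => enc_bool true
  | OpAdd, Node (Atom x) (Atom y) => Atom (x + y)
  | OpSub, Node (Atom x) (Atom y) => Atom (x - y)
  | OpMul, Node (Atom x) (Atom y) => Atom (x * y)
  | OpLeq, Node (Atom x) (Atom y) => enc_bool (x <= y)
  | _, _ => Atom 0
  end.

Definition truthy (v : data) : bool := if v is Atom z then z != 0 else true.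

Inductive prog :=
  | PPrim of prim
  | PSeq of prog & prog
  | PFork of prog & prog
  | PIf of prog & prog & prog
  | PWhile of prog & prog.

(* [runs p v w t]: on the value v, the program p halts with the value w in
   time t. *)
Inductive runs : prog -> data -> data -> nat -> Prop :=
  | RunPrim o v :
      runs (PPrim o) v (prim_eval o v) (dsize v + dsize (prim_eval o v)).+1%N
  | RunSeq p q u v w s t :
      runs p u v s -> runs q v w t -> runs (PSeq p q) u w (s + t).+1%N
  | RunFork p q u v w s t :
      runs p u v s -> runs q u w t ->
      runs (PFork p q) u (Node v w) (s + t + dsize u).+1%N
  | RunIfTrue b p q u v w s t :
      runs b u v s -> truthy v -> runs p u w t ->
      runs (PIf b p q) u w (s + t + dsize u).+1%N
  | RunIfFalse b p q u v w s t :
      runs b u v s -> ~~ truthy v -> runs q u w t ->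
      runs (PIf b p q) u w (s + t + dsize u).+1%N
  | RunWhileTrue b p u v u' w s t t' :
      runs b u v s -> truthy v -> runs p u u' t -> runs (PWhile b p) u' w t' ->
      runs (PWhile b p) u w (s + t + t' + dsize u).+1%N
  | RunWhileFalse b p u v s :
      runs b u v s -> ~~ truthy v -> runs (PWhile b p) u u (s + dsize u).+1%N.

Definition runs_within (p : prog) (v w : data) (b : nat) : Prop :=
  exists2 t, runs p v w t & (t <= b)%N.

Definition enc_seq (s : seq data) : data := foldr Node (Atom 0) s.

Definition enc_rat (q : rat) : data := Node (Atom (numq q)) (Atom (denq q)).

Definition enc_set (m : nat) (U : {set 'I_m}) : data :=
  enc_seq [seq enc_bool (e \in U) | e <- enum 'I_m].

Definition enc_costs (m : nat) (C c d : 'I_m -> rat) : data :=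
  enc_seq [seq Node (enc_rat (C e)) (Node (enc_rat (c e)) (enc_rat (d e)))
          | e <- enum 'I_m].

Definition enc_query (m : nat) (D : data) (U : {set 'I_m}) : data :=
  Node D (enc_set U).

Definition enc_input (m : nat) (D : data) (k : nat) (C c d : 'I_m -> rat) :
    data :=
  Node D (Node (Atom k%:Z) (enc_costs C c d)).

(* [rep m D M]: the value D describes the matroid M on m elements. *)
Definition representation := forall m : nat, data -> matroid 'I_m -> Prop.

Definition indep_poly_time (rep : representation) : Prop :=
  exists (T : prog) (p : {poly nat}),
  forall (m : nat) (D : data) (M : matroid 'I_m) (U : {set 'I_m}),
    rep m D M ->
    runs_within T (enc_query D U) (enc_bool (indep M U))
      p.[dsize (enc_query D U)].

(* Main.v *)
Require Import Defs.
From mathcomp Require Import all_boot all_order all_algebra.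
From mathcomp Require Import zify ring.

Set Implicit Arguments.
Unset Strict Implicit.
Unset Printing Implicit Defensive.

Import Order.TTheory GRing.Theory Num.Theory.

Local Open Scope nat_scope.

(** The scenario in which every cost takes its upper bound is a worst one for every
    basis, so with [w = c + d] one has to minimize [C(X) + w(Y)] over the pairs of
    bases with [#|Y :\: X| <= k]. Splitting such a pair into a common part of size
    [r - k] and the two rests of size [k] turns it into a common basis of two matroids
    on three copies of the ground set, with an additive weight.

    A common basis of minimum weight is found by inserting the elements one at a time.
    The current basis [B] is kept optimal together with a splitting [w = w1 + w2] for
    which it is [w1]-minimal in the first matroid and [w2]-minimal in the second. When
    [e] is inserted, a shortest cycle through [e] in the exchange graph, with the fewest
    arcs among these, is searched for by Bellman-Ford; if it is negative, [B] is
    exchanged along it. The distances from [e] correct the splitting, and minimality of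
    the number of arcs excludes tight shortcuts, so that the exchanged set is again a
    basis. The number of arcs is made a secondary objective by multiplying the integral
    weights by a constant larger than the number of elements.

    Polynomial running time is a closure property: [polyc dom rho f g] says that one
    program computes [g a] from [f a] for all [a] in [dom], in time polynomial in
    [rho a]. *)

(** * Polynomial-time computable functions *)

(** The splitting [w1 + w2] lives only in the proof: the program stores [B] alone and works with the
    given weights, since reduced arc lengths telescope along a closed walk. A splitting certifies
    optimality, because adding the two minimalities bounds every common basis from below. Common
    bases have [r + k] elements, and one of them is found greedily without regard to weights. It is
    trivially optimal among its own elements, so no augmentation ever occurs, only exchanges that
    keep the cardinality. One exchange per insertion suffices, so the number of phases does not
    depend on the weights. Indeed, reduced lengths of arcs ending in old elements can be made
    nonnegative; hence a negative cycle must return to the new element, and loops among old elements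
    can be cut out of a walk at no cost. The correction raises the weight of [e] by the amount by
    which the cycle is negative. For the raised weight the old basis is optimal and the cycle costs
    nothing; lowering the weight of [e] again can only favour a basis that contains [e]. *)

Lemma leq_horner (p : {poly nat}) (x y : nat) : x <= y -> p.[x]%R <= p.[y]%R.
Proof.
move=> le_xy; rewrite !horner_coef.
elim/big_ind2: _ => // [a b a' b' ha hb|i _]; first exact: leq_add.
have E (z : nat) : (z ^+ i)%R = z ^ i by elim: (val i) => // j IH; rewrite exprS expnS IH.
by rewrite !E; apply: leq_mul => //; elim: (val i) => // j IH; rewrite !expnS leq_mul.
Qed.

Section PolyBounds.
Variables (A : Type) (dom : A -> Prop) (rho : A -> nat).

Definition pbnd (h : A -> nat) : Prop :=
  exists q : {poly nat}, forall a, dom a -> h a <= q.[rho a]%R.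

Lemma pbnd_le (h' h : A -> nat) :
  pbnd h' -> (forall a, dom a -> h a <= h' a) -> pbnd h.
Proof. by move=> [q Hq] le; exists q => a da; exact: leq_trans (le a da) (Hq a da). Qed.

Lemma pbnd_cst n : pbnd (fun _ => n).
Proof. by exists (n%:P)%R => a _; rewrite hornerC. Qed.

Lemma pbnd_add h1 h2 : pbnd h1 -> pbnd h2 -> pbnd (fun a => h1 a + h2 a).
Proof.
move=> [q1 H1] [q2 H2]; exists (q1 + q2)%R => a da.
by rewrite hornerD leq_add ?H1 ?H2.
Qed.

Lemma pbnd_mul h1 h2 : pbnd h1 -> pbnd h2 -> pbnd (fun a => h1 a * h2 a).
Proof.
move=> [q1 H1] [q2 H2]; exists (q1 * q2)%R => a da.
by rewrite hornerM leq_mul ?H1 ?H2.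
Qed.

Lemma pbnd_horner (p : {poly nat}) h : pbnd h -> pbnd (fun a => p.[h a]%R).
Proof.
move=> [q H]; exists (p \Po q)%R => a da.
by rewrite horner_comp leq_horner ?H.
Qed.

Lemma pbnd_rho : pbnd rho.
Proof. by exists 'X%R => a _; rewrite hornerX. Qed.

Lemma pbnd_S h : pbnd h -> pbnd (fun a => (h a).+1).
Proof. by move=> H; apply: pbnd_le (pbnd_add (pbnd_cst 1) H) _. Qed.

End PolyBounds.

Lemma dsize_gt0 v : 0 < dsize v. Proof. by case: v. Qed.

Lemma runs_dsize p u w t : runs p u w t -> dsize w <= t.
Proof. by elim=> /= *; lia. Qed.

Lemma runs_within_le p u w b b' : runs_within p u w b -> b <= b' -> runs_within p u w b'.
Proof. by move=> [t r le] le'; exists t => //; exact: leq_trans le le'. Qed.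

Section Computable.
Variables (A : Type) (dom : A -> Prop) (rho : A -> nat).

(* Running times bound the sizes of results, so the premise on f need only be established
   once, for the input of the whole program. *)
Definition polyc (f g : A -> data) : Prop :=
  pbnd dom rho (dsize \o f) ->
  exists (p : prog) (t : A -> nat),
    pbnd dom rho t /\ forall a, dom a -> runs_within p (f a) (g a) (t a).

Lemma polyc_bnd f g : polyc f g -> pbnd dom rho (dsize \o f) -> pbnd dom rho (dsize \o g).
Proof.
move=> H /H [p [t [bt Ht]]]; apply: (pbnd_le bt) => a da.
by have [s r le] := Ht a da; exact: leq_trans (runs_dsize r) le.
Qed.

Lemma pc_prim o f g : polyc f g -> pbnd dom rho (fun a => dsize (prim_eval o (g a))) ->
  polyc f (fun a => prim_eval o (g a)).
Proof.
move=> Hg bo bf; have bg := polyc_bnd Hg bf.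
have [p [t [bt Ht]]] := Hg bf.
exists (PSeq p (PPrim o)), (fun a => (t a + (dsize (g a) + dsize (prim_eval o (g a))).+1).+1).
split; first by apply/pbnd_S/pbnd_add => //; apply/pbnd_S/pbnd_add.
move=> a da; have [s r le] := Ht a da.
exists (s + (dsize (g a) + dsize (prim_eval o (g a))).+1).+1; last by lia.
by apply: RunSeq r _; apply: RunPrim.
Qed.

Lemma pc_id f : polyc f f.
Proof.
move=> bf; exists (PPrim OpId), (fun a => (dsize (f a) + dsize (f a)).+1); split.
  by apply/pbnd_S/pbnd_add.
by move=> a da; eexists; first exact: RunPrim.
Qed.

Lemma pc_trans g f h : polyc f g -> polyc g h -> polyc f h.
Proof.
move=> Hg Hh bf; have [p [t [bt Ht]]] := Hg bf.
have [p' [t' [bt' Ht']]] := Hh (polyc_bnd Hg bf).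
exists (PSeq p p'), (fun a => (t a + t' a).+1); split; first exact/pbnd_S/pbnd_add.
move=> a da; have [s r le] := Ht a da; have [s' r' le'] := Ht' a da.
by exists (s + s').+1; [exact: RunSeq r r' | lia].
Qed.

Lemma pc_ext g f g' : (forall a, dom a -> g a = g' a) -> polyc f g -> polyc f g'.
Proof.
move=> E H bf; have [p [t [bt Ht]]] := H bf; exists p, t; split=> // a da.
by rewrite -E //; exact: Ht.
Qed.

Lemma pc_node f g h : polyc f g -> polyc f h -> polyc f (fun a => Node (g a) (h a)).
Proof.
move=> Hg Hh bf; have [p [t [bt Ht]]] := Hg bf; have [p' [t' [bt' Ht']]] := Hh bf.
exists (PFork p p'), (fun a => (t a + t' a + dsize (f a)).+1); split.
  by apply/pbnd_S/pbnd_add => //; apply/pbnd_add.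
move=> a da; have [s r le] := Ht a da; have [s' r' le'] := Ht' a da.
by exists (s + s' + dsize (f a)).+1; [exact: RunFork r r' | lia].
Qed.

Lemma pc_fst f g h : polyc f (fun a => Node (g a) (h a)) -> polyc f g.
Proof.
move=> H bf; apply: (pc_prim (o := OpFst) H) (bf).
by apply: (pbnd_le (polyc_bnd H bf)) => a _ /=; lia.
Qed.

Lemma pc_snd f g h : polyc f (fun a => Node (g a) (h a)) -> polyc f h.
Proof.
move=> H bf; apply: (pc_prim (o := OpSnd) H) (bf).
by apply: (pbnd_le (polyc_bnd H bf)) => a _ /=; lia.
Qed.

Lemma pc_inl f g h k : polyc g k -> polyc f (fun a => Node (g a) (h a)) -> polyc f k.
Proof. by move=> H /pc_fst F; exact: pc_trans F H. Qed.

Lemma pc_inr f g h k : polyc h k -> polyc f (fun a => Node (g a) (h a)) -> polyc f k.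
Proof. by move=> H /pc_snd F; exact: pc_trans F H. Qed.

Lemma pc_left g h k : polyc g k -> polyc (fun a => Node (g a) (h a)) k.
Proof. by move=> H; apply: pc_inl H (@pc_id _). Qed.

Lemma pc_right g h k : polyc h k -> polyc (fun a => Node (g a) (h a)) k.
Proof. by move=> H; apply: pc_inr H (@pc_id _). Qed.

Lemma pc_const f z : polyc f (fun _ => Atom z).
Proof.
move=> bf; apply: (pc_prim (o := OpConst z) (@pc_id f)) (bf).
exact: pbnd_cst.
Qed.

Lemma pc_if f (b : A -> bool) g h :
  polyc f (fun a => enc_bool (b a)) -> polyc f g -> polyc f h ->
  polyc f (fun a => if b a then g a else h a).
Proof.
move=> Hb Hg Hh bf; have [pb [tb [btb Htb]]] := Hb bf.
have [p [t [bt Ht]]] := Hg bf; have [p' [t' [bt' Ht']]] := Hh bf.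
exists (PIf pb p p'), (fun a => (tb a + (t a + t' a) + dsize (f a)).+1); split.
  by apply/pbnd_S/pbnd_add => //; apply/pbnd_add => //; apply/pbnd_add.
move=> a da; have [sb rb leb] := Htb a da.
have [s r le] := Ht a da; have [s' r' le'] := Ht' a da.
case E: (b a) rb => rb.
  by exists (sb + s + dsize (f a)).+1; [exact: RunIfTrue rb _ r | lia].
by exists (sb + s' + dsize (f a)).+1; [exact: RunIfFalse rb _ r' | lia].
Qed.

(** Deliberately crude: with one subadditive bound for sums and products, the size of an arithmetic
    expression is at most the total size of its leaves, counted with multiplicity. *)
Lemma bits_add (x y : int) : bits (x + y) <= bits x + bits y.
Proof.
rewrite /bits; set a := `|x|; set b := `|y|.
have le : `|(x + y)%R| <= a + b by lia.
have [->|s0] := posnP `|(x + y)%R|; first by rewrite trunc_log0; lia.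
have lt1 z : z < 2 ^ (trunc_log 2 z).+1 by apply: trunc_log_ltn.
have /andP [h _] := trunc_log_bounds (isT : 1 < 2) s0.
rewrite addSn ltnS -(@leq_exp2l 2) //; apply: leq_trans h _; apply: (leq_trans le).
have := lt1 a; have := lt1 b; rewrite expnD !expnS.
have := expn_gt0 2 (trunc_log 2 a); have := expn_gt0 2 (trunc_log 2 b).
by nia.
Qed.

Lemma bits_mul (x y : int) : bits (x * y) <= bits x + bits y.
Proof.
rewrite /bits abszM; set a := `|x|; set b := `|y|.
have [->|s0] := posnP (a * b); first by rewrite trunc_log0; lia.
have lt1 z : z < 2 ^ (trunc_log 2 z).+1 by apply: trunc_log_ltn.
have /andP [h _] := trunc_log_bounds (isT : 1 < 2) s0.
rewrite -(@ltn_exp2l 2) //; apply: leq_ltn_trans h _.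
by rewrite expnD ltn_mul.
Qed.

Lemma bits_opp (x : int) : bits (- x) = bits x.
Proof. by rewrite /bits abszN. Qed.

Lemma dsize_add (x y : int) : dsize (Atom (x + y)) <= dsize (Atom x) + dsize (Atom y).
Proof. by rewrite /=; have := bits_add x y; lia. Qed.

Lemma dsize_mul (x y : int) : dsize (Atom (x * y)) <= dsize (Atom x) + dsize (Atom y).
Proof. by rewrite /=; have := bits_mul x y; lia. Qed.

Lemma dsize_bool b : dsize (enc_bool b) = 2.
Proof. by case: b. Qed.

Lemma pc_arith o (op : int -> int -> int) f x y :
  (forall x y, prim_eval o (Node (Atom x) (Atom y)) = Atom (op x y)) ->
  (forall x y, dsize (Atom (op x y)) <= dsize (Atom x) + dsize (Atom y)) ->
  polyc f (fun a => Atom (x a)) -> polyc f (fun a => Atom (y a)) ->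
  polyc f (fun a => Atom (op (x a) (y a))).
Proof.
move=> Eo le Hx Hy; apply: (@pc_ext (fun a => prim_eval o (Node (Atom (x a)) (Atom (y a))))).
  by move=> a _; rewrite Eo.
move=> bf; apply: (pc_prim (o := o) (pc_node Hx Hy)) (bf).
apply: (pbnd_le (pbnd_add (polyc_bnd Hx bf) (polyc_bnd Hy bf))) => a _ /=.
by rewrite Eo le.
Qed.

Lemma pc_add f x y :
  polyc f (fun a => Atom (x a)) -> polyc f (fun a => Atom (y a)) ->
  polyc f (fun a => Atom (x a + y a)%R).
Proof. by apply: (@pc_arith OpAdd +%R) => // *; exact: dsize_add. Qed.

Lemma pc_sub f x y :
  polyc f (fun a => Atom (x a)) -> polyc f (fun a => Atom (y a)) ->
  polyc f (fun a => Atom (x a - y a)%R).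
Proof.
apply: (@pc_arith OpSub (fun x y => x - y)%R) => // u v.
by apply: leq_trans (dsize_add _ _) _; rewrite /= bits_opp.
Qed.

Lemma pc_mul f x y :
  polyc f (fun a => Atom (x a)) -> polyc f (fun a => Atom (y a)) ->
  polyc f (fun a => Atom (x a * y a)%R).
Proof. by apply: (@pc_arith OpMul *%R) => // *; exact: dsize_mul. Qed.

Lemma pc_le f (x y : A -> int) :
  polyc f (fun a => Atom (x a)) -> polyc f (fun a => Atom (y a)) ->
  polyc f (fun a => enc_bool (x a <= y a)%R).
Proof.
move=> Hx Hy bf; apply: (pc_prim (o := OpLeq) (pc_node Hx Hy)) (bf).
by apply: (pbnd_le (pbnd_cst _ _ 2)) => a _; rewrite dsize_bool.
Qed.

Lemma pc_bool f (b : bool) : polyc f (fun _ => enc_bool b).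
Proof. exact: pc_const. Qed.

Lemma pc_boolop (op : bool -> bool -> bool) f (x y : A -> bool) :
  polyc f (fun a => enc_bool (x a)) -> polyc f (fun a => enc_bool (y a)) ->
  polyc f (fun a => enc_bool (op (x a) (y a))).
Proof.
move=> Hx Hy; apply: (@pc_ext (fun a => if x a
    then if y a then enc_bool (op true true) else enc_bool (op true false)
    else if y a then enc_bool (op false true) else enc_bool (op false false))).
  by move=> a _; case: (x a); case: (y a).
by apply: pc_if => //; apply: pc_if => //; apply: pc_bool.
Qed.

Lemma pc_neg f (x : A -> bool) :
  polyc f (fun a => enc_bool (x a)) -> polyc f (fun a => enc_bool (~~ x a)).
Proof. by move=> Hx; apply: (@pc_boolop (fun b _ => ~~ b) _ x x). Qed.

Lemma pc_lt f (x y : A -> int) :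
  polyc f (fun a => Atom (x a)) -> polyc f (fun a => Atom (y a)) ->
  polyc f (fun a => enc_bool (x a < y a)%R).
Proof.
move=> Hx Hy; apply: (@pc_ext (fun a => enc_bool (~~ (y a <= x a)%R))).
  by move=> a _; rewrite ltNge.
by apply: pc_neg; apply: pc_le.
Qed.

Lemma pc_eif f (b : A -> bool) (X : A -> Type) (e : forall a, X a -> data) (x y : forall a, X a) :
  polyc f (fun a => enc_bool (b a)) -> polyc f (fun a => e a (x a)) ->
  polyc f (fun a => e a (y a)) ->
  polyc f (fun a => e a (if b a then x a else y a)).
Proof.
move=> Hb Hx Hy; apply: (@pc_ext (fun a => if b a then e a (x a) else e a (y a))).
  by move=> a _; case: (b a).
exact: pc_if.
Qed.

End Computable.

Lemma dsize_seq_size s : size s < dsize (enc_seq s).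
Proof. by elim: s => //= v s IH; have := dsize_gt0 v; lia. Qed.

Lemma dsize_seq_cat s1 s2 : dsize (enc_seq (s1 ++ s2)) + 2 = dsize (enc_seq s1) + dsize (enc_seq s2).
Proof. by elim: s1 => /= [|v s1 IH]; [rewrite /bits trunc_log0; lia | lia]. Qed.

(** * Loops over lists *)

Section Loops.
Variables (A : Type) (dom : A -> Prop) (rho : A -> nat) (f : A -> data).
Variables (B Acc : A -> Type) (eb : forall a, B a -> data) (ea : forall a, Acc a -> data).
Variables (s : forall a, seq (B a)) (z : forall a, Acc a).
Variable (step : forall a, Acc a -> B a -> Acc a).
Variable (Inv : forall a, nat -> Acc a -> Prop).

(** The body of a loop has to be fast only on accumulators that satisfy the invariant; on arbitrary
    ones its time could not be bounded in terms of [rho]. *)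
Definition loop_dom (x : {a : A & (Acc a * B a)%type}) : Prop :=
  dom (projT1 x) /\ exists p q,
    s (projT1 x) = p ++ (projT2 x).2 :: q /\ Inv (size p) (projT2 x).1.

(** The state of the loop is the remaining list, the environment [f a] and the accumulator. The
    bound [h] must hold uniformly over all rounds: iterating the polynomial size bound of the body
    would not stay polynomial. *)
Lemma pc_foldl :
  polyc dom rho f (fun a => enc_seq [seq eb b | b <- s a]) ->
  polyc dom rho f (fun a => ea (z a)) ->
  (forall a, dom a -> Inv 0 (z a)) ->
  (forall a p b q acc, dom a -> s a = p ++ b :: q -> Inv (size p) acc ->
     Inv (size p).+1 (step acc b)) ->
  (exists2 h, pbnd dom rho h & forall a i acc, dom a -> i <= size (s a) ->
     @Inv a i acc -> dsize (ea acc) <= h a) ->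
  polyc loop_dom (fun x => rho (projT1 x))
    (fun x => Node (f (projT1 x)) (Node (ea (projT2 x).1) (eb (projT2 x).2)))
    (fun x => ea (step (projT2 x).1 (projT2 x).2)) ->
  polyc dom rho f (fun a => ea (foldl (@step a) (z a) (s a))).
Proof.
move=> Hs Hz Inv0 InvS [h bh Hh] Hbody.
pose es a (l : seq (B a)) := enc_seq [seq eb b | b <- l].
pose st a (l : seq (B a)) (acc : Acc a) := Node (es a l) (Node (f a) (ea acc)).
suff loop : polyc dom rho (fun a => st a (s a) (z a))
   (fun a => st a [::] (foldl (@step a) (z a) (s a))).
  apply: (@pc_trans _ _ _ (fun a => st a (s a) (z a))).
    by apply: pc_node => //; apply: pc_node => //; exact: pc_id.
  apply: (pc_trans loop); apply: pc_right; apply: pc_right; exact: pc_id.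
move=> bst.
have bs : pbnd dom rho (fun a => dsize (es a (s a))).
  by apply: (pbnd_le bst) => a _ /=; lia.
have bf : pbnd dom rho (dsize \o f).
  by apply: (pbnd_le bst) => a _ /=; lia.
have suf a (p q : seq (B a)) : s a = p ++ q -> dsize (es a q) <= dsize (es a (s a)).
  move=> ->; have := dsize_seq_cat [seq eb b | b <- p] [seq eb b | b <- q].
  rewrite /es map_cat; have := dsize_seq_size [seq eb b | b <- p].
  case: p => [|b p] /=; first by [].
  by have := dsize_gt0 (eb b); have := dsize_gt0 (enc_seq [seq eb b | b <- p]); lia.
have [|pb [tb [[qb btb] Htb]]] := Hbody.
  have [Q HQ] := pbnd_add bf (pbnd_add bh bs).
  (* The two units pay for the two [Node]s in the argument of the body. *)
  exists (1 + 1 + Q)%R => -[a [acc b]] /= [da [p [q [/= E I]]]].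
  rewrite !hornerD !hornerC; have h1 := HQ a da.
  have {}h2 : dsize (ea acc) <= h a by apply: Hh I => //; rewrite E size_cat leq_addr.
  have h3 := suf a p (b :: q) E.
  have {}h3 : dsize (eb b) < dsize (es a (s a)) by apply: leq_trans h3; rewrite /es /=; lia.
  rewrite -[(_ + Q.[_])%R]/(1 + 1 + Q.[rho a]%R).
  by move: h1 h2 h3 => /=; lia.
pose cond := PSeq (PPrim OpFst) (PPrim OpIsNode).
pose body := PFork (PSeq (PPrim OpFst) (PPrim OpSnd))
  (PFork (PSeq (PPrim OpSnd) (PPrim OpFst))
    (PSeq (PFork (PSeq (PPrim OpSnd) (PPrim OpFst))
            (PFork (PSeq (PPrim OpSnd) (PPrim OpSnd)) (PSeq (PPrim OpFst) (PPrim OpFst)))) pb)).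
(* [N a] bounds the size of every loop state; the factor 100 in [U] absorbs the copying done by
   [cond] and by the wiring of [body]. *)
pose N a := dsize (es a (s a)) + dsize (f a) + h a + 10.
pose U a := 100 * N a + qb.[rho a]%R.
exists (PWhile cond body), (fun a => (size (s a)).+1 * U a); split.
  apply: pbnd_mul.
    by apply: (pbnd_le bs) => a _; have := dsize_seq_size [seq eb b | b <- s a]; rewrite size_map.
  apply: pbnd_add; last by exists qb.
  apply: pbnd_mul (pbnd_cst _ _ _) _; apply: pbnd_add (pbnd_cst _ _ _); apply: pbnd_add => //.
  exact: pbnd_add.
move=> a da.
suff H q : forall p acc, s a = p ++ q -> Inv (size p) acc ->
    runs_within (PWhile cond body) (st a q acc) (st a [::] (foldl (@step a) acc q)) ((size q).+1 * U a).
  by apply: (H _ [::] _ erefl); exact: Inv0.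
elim: q => [|b q IH] p acc E I.
  have le := Hh a (size p) acc da _ I; rewrite E cats0 leqnn in le; have {}le := le isT.
  eexists; first apply: RunWhileFalse.
  - by apply: RunSeq (RunPrim _ _) (RunPrim _ _).
  - by [].
  rewrite mul1n /U /N /st /=.
  by rewrite /bits trunc_log0; lia.
have I' := InvS a p b q acc da E I.
have E' : s a = rcons p b ++ q by rewrite cat_rcons.
have [|t r le] := IH (rcons p b) (step acc b) E'; first by rewrite size_rcons.
have [tB rB leB] : runs_within pb (Node (f a) (Node (ea acc) (eb b))) (ea (step acc b)) qb.[rho a]%R.
  have D : loop_dom (existT (fun a => (Acc a * B a)%type) a (acc, b)).
    by split=> //=; exists p, q.
  have [tB rB leB] := Htb _ D; exists tB => //=.
  exact: leq_trans leB (btb _ D).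
have leacc := Hh a (size p) acc da _ I.
rewrite E size_cat leq_addr in leacc; have {}leacc := leacc isT.
have leacc' := Hh a (size p).+1 (step acc b) da _ I'.
rewrite E size_cat /= addnS ltnS leq_addr in leacc'; have {}leacc' := leacc' isT.
have leb := suf a p (b :: q) E; have leq' := suf a (rcons p b) q E'.
eexists; first apply: RunWhileTrue.
- by apply: RunSeq (RunPrim _ _) (RunPrim _ _).
- by [].
- apply: RunFork; first by apply: RunSeq (RunPrim _ _) (RunPrim _ _).
  apply: RunFork; first by apply: RunSeq (RunPrim _ _) (RunPrim _ _).
  apply: RunSeq rB; apply: RunFork; first by apply: RunSeq (RunPrim _ _) (RunPrim _ _).
  by apply: RunFork; apply: RunSeq (RunPrim _ _) (RunPrim _ _).
- exact: r.
rewrite -[(size (b :: q)).+1]/(size q).+2 mulSn.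
move: leb leq' leacc leacc' le leB; set X := (_.+1 * _); move: (X) => {}X.
by rewrite /U /N /st /es /= /bits /= trunc_log1; lia.
Qed.

End Loops.

(** Environments are nested pairs; this searches for the path to a component that is literally
    present. *)
Ltac lookup := solve [ exact: pc_id | apply: pc_left; lookup | apply: pc_right; lookup ].

(** Transfers a program to loop bodies that see additional data, such as an accumulator. The size of
    [f] must be polynomial on the old domain, since [polyc] promises nothing otherwise. *)
Lemma pc_reindex A (dom : A -> Prop) rho f g A' (dom' : A' -> Prop) rho' (phi : A' -> A) :
  pbnd dom rho (dsize \o f) -> polyc dom rho f g ->
  (forall x, dom' x -> dom (phi x)) -> (forall x, rho (phi x) = rho' x) ->
  polyc dom' rho' (fun x => f (phi x)) (fun x => g (phi x)).
Proof.
move=> bf /(_ bf) [p [t [[q bt] Ht]]] Hd Hr _; exists p, (t \o phi); split.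
  by exists q => x /Hd dx; rewrite -Hr; exact: bt.
by move=> x /Hd; exact: Ht.
Qed.

Lemma dsize_seq_mem p v q : dsize v < dsize (enc_seq (p ++ v :: q)).
Proof. by have := dsize_seq_cat p (v :: q); have := dsize_seq_size p; case: p => //= *; lia. Qed.

Section LoopCorollaries.
Variables (A : Type) (dom : A -> Prop) (rho : A -> nat) (f : A -> data).

Section Grow.
Variables (B Acc : A -> Type) (eb : forall a, B a -> data) (ea : forall a, Acc a -> data).
Variables (s : forall a, seq (B a)) (z : forall a, Acc a).
Variable (step : forall a, Acc a -> B a -> Acc a).
Variable (g : A -> nat).

Definition grow_dom :=
  loop_dom dom s (fun a i (acc : Acc a) => dsize (ea acc) <= dsize (ea (z a)) + i * g a).

(** Growth by at most [g a] per round keeps the accumulator polynomial, as the number of rounds is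
    below the size of the encoded list. *)
Lemma pc_foldl_grow :
  polyc dom rho f (fun a => enc_seq [seq eb b | b <- s a]) ->
  polyc dom rho f (fun a => ea (z a)) ->
  pbnd dom rho g ->
  (forall a p b q acc, dom a -> s a = p ++ b :: q ->
    dsize (ea (step acc b)) <= dsize (ea acc) + g a) ->
  polyc grow_dom (fun x => rho (projT1 x))
    (fun x => Node (f (projT1 x)) (Node (ea (projT2 x).1) (eb (projT2 x).2)))
    (fun x => ea (step (projT2 x).1 (projT2 x).2)) ->
  polyc dom rho f (fun a => ea (foldl (@step a) (z a) (s a))).
Proof.
move=> Hs Hz bg Hg Hbody bf; move: (bf); apply: (pc_foldl Hs Hz _ _ _ Hbody) => //.
- by move=> a _ /=; lia.
- move=> a p b q acc da E I; have := Hg a p b q acc da E; lia.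
exists (fun a => dsize (ea (z a)) + dsize (enc_seq [seq eb b | b <- s a]) * g a).
  by apply: pbnd_add (polyc_bnd Hz bf) _; apply: pbnd_mul bg; exact: polyc_bnd Hs bf.
move=> a i acc da le I; apply: (leq_trans I); rewrite leq_add2l leq_mul2r.
have := dsize_seq_size [seq eb b | b <- s a]; rewrite size_map; lia.
Qed.

End Grow.

Lemma pc_catrev (s t : A -> seq data) :
  polyc dom rho f (fun a => enc_seq (s a)) -> polyc dom rho f (fun a => enc_seq (t a)) ->
  polyc dom rho f (fun a => enc_seq (catrev (s a) (t a))).
Proof.
move=> Hs Ht; apply: (@pc_ext _ _ _ (fun a => enc_seq (foldl (fun acc b => b :: acc) (t a) (s a)))).
  by move=> a _; congr enc_seq; elim: (s a) (t a) => //= x l IH l'; exact: IH.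
move=> bf; move: (bf); apply: (@pc_foldl_grow (fun _ => data) (fun _ => seq data) (fun _ => id) (fun _ => enc_seq)
  s t (fun _ acc b => b :: acc) (fun a => dsize (enc_seq (s a)))) => //.
- by apply: pc_ext Hs => a _; rewrite map_id.
- exact: polyc_bnd Hs bf.
- by move=> a p b q acc _ E /=; have := dsize_seq_mem p b q; rewrite E; lia.
by rewrite /=; apply: pc_node; lookup.
Qed.

Lemma pc_nil : polyc dom rho f (fun _ => enc_seq [::]).
Proof. exact: pc_const. Qed.

Lemma pc_rev (s : A -> seq data) :
  polyc dom rho f (fun a => enc_seq (s a)) -> polyc dom rho f (fun a => enc_seq (rev (s a))).
Proof. by move=> Hs; apply: pc_catrev => //; apply: pc_nil. Qed.

Lemma pc_cat (s t : A -> seq data) :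
  polyc dom rho f (fun a => enc_seq (s a)) -> polyc dom rho f (fun a => enc_seq (t a)) ->
  polyc dom rho f (fun a => enc_seq (s a ++ t a)).
Proof.
move=> Hs Ht; apply: (@pc_ext _ _ _ (fun a => enc_seq (catrev (rev (s a)) (t a)))).
  by move=> a _; rewrite catrevE revK.
by apply: pc_catrev => //; apply: pc_rev.
Qed.

Section Map.
Variables (B : A -> Type) (eb : forall a, B a -> data) (s : forall a, seq (B a)).

Definition map_dom (x : {a : A & B a}) : Prop :=
  dom (projT1 x) /\ exists p q, s (projT1 x) = p ++ projT2 x :: q.

Lemma pbnd_map_env :
  pbnd dom rho (dsize \o f) -> polyc dom rho f (fun a => enc_seq [seq eb b | b <- s a]) ->
  pbnd map_dom (fun x => rho (projT1 x))
   (fun x => dsize (Node (f (projT1 x)) (eb (projT2 x)))).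
Proof.
move=> bf Hs; have [q Hq] := pbnd_add bf (polyc_bnd Hs bf).
exists q => -[a b] /= [da [p' [q' /= E]]]; apply: leq_trans (Hq a da) => /=.
by have := dsize_seq_mem [seq eb b | b <- p'] (eb b) [seq eb b | b <- q']; rewrite E map_cat /=; lia.
Qed.

Lemma pc_map (B' : A -> Type) (eb' : forall a, B' a -> data) (g : forall a, B a -> B' a) :
  polyc dom rho f (fun a => enc_seq [seq eb b | b <- s a]) ->
  polyc map_dom (fun x => rho (projT1 x))
    (fun x => Node (f (projT1 x)) (eb (projT2 x))) (fun x => eb' _ (g _ (projT2 x))) ->
  polyc dom rho f (fun a => enc_seq [seq eb' _ b | b <- [seq g _ b | b <- s a]]).
Proof.
move=> Hs Hg bf; have benv := pbnd_map_env bf Hs; have [q Hq] := polyc_bnd Hg benv.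
(* Consing onto an accumulator yields the images in reverse order. *)
move: bf; apply: (@pc_ext _ _ _ (fun a => enc_seq (rev
   (foldl (fun acc b => eb' _ (g a b) :: acc) [::] (s a))))).
  move=> a _; congr enc_seq; rewrite -map_comp.
  have E l acc : foldl (fun acc b => eb' _ (g a b) :: acc) acc l = catrev (map (eb' a \o g a) l) acc.
    by elim: l acc => //= x l IH acc; rewrite IH.
  by rewrite E -/(rev _) revK.
apply: pc_rev.
apply: (@pc_foldl_grow B (fun _ => seq data) eb (fun _ => enc_seq) s (fun _ => [::])
  (fun a acc b => eb' _ (g a b) :: acc) (fun a => q.[rho a]%R.+1)) => //.
- exact: pc_nil.
- by apply: pbnd_S; exists q.
- move=> a p b q' acc da E /=; have /= := Hq (existT _ a b); rewrite /map_dom /= => /(_ _)/wrap[].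
    by split=> //; exists p, q'.
  by lia.
rewrite /=; apply: pc_node; last by lookup.
pose phi (x : {a : A & (seq data * B a)%type}) := existT B (projT1 x) (projT2 x).2.
apply: (@pc_trans _ _ _ (fun x => Node (f (projT1 x)) (eb (projT2 x).2))).
  by apply: pc_node; lookup.
apply: (pc_reindex (phi := phi) benv Hg) => //.
by move=> [a [acc b]] [/= da [p [q' [/= E _]]]]; split=> //=; exists p, q'.
Qed.

Lemma pc_filter (g : forall a, pred (B a)) :
  polyc dom rho f (fun a => enc_seq [seq eb b | b <- s a]) ->
  polyc map_dom (fun x => rho (projT1 x))
    (fun x => Node (f (projT1 x)) (eb (projT2 x))) (fun x => enc_bool (g _ (projT2 x))) ->
  polyc dom rho f (fun a => enc_seq [seq eb b | b <- s a & g a b]).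
Proof.
move=> Hs Hg bf; have benv := pbnd_map_env bf Hs.
move: (bf); apply: (@pc_ext _ _ _ (fun a => enc_seq (rev
   (foldl (fun acc b => if g a b then eb b :: acc else acc) [::] (s a))))).
  move=> a _; congr enc_seq.
  have E l acc : foldl (fun acc b => if g a b then eb b :: acc else acc) acc l =
      catrev (map (@eb a) (filter (g a) l)) acc.
    by elim: l acc => //= x l IH acc; rewrite IH; case: (g a x).
  by rewrite E -/(rev _) revK.
apply: pc_rev.
apply: (@pc_foldl_grow B (fun _ => seq data) eb (fun _ => enc_seq) s (fun _ => [::])
  (fun a acc b => if g a b then eb b :: acc else acc)
  (fun a => dsize (enc_seq [seq eb b | b <- s a]))) => //.
- exact: pc_nil.
- exact: polyc_bnd Hs bf.
- move=> a p b q' acc da E /=; have := dsize_seq_mem [seq eb b | b <- p] (eb b) [seq eb b | b <- q'].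
  by rewrite E map_cat; case: (g a b) => /=; lia.
rewrite /=; apply: (@pc_eif _ _ _ _ _ (fun _ => seq data) (fun _ => enc_seq)); [|by apply: pc_node; lookup|by lookup].
pose phi (x : {a : A & (seq data * B a)%type}) := existT B (projT1 x) (projT2 x).2.
apply: (@pc_trans _ _ _ (fun x => Node (f (projT1 x)) (eb (projT2 x).2))).
  by apply: pc_node; lookup.
apply: (pc_reindex (phi := phi) benv Hg) => //.
by move=> [a [acc b]] [/= da [p [q' [/= E _]]]]; split=> //=; exists p, q'.
Qed.

End Map.

(** For minimum searches: each step returns one of its arguments, so nothing outgrows the start
    value and the list. *)
Lemma pc_foldl_select (B : A -> Type) (eb : forall a, B a -> data) (s : forall a, seq (B a))
    (z : forall a, B a) (step : forall a, B a -> B a -> B a) :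
  polyc dom rho f (fun a => enc_seq [seq eb _ b | b <- s a]) ->
  polyc dom rho f (fun a => eb _ (z a)) ->
  (forall a x y, step a x y = x \/ step a x y = y) ->
  polyc (grow_dom eb s z (fun a => dsize (enc_seq [seq eb _ b | b <- s a])))
    (fun x => rho (projT1 x))
    (fun x => Node (f (projT1 x)) (Node (eb _ (projT2 x).1) (eb _ (projT2 x).2)))
    (fun x => eb _ (step _ (projT2 x).1 (projT2 x).2)) ->
  polyc dom rho f (fun a => eb _ (foldl (step a) (z a) (s a))).
Proof.
move=> Hs Hz Hstep Hb bf; move: (bf); apply: pc_foldl_grow Hb => //.
- exact: polyc_bnd Hs bf.
move=> a p b q acc _ E.
have := dsize_seq_mem [seq eb _ b | b <- p] (eb _ b) [seq eb _ b | b <- q].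
by rewrite E map_cat /=; case: (Hstep a acc b) => ->; lia.
Qed.

Lemma pc_size (B : A -> Type) (eb : forall a, B a -> data) (s : forall a, seq (B a)) :
  polyc dom rho f (fun a => enc_seq [seq eb _ b | b <- s a]) ->
  polyc dom rho f (fun a => Atom (size (s a))%:Z).
Proof.
move=> Hs; apply: (@pc_ext _ _ _ (fun a => Atom (foldl (fun n _ => n + 1)%R 0%R (s a)))).
  move=> a _; congr Atom; rewrite -[RHS]add0r; move: (0%R : int) => z0.
  elim: (s a) z0 => [|x l IH] z0 /=; first by rewrite addr0.
  by rewrite IH -addrA; congr (_ + _)%R.
apply: (@pc_foldl_grow B (fun _ => int) eb (fun _ => Atom) s (fun _ => 0%R)
  (fun _ n _ => n + 1)%R (fun _ => 3)) => //.
- exact: pc_const.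
- exact: pbnd_cst.
- by move=> a p b q acc _ _; apply: leq_trans (dsize_add _ _) _; rewrite leq_add2l /= /bits trunc_log1.
by apply: pc_add; [lookup | exact: pc_const].
Qed.

(** The fold runs over [s], while [t] is consumed inside the accumulator. *)
Lemma pc_zip (s t : A -> seq data) :
  (forall a, dom a -> size (s a) = size (t a)) ->
  polyc dom rho f (fun a => enc_seq (s a)) -> polyc dom rho f (fun a => enc_seq (t a)) ->
  polyc dom rho f (fun a => enc_seq [seq Node x.1 x.2 | x <- zip (s a) (t a)]).
Proof.
move=> Est Hs Ht.
pose step (acc : seq data * seq data) b := (behead acc.1, Node b (head (Atom 0) acc.1) :: acc.2).
pose ea (acc : seq data * seq data) := Node (enc_seq acc.1) (enc_seq acc.2).
apply: (@pc_ext _ _ _ (fun a => enc_seq (rev (foldl step (t a, [::]) (s a)).2))).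
  move=> a /Est Ea; congr enc_seq.
  have E l l' acc : size l = size l' -> (foldl step (l', acc) l).2 = catrev [seq Node x.1 x.2 | x <- zip l l'] acc.
    by elim: l l' acc => [|x l IH] [|y l'] acc //= [Es]; rewrite IH.
  by rewrite E // -/(rev _) revK.
apply: pc_rev; apply: (@pc_snd _ _ _ _ (fun a => enc_seq (foldl step (t a, [::]) (s a)).1)).
move=> bf; move: (bf).
have bt := polyc_bnd Ht bf; have bs := polyc_bnd Hs bf.
pose M a := dsize (enc_seq (s a)) + dsize (enc_seq (t a)) + 2.
have behead_le l : dsize (enc_seq (behead l)) <= dsize (enc_seq l) by case: l => //= *; lia.
have head_le l : dsize (head (Atom 0) l) <= dsize (enc_seq l) by case: l => //= *; lia.
apply: (@pc_foldl _ _ _ _ (fun _ => data) (fun _ => _) (fun _ => id) (fun _ => ea) s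
  (fun a => (t a, [::])) (fun _ => step)
  (fun a i acc => dsize (enc_seq acc.1) <= dsize (enc_seq (t a)) /\
                  dsize (enc_seq acc.2) <= 2 + i * M a)) => //.
- by apply: pc_ext Hs => a _; rewrite map_id.
- by apply: pc_node => //; exact: pc_nil.
- move=> a p b q [l acc] da E /= [h1 h2].
  have := behead_le l; have := head_le l; have := dsize_seq_mem p b q; rewrite -E mulSn /M.
  by move: h1 h2; rewrite /M; lia.
- exists (fun a => (dsize (enc_seq (t a)) + (2 + dsize (enc_seq (s a)) * M a)).+1).
    apply: pbnd_S; apply: pbnd_add => //; apply: pbnd_add (pbnd_cst _ _ _) _.
    by apply: pbnd_mul => //; apply: pbnd_add (pbnd_cst _ _ _); apply: pbnd_add.
  move=> a i [l acc] da le /= [h1 h2]; rewrite ltnS leq_add //; apply: leq_trans h2 _.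
  by rewrite leq_add2l leq_mul2r; have := dsize_seq_size (s a); lia.
(* The empty list is [Atom 0], which is also the projection of an atom; so [OpSnd] and [OpFst]
   compute [behead] and [head (Atom 0)] on every list. *)
have prj o (F : _ -> seq data) (D : {a : A & (seq data * seq data * data)%type} -> Prop) R h :
    (forall l, dsize (prim_eval o (enc_seq l)) <= dsize (enc_seq l)) ->
    polyc D R h (fun x => enc_seq (F x)) -> polyc D R h (fun x => prim_eval o (enc_seq (F x))).
  by move=> le H bh; move: (bh); apply: pc_prim => //; apply: pbnd_le (polyc_bnd H bh) _ => *; exact: le.
rewrite /=; apply: pc_node.
  apply: (@pc_ext _ _ _ (fun x => prim_eval OpSnd (enc_seq (projT2 x).1.1))).
    by move=> [a [[[|? ?] acc] b]].
  by apply: prj; [case=> //= *; lia | lookup].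
apply: pc_node; last by lookup.
apply: pc_node; first by lookup.
apply: (@pc_ext _ _ _ (fun x => prim_eval OpFst (enc_seq (projT2 x).1.1))).
  by move=> [a [[[|? ?] acc] b]].
by apply: prj; [case=> //= *; lia | lookup].
Qed.

End LoopCorollaries.

(** * Sets as lists of bits *)

Definition enc_bits (s : seq bool) : data := enc_seq [seq enc_bool b | b <- s].

Lemma dsize_bits s : dsize (enc_bits s) = 2 + 3 * size s.
Proof. by rewrite /enc_bits; elim: s => //= -[] s IH; rewrite IH /bits /= ?trunc_log1 ?trunc_log0; lia. Qed.

Lemma dsize_map_le T (e : T -> data) (P : pred T) l b :
  all P l -> (forall x, P x -> dsize (e x) <= b) ->
  dsize (enc_seq [seq e x | x <- l]) <= 2 + size l * b.+1.
Proof.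
by move=> + Pe; elim: l => //= x l IH /andP [/Pe Px /IH]; rewrite mulSn; lia.
Qed.

Definition set_bits m (U : {set 'I_m}) : seq bool := [seq e \in U | e <- enum 'I_m].

Lemma enc_setE m (U : {set 'I_m}) : enc_set U = enc_bits (set_bits U).
Proof. by rewrite /enc_set /enc_bits /set_bits -map_comp. Qed.

Lemma dsize_set m (U : {set 'I_m}) : dsize (enc_set U) = 2 + 3 * m.
Proof. by rewrite enc_setE dsize_bits size_map size_enum_ord. Qed.

(** The bit lists of the singletons, built without reference to indices. *)
Fixpoint unit_bits n : seq (seq bool) :=
  if n is n'.+1 then (true :: nseq n' false) :: [seq false :: b | b <- unit_bits n'] else [::].

Lemma unit_bitsE m : unit_bits m = [seq set_bits [set e] | e <- enum 'I_m].
Proof.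
elim: m => [|m IH]; first by rewrite (size0nil (size_enum_ord 0)).
rewrite /= enum_ordSl /= IH -!map_comp; congr cons.
  rewrite /set_bits enum_ordSl /= in_set1 eqxx -map_comp; congr cons.
  apply: (@eq_from_nth _ false); first by rewrite size_nseq size_map size_enum_ord.
  move=> i; rewrite size_nseq => lt; rewrite nth_nseq lt.
  by rewrite (nth_map (Ordinal lt)) ?size_enum_ord //= in_set1.
apply: eq_map => e /=; rewrite /set_bits enum_ordSl /= in_set1; congr cons.
by rewrite -map_comp; apply: eq_map => x /=; rewrite !in_set1 (inj_eq lift_inj).
Qed.

Section Sets.
Variables (A : Type) (dom : A -> Prop) (rho : A -> nat) (f : A -> data) (m : A -> nat).

Lemma pc_setop (op : bool -> bool -> bool) (U V : forall a, {set 'I_(m a)}) :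
  polyc dom rho f (fun a => enc_set (U a)) -> polyc dom rho f (fun a => enc_set (V a)) ->
  polyc dom rho f (fun a => enc_set [set x | op (x \in U a) (x \in V a)]).
Proof.
move=> HU HV.
pose eb (_ : A) (x : bool * bool) := Node (enc_bool x.1) (enc_bool x.2).
pose s a := [seq (x \in U a, x \in V a) | x <- enum 'I_(m a)].
apply: (@pc_ext _ _ _ (fun a => enc_seq [seq enc_bool b | b <- [seq op x.1 x.2 | x <- s a]])).
  move=> a _; rewrite /enc_set /s -!map_comp; congr enc_seq.
  by apply: eq_map => x /=; rewrite in_set.
apply: (@pc_map _ _ _ _ _ eb s _ (fun _ => enc_bool) (fun _ x => op x.1 x.2)).
  apply: (@pc_ext _ _ _ (fun a => enc_seq [seq Node x.1 x.2 | x <-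
      zip [seq enc_bool (e \in U a) | e <- enum 'I_(m a)] [seq enc_bool (e \in V a) | e <- enum 'I_(m a)]])).
    move=> a _; congr enc_seq; rewrite zip_map -!map_comp.
    exact: eq_map.
  by apply: pc_zip => // a _; rewrite !size_map.
by apply: pc_boolop; lookup.
Qed.

Lemma pc_nonempty (U : forall a, {set 'I_(m a)}) :
  polyc dom rho f (fun a => enc_set (U a)) -> polyc dom rho f (fun a => enc_bool (U a != set0)).
Proof.
move=> HU; apply: (@pc_ext _ _ _ (fun a => enc_bool (foldl orb false (set_bits (U a))))).
  move=> a _; congr enc_bool.
  have E l b : foldl orb b l = b || has id l.
    by elim: l b => [|x l IH] b /=; rewrite ?orbF // IH orbA.
  rewrite E /= has_map; apply/hasP/set0Pn => [[x _ /= Ux]|[x Ux]]; exists x => //.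
  by rewrite mem_enum.
apply: (@pc_foldl_select _ _ _ _ (fun _ => bool) (fun _ => enc_bool)
   (fun a => set_bits (U a)) (fun _ => false) (fun _ => orb)).
- by apply: pc_ext HU => a _; rewrite enc_setE.
- exact: pc_bool.
- by move=> _ [] []; tauto.
by apply: pc_boolop; lookup.
Qed.

Lemma pc_card (U : forall a, {set 'I_(m a)}) :
  polyc dom rho f (fun a => enc_set (U a)) -> polyc dom rho f (fun a => Atom (#|U a|%:Z)).
Proof.
move=> HU; apply: (@pc_ext _ _ _ (fun a => Atom (foldl (fun n (b : bool) => n + (b : nat)%:Z)%R 0%R (set_bits (U a))))).
  move=> a _; congr Atom.
  have E l (z : int) : foldl (fun n (b : bool) => n + (b : nat)%:Z)%R z l = (z + (count id l)%:Z)%R.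
    by elim: l z => [|x l IH] z /=; rewrite ?addr0 // IH PoszD addrA.
  by rewrite E add0r; congr Posz; rewrite count_map cardE -size_filter enumT.
apply: (@pc_foldl_grow _ _ _ _ (fun _ => bool) (fun _ => int) (fun _ => enc_bool) (fun _ => Atom)
  (fun a => set_bits (U a)) (fun _ => 0%R) (fun _ n b => n + (b : nat)%:Z)%R (fun _ => 3)) => //.
- by apply: pc_ext HU => a _; rewrite enc_setE.
- exact: pc_const.
- exact: pbnd_cst.
- by move=> a p [] q acc _ _; apply: leq_trans (dsize_add _ _) _; rewrite leq_add2l /= /bits ?trunc_log1 ?trunc_log0.
by apply: pc_add; lookup.
Qed.

(** The size of the ground set is not an explicit part of the input; a list of that length, such as
    the list of costs, drives the loop. *)
Lemma pc_units (s : A -> seq data) :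
  (forall a, dom a -> size (s a) = m a) ->
  polyc dom rho f (fun a => enc_seq (s a)) ->
  polyc dom rho f (fun a => enc_seq [seq enc_set [set e] | e <- enum 'I_(m a)]).
Proof.
move=> Es Hs.
pose step (acc : seq bool * seq (seq bool)) (_ : data) :=
  (false :: acc.1, (true :: acc.1) :: [seq false :: b | b <- acc.2]).
pose ea (acc : seq bool * seq (seq bool)) := Node (enc_bits acc.1) (enc_seq [seq enc_bits b | b <- acc.2]).
have E l i : foldl step (nseq i false, unit_bits i) l = (nseq (size l + i) false, unit_bits (size l + i)).
  by elim: l i => //= x l IH i; rewrite /step /= -[_ :: nseq _ _]/(nseq i.+1 false) -[_ :: map _ _]/(unit_bits i.+1) IH addnS.
apply: (@pc_ext _ _ _ (fun a => enc_seq [seq enc_bits b | b <- (foldl step ([::], [::]) (s a)).2])).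
  move=> a da; rewrite (E (s a) 0) addn0 Es //= unit_bitsE -map_comp; congr enc_seq.
  by apply: eq_map => e /=; rewrite enc_setE.
apply: (@pc_snd _ _ _ _ (fun a => enc_bits (foldl step ([::], [::]) (s a)).1)).
move=> bf; move: (bf).
apply: (@pc_foldl _ _ _ _ (fun _ => data) (fun _ => _) (fun _ => id) (fun _ => ea) s
  (fun a => ([::], [::])) (fun _ => step)
  (fun a i acc => acc = (nseq i false, unit_bits i))) => //.
- by apply: pc_ext Hs => a _; rewrite map_id.
- by apply: pc_node; exact: pc_nil.
- by move=> a p b q acc _ _ ->.
- exists (fun a => 10 + 10 * dsize (enc_seq (s a)) + 10 * dsize (enc_seq (s a)) * dsize (enc_seq (s a))).
    have bs := polyc_bnd Hs bf; have bc := @pbnd_cst _ dom rho.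
    by apply: pbnd_add; [apply: pbnd_add (bc _) _ | apply: pbnd_mul => //]; apply: pbnd_mul (bc _) _.
  move=> a i acc da le ->; rewrite /ea /= dsize_bits size_nseq.
  have Eu j : size (unit_bits j) = j by rewrite unit_bitsE size_map size_enum_ord.
  have all_i : all (fun b => size b == i) (unit_bits i).
    by rewrite unit_bitsE all_map; apply/allP => e _ /=; rewrite size_map size_enum_ord.
  have := @dsize_map_le _ enc_bits _ _ (2 + 3 * i) all_i.
  rewrite Eu => H; have {}H := H (fun b => ltac:(by move=> /eqP Eb; rewrite dsize_bits Eb)).
  have := dsize_seq_size (s a); move: (dsize _) H => X; move: (dsize _) => S H lt.
  by nia.
rewrite /=; apply: pc_node; first by apply: pc_node; [exact: pc_const | lookup].
apply: pc_node; first by apply: pc_node; [exact: pc_const | lookup].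
apply: (@pc_map _ _ _ _ (fun _ => seq bool) (fun _ => enc_bits) (fun x => (projT2 x).1.2)
   (fun _ => seq bool) (fun _ => enc_bits) (fun _ => cons false)).
  by lookup.
by apply: pc_node; [exact: pc_const | lookup].
Qed.

End Sets.

(** * Matroid exchange *)

Section MatroidExchange.
Variables (E : finType) (N : matroid E).
Implicit Types (A B C F S T U : {set E}) (x y : E).

Lemma indep_extend A B : indep N A -> indep N B -> #|A| <= #|B| ->
  exists C : {set E}, [/\ A \subset C, C \subset A :|: B, indep N C & #|C| = #|B|].
Proof.
move=> IA IB; move Dn: (#|B| - #|A|) => n; elim: n A Dn IA => [|n IH] A Dn IA le.
  by exists A; split=> //; [exact: subsetUl | lia].
have [|e eBA Ie] := indep_augment IA IB; first by lia.
have [eB eA] : e \in B /\ e \notin A by move: eBA; rewrite inE => /andP[].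
have cA : #|e |: A| = #|A|.+1 by rewrite cardsU1 eA.
have [|||C [sAC sC IC EC]] := IH (e |: A); rewrite ?cA //; [by lia|by lia|].
exists C; split=> //; first exact: subset_trans (subsetUr _ _) sAC.
apply: (subset_trans sC); rewrite -setUA; apply/subsetP => z.
by rewrite !inE => /or3P [/eqP ->|->|->]; rewrite ?eB ?orbT.
Qed.

Lemma card_swap B x y : y \in B -> x \notin B -> #|x |: (B :\ y)| = #|B|.
Proof.
move=> yB xB; rewrite cardsU1 !inE (negbTE xB) andbF /= (cardsD1 y B) yB; lia.
Qed.

Lemma swap_form B C x : x \notin B -> x \in C -> C \subset x |: B -> #|C| = #|B| ->
  exists2 y, y \in B :\: C & C = x |: (B :\ y).
Proof.
move=> xB xC sC EC.
have : B :\: C != set0.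
  rewrite setD_eq0; apply/negP => sBC.
  have : x |: B \subset C by rewrite subUset sub1set xC.
  by move/subset_leq_card; rewrite cardsU1 xB; lia.
case/set0Pn => y; rewrite inE => /andP [yC yB]; exists y; first by rewrite inE yC.
apply/eqP; rewrite eqEcard card_swap // EC leqnn andbT.
apply/subsetP => z zC; have := subsetP sC z zC; rewrite !inE.
by case/orP => [->//|zB]; rewrite zB andbT; case: (eqVneq z y) zC yC => [-> -> //|]; rewrite orbT.
Qed.

(** Extending [y |: (S :&: T)] by elements of [S] up to the size of [S] leaves out a single element
    of [S], which must lie outside [T]. *)
Lemma indep_swap S T y : indep N S -> indep N T -> #|S| = #|T| -> y \in T :\: S ->
  exists2 x, x \in S :\: T & indep N (y |: (S :\ x)).
Proof.
move=> IS IT ES; rewrite inE => /andP [yS yT].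
have sA : y |: (S :&: T) \subset T by rewrite subUset sub1set yT subsetIr.
have IA := indep_sub sA IT.
have [C [sAC sC IC EC]] := indep_extend IA IS (leq_trans (subset_leq_card sA) (eq_leq (esym ES))).
have [||||x xSC EC'] := @swap_form S C y => //.
- by apply: (subsetP sAC); rewrite !inE eqxx.
- apply: (subset_trans sC); apply/subsetP => z; rewrite !inE.
  by case/orP => [/orP [->//|/andP [->]]|->]; rewrite orbT.
exists x; last by rewrite -EC'.
move: xSC; rewrite !inE => /andP [xC xS]; rewrite xS andbT; apply: contra xC => xT.
by apply: (subsetP sAC); rewrite !inE xS xT orbT.
Qed.

(** The circuit in [x |: B] already lies in [x |: U] and contains [y]. Instead of circuits, the
    proof extends [x |: (U :\ y)] inside [x |: B] and identifies the one element left out. *)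
Lemma indep_exchange B U x y : indep N B -> U \subset B -> y \in U -> x \notin B ->
  indep N (x |: (U :\ y)) -> ~~ indep N (x |: U) -> indep N (x |: (B :\ y)).
Proof.
move=> IB sU yU xB IU DU; have yB := subsetP sU y yU.
have le : #|x |: (U :\ y)| <= #|B|.
  by rewrite card_swap ?(contra (subsetP sU x)) //; exact: subset_leq_card.
have [C [sAC sC IC EC]] := indep_extend IU IB le.
have xC : x \in C by apply: (subsetP sAC); rewrite !inE eqxx.
have [|z zBC EC'] := swap_form xB xC _ EC.
  apply: (subset_trans sC); apply/subsetP => z; rewrite !inE.
  by case/orP => [/orP [->//|/andP [_ /(subsetP sU) ->]]|->]; rewrite orbT.
suff <- : z = y by rewrite -EC'.
apply/eqP; apply: contraNT DU => ne; apply: indep_sub IC; rewrite EC'.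
apply/subsetP => t; rewrite !inE => /orP [->//|tU]; rewrite (subsetP sU) // andbT.
apply/orP; right; apply: contraTneq zBC => Etz; rewrite inE negb_and negbK -Etz.
by rewrite (subsetP sAC) // !inE tU Etz ne orbT.
Qed.

(** Maximality by cardinality passes at once to any independent set of the same size. *)
Definition spanning_indep B : Prop := indep N B /\ forall S, indep N S -> #|S| <= #|B|.

(** The circuit that [x] closes with the basis [B] consists of [x] and the elements exchangeable for
    it; if it avoids [Ys], it survives their removal. *)
Lemma dep_setD B (Ys : {set E}) x : spanning_indep B -> x \notin B -> 
  (forall y, y \in Ys -> y \in B -> ~~ indep N (x |: (B :\ y))) ->
  ~~ indep N (x |: (B :\: Ys)).
Proof.
move=> [IB maxB] xB HY; apply/negP => I.
have [C [sAC sC IC EC]] := indep_extend I IB (maxB _ I).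
have xC : x \in C by apply: (subsetP sAC); rewrite !inE eqxx.
have [|z] := swap_form xB xC _ EC.
  apply: (subset_trans sC); apply/subsetP => z; rewrite !inE.
  by case/orP => [/orP [->//|/andP [_ ->]]|->]; rewrite orbT.
rewrite inE => /andP [zC zB] EC'.
case: (boolP (z \in Ys)) => [zY|zY].
  by have := HY z zY zB; rewrite -EC' IC.
by case/negP: zC; rewrite (subsetP sAC) // !inE zB zY orbT.
Qed.

Section Weights.
Variable (w : E -> int).

Definition locally_min (F B : {set E}) : Prop := forall y x, y \in B -> x \in F -> x \notin B ->
  indep N (x |: (B :\ y)) -> (w y <= w x)%R.

Lemma sum_swap B x y : y \in B -> x \notin B ->
  (\sum_(e in x |: (B :\ y)) w e = \sum_(e in B) w e - w y + w x)%R.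
Proof.
move=> yB xB; rewrite big_setU1 ?inE ?(negbTE xB) ?andbF //= (big_setD1 y yB) /=; ring.
Qed.

Lemma min_locally_min F B : indep N B -> B \subset F ->
  (forall S, S \subset F -> indep N S -> #|S| = #|B| ->
    (\sum_(e in B) w e <= \sum_(e in S) w e)%R) -> locally_min F B.
Proof.
move=> IB sB minB y x yB xF xB I.
have := minB _ _ I (card_swap yB xB); rewrite sum_swap // => H.
suff : (\sum_(e in B) w e <= \sum_(e in B) w e - w y + w x)%R.
  by rewrite -addrA lerDl addrC subr_ge0.
apply: H; apply/subsetP => z; rewrite !inE => /orP [/eqP ->//|/andP [_ /(subsetP sB)]] //.
Qed.

(* The cheapest element y of B outside S is at most as expensive as every element
   of S outside B, so exchanging y into S never increases the weight of S. *)
Lemma locally_min_min F B S : indep N B -> B \subset F -> locally_min F B ->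
  S \subset F -> indep N S -> #|S| = #|B| ->
  (\sum_(e in B) w e <= \sum_(e in S) w e)%R.
Proof.
move=> IB sB minB; move Dn: (#|B :\: S|) => n; elim: n S Dn => [|n IH] S Dn sS IS ES.
  move/eqP: Dn; rewrite cards_eq0 setD_eq0 => sBS.
  suff -> : B = S by []. 
  by apply/eqP; rewrite eqEcard sBS ES leqnn.
have [y0 y0P] : exists y, y \in B :\: S by apply/set0Pn; rewrite -card_gt0 Dn.
have [y yBS miny] : exists2 y, y \in B :\: S & forall z, z \in B :\: S -> (w y <= w z)%R.
  by case: (@arg_minP _ _ _ y0 (mem (B :\: S)) w y0P) => y; exists y.
have [x xSB Ix] := indep_swap IS IB ES yBS.
have [yS yB] : y \notin S /\ y \in B by move: yBS; rewrite inE => /andP.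
have [xB xS] : x \notin B /\ x \in S by move: xSB; rewrite inE => /andP.
have [y' y'BS Iy'] := indep_swap IB IS (esym ES) xSB.
have y'B : y' \in B by move: y'BS; rewrite inE => /andP [].
have lexy : (w y <= w x)%R.
  exact: le_trans (miny _ y'BS) (minB _ _ y'B (subsetP sS x xS) xB Iy').
have := IH (y |: (S :\ x)); rewrite sum_swap // card_swap // => H.
suff : (\sum_(e in B) w e <= \sum_(e in S) w e - w x + w y)%R.
  by move/le_trans; apply; rewrite -addrA gerDl addrC subr_le0.
apply: H => //.
- have -> : B :\: (y |: (S :\ x)) = (B :\: S) :\ y.
    apply/setP => z; rewrite !inE negb_or negb_and negbK.
    case: (eqVneq z y) => //= _; case: (eqVneq z x) => [->|_] //=.
    by rewrite (negbTE xB) !andbF.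
  by apply: succn_inj; rewrite -Dn (cardsD1 y (B :\: S)) yBS.
- apply/subsetP => z; rewrite !inE => /orP [/eqP ->|/andP [_ /(subsetP sS)] //].
  exact: (subsetP sB).
Qed.

Lemma last_argmin (T : eqType) (v : T -> int) (L : seq T) : L != [::] ->
  exists L1 t L2, [/\ L = L1 ++ t :: L2, {in L1, forall a, (v t <= v a)%R}
    & {in L2, forall a, (v t < v a)%R}].
Proof.
elim: L => // a L IH _; case: (eqVneq L [::]) => [->|/IH [L1 [t [L2 [-> H1 H2]]]]].
  by exists [::], a, [::].
case: (lerP (v t) (v a)) => [le|lt].
  exists (a :: L1), t, L2; split=> // b; rewrite inE => /orP [/eqP ->|] //; exact: H1.
exists [::], a, (L1 ++ t :: L2); split=> // b; rewrite mem_cat inE.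
by case/or3P => [/H1|/eqP ->|/H2] //; lia.
Qed.

Definition swapped B (L : seq (E * E)) : {set E} :=
  (B :\: [set y in unzip1 L]) :|: [set x in unzip2 L].

(* A pair of minimal weight, the last such in L, has no exchange arc from the other
   pairs; hence it can be exchanged after all the others. *)
Lemma exchange_pairs B (L : seq (E * E)) : spanning_indep B ->
  uniq (unzip1 L) -> uniq (unzip2 L) ->
  {in L, forall a, [/\ a.1 \in B, a.2 \notin B, indep N (a.2 |: (B :\ a.1)) & w a.1 = w a.2]} ->
  (forall y x, y \in B -> x \in unzip2 L -> indep N (x |: (B :\ y)) -> (w y <= w x)%R) ->
  pairwise (fun a b => ~~ (indep N (b.2 |: (B :\ a.1)) && (w a.1 == w b.2))) L ->
  [/\ indep N (swapped B L), #|swapped B L| = #|B|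
    & (\sum_(e in swapped B L) w e = \sum_(e in B) w e)%R].
Proof.
move=> spB; move Dn: (size L) => n; elim: n L Dn => [|n IH] L Dn.
  move: (size0nil Dn) => -> *; rewrite /swapped /=.
  suff -> : B :\: [set y in [::]] :|: [set x in [::]] = B by case: spB.
  by apply/setP => z; rewrite !inE orbF.
have : L != [::] by case: (L) Dn.
case/(last_argmin (fun a => w a.1)) => L1 [t [L2 [EL m1 m2]]] u1 u2 HL min2 pwL.
pose L' := L1 ++ L2.
have sL' : subseq L' L by rewrite EL cat_subseq // subseq_cons.
have memL : L =i t :: L' by move=> a; rewrite EL /L' !(mem_cat, inE) orbCA.
have {}Dn : size L' = n by move: Dn; rewrite EL /L' !size_cat /=; lia.
have pL : perm_eq L (t :: L') by rewrite EL perm_catC /= perm_cons perm_catC.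
have [tB1 tB2 It wt] : [/\ t.1 \in B, t.2 \notin B, indep N (t.2 |: (B :\ t.1)) & w t.1 = w t.2].
  by apply: HL; rewrite memL inE eqxx.
have mem1 : unzip1 L =i t.1 :: unzip1 L' by apply/perm_mem/(perm_map _ pL).
have mem2 : unzip2 L =i t.2 :: unzip2 L' by apply/perm_mem/(perm_map _ pL).
have t1' : t.1 \notin unzip1 L' by move: u1; rewrite (perm_uniq (perm_map _ pL)) /= => /andP[].
have t2' : t.2 \notin unzip2 L' by move: u2; rewrite (perm_uniq (perm_map _ pL)) /= => /andP[].
have [|||||I' c' s'] := IH L' Dn.
- exact: subseq_uniq (map_subseq _ sL') u1.
- exact: subseq_uniq (map_subseq _ sL') u2.
- by move=> a aL; apply: HL; rewrite memL inE aL orbT.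
- by move=> y x yB xL; apply: min2 => //; rewrite mem2 inE xL orbT.
- exact: subseq_pairwise sL' pwL.
have notB2 x : x \in unzip2 L' -> x \notin B.
  by case/mapP => a aL ->; have [] := HL a ltac:(by rewrite memL inE aL orbT).
have ES : swapped B L = t.2 |: (swapped B L' :\ t.1).
  apply/setP => z; rewrite !inE !mem1 !mem2 !inE !negb_or.
  case: (eqVneq z t.2) => [->|_] //=; first by rewrite orbT.
  case: (eqVneq z t.1) => [->|_] //=; apply/negP => /notB2; by rewrite tB1.
have t1S : t.1 \in swapped B L' by rewrite !inE (negbTE t1') tB1.
have t2S : t.2 \notin swapped B L' by rewrite !inE (negbTE t2') (negbTE tB2) andbF.
rewrite ES card_swap // sum_swap // c' s' wt; split=> //; last by ring.
(* [U] is the part of [B] left by the other exchanges, and [t.2 |: U] is dependent: a pair of [L1]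
   whose first component were exchangeable for [t.2] would have the weight of [t], which the
   pairwise condition forbids, and the pairs of [L2] are too expensive. *)
apply: (@indep_exchange _ (B :\: [set y in unzip1 L'])) => //.
- exact: subsetUl.
- by rewrite !inE t1' tB1.
- apply: indep_sub It; apply: setUS; apply: setSD; exact: subsetDl.
apply: dep_setD => // y; rewrite inE => /mapP [a aL ->] aB; apply/negP => Ia.
have le : (w a.1 <= w t.2)%R by apply: min2 => //; rewrite mem2 inE eqxx.
move: aL; rewrite mem_cat => /orP [aL1|/m2]; last by rewrite wt ltNge le.
have := m1 a aL1 => le2.
move: pwL; rewrite EL pairwise_cat => /and3P [/allrelP H _ _].
have /H : (t \in t :: L2) by rewrite inE eqxx.
by move/(_ a)/(_ aL1); rewrite Ia eq_le le -wt le2.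
Qed.

End Weights.
End MatroidExchange.

(** * Shortest cycles in the exchange graph *)

Section Walks.
Variables (T : eqType) (ar : rel T) (a : T -> T -> int).

Fixpoint wlen (u : T) (p : seq T) : int :=
  if p is v :: p' then (a u v + wlen v p')%R else 0%R.

Lemma wlen_cat u p q : wlen u (p ++ q) = (wlen u p + wlen (last u p) q)%R.
Proof. by elim: p u => [|v p IH] u /=; rewrite ?add0r // IH addrA. Qed.

Lemma wlen_rcons u p v : wlen u (rcons p v) = (wlen u p + a (last u p) v)%R.
Proof. by rewrite -cats1 wlen_cat /= addr0. Qed.

Section Nonneg.
(** [P] restricts the starts of arcs and [Q] their ends: for distances from a new element, arcs
    returning to it may be negative and are kept out by [Q]. *)
Variables (P Q : pred T).
Hypothesis a_ge0 : forall u v, P u -> Q v -> ar u v -> (0 <= a u v)%R.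
Hypothesis subQP : forall v, Q v -> P v.

Lemma wlen_ge0 u p : path ar u p -> P u -> all Q p -> (0 <= wlen u p)%R.
Proof.
elim: p u => //= v p IH u /andP [auv pv] Pu /andP [Qv Qp].
by rewrite addr_ge0 ?a_ge0 // IH // subQP.
Qed.

Lemma wlen_eq0 u p : path ar u p -> P u -> all Q p -> wlen u p = 0%R ->
  path (fun u v => ar u v && (a u v == 0%R)) u p.
Proof.
elim: p u => //= v p IH u /andP [auv pv] Pu /andP [Qv Qp].
have := a_ge0 Pu Qv auv; have := wlen_ge0 pv (subQP Qv) Qp => h1 h2 h3.
by rewrite auv /= IH ?subQP // ?andbT; [apply/eqP|]; move: h1 h2 h3; clear; lia.
Qed.

(** Cutting out a loop deletes a closed stretch of nonnegative length. The last clause records that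
    any cut lowers the number of vertices, which later shows that a cycle with fewest arcs is
    simple. *)
Lemma shorten_walk u p : path ar u p -> P u -> all Q p ->
  exists p', [/\ path ar u p', last u p' = last u p, uniq (u :: p') && all Q p',
    (wlen u p' <= wlen u p)%R & p' = p \/ size p' < size p].
Proof.
elim: p u => [|v p IH] u; first by exists [::]; split=> //; left.
rewrite [path _ _ _]/= [all _ _]/= => /andP [auv pv] Pu /andP [Qv Qp].
have a0 := a_ge0 Pu Qv auv.
have [p' [pp' lp' /andP [up' Qp'] wp' sp']] := IH v pv (subQP Qv) Qp.
case: (boolP (u \in v :: p')) => [|uN]; last first.
  exists (v :: p'); split.
  - by rewrite /= auv.
  - exact: lp'.
  - by rewrite cons_uniq uN up' /= Qv.
  - by rewrite /= lerD2l.
  by case: sp' => [->|lt]; [left | right].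
have w0 := wlen_ge0 pp' (subQP Qv) Qp'.
rewrite inE; case: eqP => [E _|_ /= uI].
  subst v; exists p'; split=> //; [by rewrite up' | by move: wp' a0; rewrite /=; clear; lia |].
  by right; case: sp' => [->|] /=; clear; lia.
case/splitPr: uI pp' lp' up' Qp' wp' sp' w0 => p1 p2.
rewrite cat_path wlen_cat last_cat /= => /and3P [pp1 au1 pp2] lp' up' Qp' wp' sp' _.
have /andP [Qp1 /andP [Qu Qp2]] : all Q p1 && all Q (u :: p2) by rewrite -all_cat.
exists p2; split=> //.
- by move: up' => /andP [_]; rewrite cat_uniq /= => /and3P [_ _ ->].
- have := wlen_ge0 pp1 (subQP Qv) Qp1; have Ql : P (last v p1).
    by have := mem_last v p1; rewrite inE => /orP [/eqP ->|/(allP Qp1)]; exact: subQP.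
  by have := a_ge0 Ql Qu au1; move: wp' a0; rewrite /=; clear; lia.
by right; case: sp'=> [<-|]; rewrite !size_cat /=; clear; lia.
Qed.

End Nonneg.

(** Arc number [i] of the walk starts at [nth u (u :: q) i] and ends at [nth u q i]; the shortcut
    replaces the arcs [i] to [j]. *)
Lemma path_shortcut u q i j : path ar u q -> i <= j -> j < size q ->
  ar (nth u (u :: q) i) (nth u q j) -> path ar u (take i q ++ drop j q).
Proof.
move=> pq le lt ar_ij.
have lq k : k <= size q -> last u (take k q) = nth u (u :: q) k.
  move=> lek; rewrite (last_nth u) size_takel //; case: k lek => //= k lek.
  by rewrite nth_take.
rewrite cat_path take_path //= lq ?(leq_trans le) 1?ltnW // (drop_nth u lt) /= ar_ij /=.
move: pq; rewrite -{1}(cat_take_drop j.+1 q) cat_path => /andP [_].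
by rewrite lq.
Qed.

End Walks.

(** * The Bellman-Ford search for a negative exchange cycle *)

Section Algorithm.
Variables (G : finType) (I1 I2 : {set G} -> bool) (W : G -> int).
Implicit Types (B S : {set G}) (F : seq G).

Definition symd (A B : {set G}) : {set G} := [set x | (x \in A) (+) (x \in B)].

(* The summand 1 counts the arcs; W will consist of multiples of a large number. *)
Definition vcost B (v : G) : int := (if v \in B then 1 - W v else 1 + W v)%R.

(** Arcs out of [B] are exchanges in the first matroid, arcs into [B] exchanges in the second. With
    symmetric differences both kinds test the same set. *)
Definition exarc B : rel G := fun u v =>
  let S := symd (symd B [set u]) [set v] in
  if u \in B then (v \notin B) && I1 S else (v \in B) && I2 S.

(* (true, (c, S)) stands for a walk of cost c from the inserted element; S is the set of
   vertices that it visits an odd number of times. *)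
Definition entry : Type := (bool * (int * {set G}))%type.

Definition cand B (x : entry) (u v : G) : entry :=
  (x.1 && exarc B u v, ((x.2.1 + vcost B v)%R, symd x.2.2 [set v])).

Definition min_entry (x y : entry) : entry :=
  if y.1 && (~~ x.1 || (y.2.1 < x.2.1)%R) then y else x.

(** A walk is either a single arc from [e] or a recorded walk prolonged by an arc; including the
    first kind in every round makes the empty table a correct start. *)
Definition relax B e F (T : seq (G * entry)) : seq (G * entry) :=
  [seq (v, foldl min_entry (cand B (true, (vcost B e, [set e])) e v)
             [seq cand B x.2 x.1 v | x <- T]) | v <- F].

(** The start value is the empty exchange of cost 0, which is kept unless some cycle is strictly
    negative. *)
Definition best_cycle B e (T : seq (G * entry)) : entry :=
  foldl min_entry (true, (0%R, set0)) [seq (x.2.1 && exarc B x.1 e, x.2.2) | x <- T].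

(** The list [V] acts as a counter of rounds. *)
Definition phase (V : seq G) B e F : {set G} :=
  symd B (best_cycle B e (foldl (fun T _ => relax B e F T) [::] V)).2.2.

Definition intersection_step V (BF : {set G} * seq G) e : {set G} * seq G :=
  (phase V BF.1 e BF.2, e :: BF.2).

Definition min_common_basis (V : seq G) B0 : {set G} :=
  (foldl (intersection_step V) (B0, [seq v <- V | v \in B0]) [seq v <- V | v \notin B0]).1.

Lemma foldl_min_entryP (z : entry) (l : seq entry) :
  let r := foldl min_entry z l in
  [/\ r = z \/ r \in l /\ (z.1 -> r.1 /\ (r.2.1 < z.2.1)%R),
      (z.1 -> r.1 /\ (r.2.1 <= z.2.1)%R) &
      forall x, x \in l -> x.1 -> r.1 /\ (r.2.1 <= x.2.1)%R].
Proof.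
elim: l z => [|y l IH] z /=; first by split; [left | | ].
have [h1 h2 h3] := IH (min_entry z y); set r := foldl _ _ _ in h1 h2 h3 *.
rewrite /min_entry in h1 h2; case: ifP h1 h2 => [/andP [y1 c]|c] h1 h2.
  have [r1 ry] := h2 y1; split.
  - right; split.
      by case: h1 => [->|[h _]]; rewrite inE ?eqxx // h orbT.
    by move=> z1; rewrite z1 in c; split=> //; exact: le_lt_trans ry c.
  - by move=> z1; rewrite z1 in c; split=> //; exact: le_trans ry (ltW c).
  by move=> x; rewrite inE => /orP [/eqP -> //|]; exact: h3.
split=> //.
- by case: h1 => [->|[h h']]; [left | right; rewrite inE h orbT].
- move=> x; rewrite inE => /orP [/eqP -> y1|]; last exact: h3.
  move: c; rewrite y1 /=; case z1: (z.1) => //= c.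
  have [? le] := h2 z1; split=> //; apply: le_trans le _.
  by rewrite leNgt c.
Qed.

Lemma arc_irr B e : exarc B e e = false.
Proof. by rewrite /exarc; case: (e \in B). Qed.

Lemma arc_flip B u v : exarc B u v -> (v \in B) = (u \notin B).
Proof. by rewrite /exarc; case: (u \in B) => /andP [] // /negbTE. Qed.

Section BellmanFord.
Variables (B : {set G}) (e : G) (F : seq G).

Definition walk p := path (exarc B) e p && all (mem F) p.
Definition closed_walk p := path (exarc B) e (rcons p e) && all (mem F) p.
Definition walk_cost p : int := foldl (fun c v => c + vcost B v)%R (vcost B e) p.
Definition walk_mask p : {set G} := foldl (fun S v => symd S [set v]) [set e] p.

Let T i := iter i (relax B e F) [::].

Lemma walk_rcons p v : walk (rcons p v) = [&& walk p, exarc B (last e p) v & v \in F].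
Proof. by rewrite /walk rcons_path all_rcons /=; case: path; case: all; rewrite ?andbF //= andbT. Qed.

(** The walk may repeat vertices, so the mask counts visits modulo two; that the chosen cycle is
    simple follows later from its minimality. *)
Lemma table_sound i x : x \in T i -> x.2.1 ->
  exists p, [/\ walk p, last e p = x.1 & x.2.2 = (walk_cost p, walk_mask p)].
Proof.
elim: i x => // i IH x /mapP [v vF ->] /=.
set z := cand _ _ e v; set l := map _ _.
have [h _ _] := foldl_min_entryP z l; case: h => [->|[]].
  rewrite /z /= => av; exists [:: v]; split=> //.
  by rewrite /walk /= av vF.
move=> /mapP [y /IH {}IH ->] _ /= /andP [/IH [p [wp lp ->]] ay].
exists (rcons p v); split; last by rewrite /walk_cost /walk_mask !foldl_rcons.
  by rewrite walk_rcons wp lp ay vF.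
by rewrite last_rcons.
Qed.

Lemma table_complete i p : walk p -> p != [::] -> size p <= i ->
  exists x, [/\ x \in T i, x.1 = last e p, x.2.1 & (x.2.2.1 <= walk_cost p)%R].
Proof.
elim: i p => [|i IH]; first by case.
case/lastP => // p v; rewrite walk_rcons => /and3P [wp ap vF] _.
rewrite size_rcons ltnS => le.
set z := cand B (true, (vcost B e, [set e])) e v.
set l := [seq cand B x.2 x.1 v | x <- T i].
exists (v, foldl min_entry z l); split=> /=.
- by apply/mapP; exists v.
- by rewrite last_rcons.
- have [_ h2 h3] := foldl_min_entryP z l.
  case: (eqVneq p [::]) ap => [->|p0] ap; first by case: (h2 _).
  have [x [xT xl x1 _]] := IH p wp p0 le.
  by case: (h3 (cand B x.2 x.1 v)) => //=; [apply: map_f | rewrite x1 xl].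
have [_ h2 h3] := foldl_min_entryP z l; rewrite /walk_cost foldl_rcons.
case: (eqVneq p [::]) ap => [->|p0] ap; first by case: (h2 _).
have [x [xT xl x1 xc]] := IH p wp p0 le.
case: (h3 (cand B x.2 x.1 v)) => //=; [by apply: map_f | by rewrite x1 xl|].
by move=> _ /le_trans; apply; rewrite lerD2r.
Qed.

Lemma closed_walkE p : closed_walk p = walk p && exarc B (last e p) e.
Proof. by rewrite /closed_walk /walk rcons_path andbAC. Qed.

Lemma best_cycleP i : let r := best_cycle B e (T i) in
  (r.2 = (0%R, set0) /\
     forall p, closed_walk p -> size p <= i -> (0 <= walk_cost p)%R) \/
  exists p, [/\ closed_walk p, r.2 = (walk_cost p, walk_mask p), (walk_cost p < 0)%R &
     forall p', closed_walk p' -> size p' <= i -> (walk_cost p <= walk_cost p')%R].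
Proof.
rewrite /best_cycle; set z : entry := (true, (0%R, set0)).
set l := map _ _; have [h1 h2 h3] := foldl_min_entryP z l.
have compl p : closed_walk p -> size p <= i -> ((foldl min_entry z l).2.1 <= walk_cost p)%R.
  rewrite closed_walkE => /andP [wp ap] le.
  have p0 : p != [::] by apply: contraTneq ap => ->; rewrite /= arc_irr.
  have [x [xT xl x1 xc]] := table_complete wp p0 le.
  apply: le_trans xc; have [] := h3 (x.2.1 && exarc B x.1 e, x.2.2) _ _ => //.
    exact: (map_f (fun x => (x.2.1 && exarc B x.1 e, x.2.2))).
  by rewrite x1 xl.
case: h1 => [E|[]].
  by left; rewrite E; split=> // p cp le; have := compl p cp le; rewrite E.
move=> rl /(_ isT) [r1 r2]; right; set r := foldl _ _ _ in rl r1 r2 compl *.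
case/mapP: rl => x xT Er; move: r1; rewrite Er /= => /andP [x1 ax].
have [p [wp lp Ep]] := table_sound xT x1.
exists p; split=> //.
- by rewrite closed_walkE wp lp.
- by move: r2; rewrite Er Ep.
by move=> p' cp' le; have := compl p' cp' le; rewrite Er Ep.
Qed.

End BellmanFord.

End Algorithm.

(** * Weighted matroid intersection *)

(** An arc count below [K] cannot reverse the comparison of the scaled parts. *)
Lemma scaled_le (K s t : nat) (x y : int) :
  (K%:Z * x + s%:Z <= K%:Z * y + t%:Z)%R -> t < K -> (x <= y)%R.
Proof. by move=> h lt; rewrite leNgt; apply/negP => lt'; nia. Qed.

Lemma symd_swap (G : finType) (B : {set G}) u v : u \in B -> v \notin B ->
  symd (symd B [set u]) [set v] = v |: (B :\ u).
Proof.
move=> uB vB; apply/setP => z; rewrite !inE.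
case: (eqVneq z v) => [->|_]; rewrite ?(negbTE vB) /= ?addbF.
  by case: (eqVneq v u) => // E; rewrite E uB in vB.
by case: (eqVneq z u) => [->|_] /=; rewrite ?uB ?addbF.
Qed.

Lemma symdAC (G : finType) (A B C : {set G}) : symd (symd A B) C = symd (symd A C) B.
Proof. by apply/setP => z; rewrite !inE addbAC. Qed.

Lemma pairwise_rev (T : Type) (r : rel T) (s : seq T) :
  pairwise r (rev s) = pairwise (fun x y => r y x) s.
Proof. by elim: s => //= x s IH; rewrite rev_cons -cats1 pairwise_cat IH allrel1r all_rev /= andbT. Qed.

Section Phase.
Variables (G : finType) (N1 N2 : matroid G) (w : G -> int) (K : nat).
Hypothesis big_K : #|G| < K.

Implicit Types (B F : {set G}).

Let W v : int := (K%:Z * w v)%R.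
Notation arcN := (exarc (indep N1) (indep N2)).

Lemma arc_out B u v : u \in B -> arcN B u v = (v \notin B) && indep N1 (v |: (B :\ u)).
Proof.
by move=> uB; rewrite /exarc uB; case: (boolP (v \in B)) => //= vB; rewrite symd_swap.
Qed.

Lemma arc_in B u v : u \notin B -> arcN B u v = (v \in B) && indep N2 (u |: (B :\ v)).
Proof.
move=> uB; rewrite /exarc (negbTE uB); case: (boolP (v \in B)) => //= vB.
by rewrite symdAC symd_swap.
Qed.

(** The optimality certificate carried through the insertions. *)
Definition split_min (F : {set G}) (B : {set G}) (w1 w2 : G -> int) : Prop :=
  [/\ forall v, (w1 v + w2 v = w v)%R, locally_min N1 w1 F B & locally_min N2 w2 F B].

(** The reduced length of an arc; it is nonnegative on all arcs within [F] exactly if [B] is locally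
    minimal in both matroids. *)
Definition red B (w1 w2 : G -> int) (u v : G) : int :=
  (if u \in B then w1 v - w1 u else w2 u - w2 v)%R.

Lemma split_min_arc F B w1 w2 u v : B \subset F -> split_min F B w1 w2 ->
  u \in F -> v \in F -> arcN B u v -> (0 <= red B w1 w2 u v)%R.
Proof.
move=> sB [_ m1 m2] uF vF; rewrite /red; case: (boolP (u \in B)) => uB.
  by rewrite arc_out // => /andP [vB I]; rewrite subr_ge0; exact: m1 I.
by rewrite arc_in // => /andP [vB I]; rewrite subr_ge0; exact: m2 I.
Qed.

Lemma arc_locally_min F B w1 w2 : B \subset F ->
  (forall u v, u \in F -> v \in F -> arcN B u v -> (0 <= red B w1 w2 u v)%R) ->
  locally_min N1 w1 F B /\ locally_min N2 w2 F B.
Proof.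
move=> sB H; split=> y x yB xF xB I.
  have := H y x (subsetP sB y yB) xF; rewrite arc_out // xB I /red yB subr_ge0; exact.
have := H x y xF (subsetP sB y yB); rewrite arc_in // yB I /red (negbTE xB) subr_ge0; exact.
Qed.

(** * Distances from the inserted element *)

Section Distances.
Variables (B : {set G}) (e : G) (F : seq G) (w1 w2 : G -> int).
Hypothesis eF : e \notin F.
Hypothesis sBF : {subset B <= F}.
Hypothesis w12 : forall v, (w1 v + w2 v = w v)%R.
Let a := red B w1 w2.
Hypothesis a_ge0 : forall u v, u \in e :: F -> v \in F -> arcN B u v -> (0 <= a u v)%R.

Let eB : e \notin B. Proof. by apply: contra eF; exact: sBF. Qed.

Notation walkN := (walk (indep N1) (indep N2) B e F).
Notation closedN := (closed_walk (indep N1) (indep N2) B e F).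
Notation cost := (walk_cost W B e).

(** The weight of a vertex splits into [w1] and [w2], one charged to the arc entering it and the
    other to the arc leaving it; only the two ends of the walk are left over. *)
Lemma walk_costE p : path (arcN B) e p ->
  cost p = (K%:Z * (w1 e + wlen a e p + (if last e p \in B then - w1 (last e p) else w2 (last e p)))
            + (size p).+1%:Z)%R.
Proof.
pose en v : int := (if v \in B then - w1 v else w2 v)%R.
have H u q (A c : int) : path (arcN B) u q ->
    foldl (fun c v => c + vcost W B v)%R (K%:Z * (A + en u) + c)%R q =
    (K%:Z * (A + wlen a u q + en (last u q)) + c + (size q)%:Z)%R.
  elim: q u A c => [|v q IH] u A c /=; first by rewrite !addr0.
  case/andP => auv pq.
  have -> : (K%:Z * (A + en u) + c + vcost W B v = K%:Z * ((A + a u v) + en v) + (c + 1))%R.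
    have := arc_flip auv; rewrite /en /vcost /W -(w12 v) /a /red.
    by case: (u \in B) => /= ->; ring.
  rewrite IH //; rewrite -[(size q).+1]addn1 PoszD; ring.
move=> pp; rewrite /walk_cost.
have -> : vcost W B e = (K%:Z * (w1 e + en e) + 1)%R.
  by rewrite /vcost /en (negbTE eB) /W w12 addrC.
by rewrite H // -addn1 PoszD /en; ring.
Qed.

(** On a closed walk the end terms cancel, so the cost computed from [w] alone gives the reduced
    length for every splitting. *)
Lemma closed_costE p : closedN p ->
  cost p = (K%:Z * wlen a e (rcons p e) + (size p).+1%:Z)%R.
Proof.
rewrite closed_walkE => /andP [/andP [pp _] al]; rewrite walk_costE // wlen_rcons.
have := arc_flip al; rewrite (negbTE eB) => /esym/negbFE lB; rewrite lB /a /red lB; ring.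
Qed.

Lemma shorten p : walkN p -> exists p', [/\ walkN p', last e p' = last e p,
  uniq (e :: p') & (wlen a e p' <= wlen a e p)%R /\ (p' = p \/ size p' < size p)].
Proof.
case/andP => pp Fp.
have [||p' [pp' lp' /andP [up' Fp'] wp' sp']] := @shorten_walk _ _ a (mem (e :: F)) (mem F) a_ge0 _ e p pp _ Fp.
- by move=> v vF; apply: mem_behead.
- by rewrite /= inE eqxx.
by exists p'; split=> //; rewrite /walk pp'.
Qed.

Lemma uniq_size p : uniq (e :: p) -> (size p).+1 <= #|G|.
Proof. by move=> u; rewrite -[(size p).+1]/(size (e :: p)) -(card_uniqP u) max_card. Qed.

Lemma shorten_closed p : closedN p -> exists p', [/\ closedN p', uniq (e :: p'), (size p').+1 <= #|G|
  & (wlen a e (rcons p' e) <= wlen a e (rcons p e))%R /\ (p' = p \/ size p' < size p)].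
Proof.
rewrite closed_walkE => /andP [wp al]; have [p' [wp' lp' up' [le sp']]] := shorten wp.
exists p'; split=> //; first by rewrite closed_walkE wp' lp' al.
  exact: uniq_size.
by rewrite !wlen_rcons lp' lerD2r.
Qed.

(** Walks can be made simple without getting longer, and after [#|G|] rounds the table covers all
    simple ones; the arc counts contained in its costs are removed by [scaled_le]. *)
Lemma min_walk v : v \in F ->
  (exists p, [/\ walkN p, last e p = v & forall p', walkN p' -> last e p' = v -> (wlen a e p <= wlen a e p')%R])
  \/ (forall p, walkN p -> last e p <> v).
Proof.
move=> vF; set T := iter #|G| (relax (indep N1) (indep N2) W B e F) [::].
have ne p : walkN p -> last e p = v -> p != [::].
  by move=> _ lp; apply: contraNneq eF => p0; move: lp vF; rewrite p0 /= => ->.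
case: (boolP (has (fun x => (x.1 == v) && x.2.1) T)) => [/hasP [x xT /andP [/eqP xv x1]]|/hasPn noT].
  pose P (x : G * entry G) := (x.1 == v) && x.2.1.
  have [y [yT yv y1 yc]] : exists y, [/\ y \in T, y.1 = v, y.2.1 &
      forall z, z \in T -> z.1 = v -> z.2.1 -> (y.2.2.1 <= z.2.2.1)%R].
    have : filter P T != [::] by rewrite -has_filter; apply/hasP; exists x; rewrite /P ?xv ?eqxx.
    case/(last_argmin (fun x => x.2.2.1)) => L1 [y [L2 [EL m1 m2]]].
    have : y \in filter P T by rewrite EL mem_cat mem_head orbT.
    rewrite mem_filter => /andP [/andP [/eqP yv y1] yT]; exists y; split=> // z zT zv z1.
    have : z \in filter P T by rewrite mem_filter /P zv eqxx z1.
    by rewrite EL mem_cat inE => /or3P [/m1|/eqP ->|/m2/ltW].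
  left; have [p [wp lp Ep]] := table_sound yT y1.
  exists p; split=> //; first by rewrite lp.
  move=> p' wp' lp'; have [q [wq lq uq [le sq]]] := shorten wp'.
  apply: le_trans le.
  have [|z [zT zl z1 zc]] := table_complete W wq (ne _ wq (etrans lq lp')) (i := #|G|).
    by apply: ltnW; exact: uniq_size.
  have := le_trans (yc z zT (etrans zl (etrans lq lp')) z1) zc.
  rewrite Ep /=.
  move: wp wq => /andP [pp _] /andP [pq _].
  rewrite !walk_costE // lq lp' lp yv => H.
  have := scaled_le H (leq_ltn_trans (uniq_size uq) big_K).
  by rewrite !lerD2r lerD2l.
right=> p wp lp; have [q [wq lq uq _]] := shorten wp.
have [|z [zT zl z1 zc]] := table_complete W wq (ne _ wq (etrans lq lp)) (i := #|G|).
  by apply: ltnW; exact: uniq_size.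
by have := noT z zT; rewrite zl lq lp eqxx z1.
Qed.

Lemma walk_last p : walkN p -> last e p \in e :: F.
Proof.
case/andP => _ Fp; have := mem_last e p; rewrite !inE => /orP [->//|/(allP Fp) /= ->].
by rewrite orbT.
Qed.

(** Shortest distances, with one common value above [X] and above all distances for the unreachable
    vertices; this keeps the triangle inequality on arcs that leave them. *)
Lemma potentials (X : int) : exists d : G -> int, [/\ d e = 0%R,
  forall u v, u \in e :: F -> v \in F -> arcN B u v -> (d v <= d u + a u v)%R &
  forall u, u \in F -> (exists p, [/\ walkN p, last e p = u & wlen a e p = d u]) \/ (X <= d u)%R].
Proof.
pose P v (o : option int) := if o is Some c then
    (exists p, [/\ walkN p, last e p = v & wlen a e p = c]) /\
    (forall p, walkN p -> last e p = v -> (c <= wlen a e p)%R)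
  else forall p, walkN p -> last e p <> v.
have /fin_all_exists [o oP] v : exists o, P v o.
  case: (boolP (v \in F)) => vF.
    case: (min_walk vF) => [[p [wp lp mp]]|no]; last by exists None.
    by exists (Some (wlen a e p)); split=> //; exists p.
  case: (eqVneq v e) => [->|ve]; last first.
    exists None => p wp lp; have := walk_last wp.
    by rewrite lp inE (negbTE ve) (negbTE vF).
  exists (Some 0%R); split; first by exists [::].
  case/lastP => // p x; rewrite walk_rcons last_rcons => /and3P [_ _ xF] xe.
  by rewrite xe (negbTE eF) in xF.
pose D := (`|X| + \sum_v `|odflt 0 (o v)|)%R.
have leD v : (odflt 0 (o v) <= D)%R.
  rewrite /D (bigD1 v) //=; apply: le_trans (ler_norm _) _.
  rewrite addrCA lerDl addr_ge0 //; apply: sumr_ge0 => *; exact: normr_ge0.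
have XD : (X <= D)%R.
  apply: le_trans (ler_norm _) _; rewrite lerDl; apply: sumr_ge0 => *; exact: normr_ge0.
exists (fun v => odflt D (o v)); split.
- have := oP e; case: (o e) => [c /= [[p [wp lp <-]] H]|/(_ [::])] //; last by case.
  have le0 := H [::] isT erefl; rewrite /= in le0.
  apply/eqP; rewrite eq_le le0 /=.
  clear H le0; move: wp lp; case/lastP: p => // p x; rewrite walk_rcons last_rcons => /and3P [_ _ xF] xe.
  by rewrite xe (negbTE eF) in xF.
- move=> u v uF vF auv; have a0 := a_ge0 uF vF auv.
  have := oP u; have leDv := leD v; have := oP v.
  case: (o v) leDv => [cv|] /= leDv Hv; case: (o u) => [cu|] /= Hu.
  + case: Hu => [[p [wp lp Ep]] _]; case: Hv => _ /(_ (rcons p v)).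
    by rewrite walk_rcons last_rcons wp lp auv vF wlen_rcons lp Ep; exact.
  + by apply: le_trans leDv _; rewrite lerDl.
  + case: Hu => [[p [wp lp Ep]] _]; case: (Hv (rcons p v)).
      by rewrite walk_rcons wp lp auv vF.
    by rewrite last_rcons.
  + by rewrite lerDl.
move=> u _; have := oP u; case: (o u) => [c [[p Hp] _]|_]; last by right.
by left; exists p.
Qed.

End Distances.

(** * Inserting one element *)

Section Step.
Variables (B : {set G}) (e : G) (F : seq G).
Hypothesis eF : e \notin F.
Hypothesis sBF : {subset B <= F}.
Hypotheses (sp1 : spanning_indep N1 B) (sp2 : spanning_indep N2 B).

Let eB : e \notin B. Proof. by apply: contra eF; exact: sBF. Qed.
Let F' : {set G} := [set v in e :: F].
Let sBF' : B \subset F'.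
Proof. by apply/subsetP => v /sBF vF; rewrite !inE vF orbT. Qed.

Notation closedN := (closed_walk (indep N1) (indep N2) B e F).

Lemma split_extend w1 w2 : split_min [set v in F] B w1 w2 ->
  exists w1 w2 : G -> int, (forall v, (w1 v + w2 v = w v)%R) /\
   forall u v, u \in e :: F -> v \in F -> arcN B u v -> (0 <= red B w1 w2 u v)%R.
Proof.
move=> [E m1 m2]; pose D := (\sum_v `|w2 v|)%R.
have leD v : (w2 v <= D)%R.
  rewrite /D (bigD1 v) //=; apply: le_trans (ler_norm _) _.
  by rewrite lerDl; apply: sumr_ge0 => *; exact: normr_ge0.
exists (fun v => if v == e then w e - D else w1 v)%R, (fun v => if v == e then D else w2 v); split.
  by move=> v; case: eqP => [->|_]; rewrite ?subrK.
have sB : B \subset [set v in F] by apply/subsetP => v /sBF vF; rewrite inE.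
move=> u v; rewrite inE /red => uF vF.
have ve : v != e by apply: contraNneq eF => <-.
rewrite (negbTE ve); case: (eqVneq u e) uF => [-> _|_ /= uF].
  by rewrite (negbTE eB) subr_ge0.
move=> auv; have := split_min_arc sB (And3 E m1 m2) _ _ auv; rewrite /red !inE; exact.
Qed.

Section Exchange.
Variables (w1 w2 : G -> int) (p : seq G).
Hypotheses (m1 : locally_min N1 w1 F' B) (m2 : locally_min N2 w2 F' B).

Definition tight : rel G := fun u v => arcN B u v && (red B w1 w2 u v == 0%R).

Hypothesis (tp : path tight e (rcons p e)) (Fp : all (mem F) p) (up : uniq (e :: p)).
Hypothesis (minp : forall p', path tight e (rcons p' e) -> all (mem F) p' -> size p <= size p').

Let L := zip (e :: p) (rcons p e).

Let nthL i : nth (e, e) L i = (nth e (e :: p) i, nth e (rcons p e) i).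
Proof. by rewrite nth_zip // size_rcons. Qed.

Let sizeL : size L = (size p).+1.
Proof. by rewrite size_zip size_rcons minnn. Qed.

Let unzip1L : unzip1 L = e :: p. Proof. by rewrite unzip1_zip // size_rcons. Qed.
Let unzip2L : unzip2 L = rcons p e. Proof. by rewrite unzip2_zip // size_rcons. Qed.

Let nth_start i : i <= size p -> nth e (e :: rcons p e) i = nth e (e :: p) i.
Proof. by move=> le; rewrite -rcons_cons nth_rcons /= ltnS le. Qed.

Let tightL x : x \in L -> tight x.1 x.2.
Proof.
move=> /(nthP (e, e)) [i]; rewrite sizeL ltnS => le <-; rewrite nthL /=.
have /(pathP e)/(_ i) := tp; rewrite size_rcons ltnS => /(_ le).
by rewrite nth_start.
Qed.

(** A tight arc from the start of an earlier arc to the end of a later one would give a tight cycle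
    with fewer vertices. *)
Let pairwiseL : pairwise (fun x y => ~~ tight x.1 y.2) L.
Proof.
apply/(pairwiseP (e, e)) => i j; rewrite !inE sizeL !ltnS => lei lej ltij.
rewrite !nthL /=; apply/negP => tij.
have := @path_shortcut _ tight e (rcons p e) i j tp (ltnW ltij).
rewrite size_rcons ltnS nth_start // => /(_ lej tij).
rewrite drop_rcons // -[X in take i X]cats1 takel_cat // -rcons_cat => /minp.
rewrite all_cat size_cat size_takel // size_drop => H.
suff : size p <= i + (size p - j) by move: ltij lej; clear; lia.
by apply: H; apply/andP; split; apply/allP => v; [move/mem_take|move/mem_drop]; exact: (allP Fp).
Qed.

Let mask : {set G} := [set v in e :: p].

Let inL_F x : x \in L -> x.1 \in F' /\ x.2 \in F'.
Proof.
move=> xL; have : x.1 \in unzip1 L by apply: map_f.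
have : x.2 \in unzip2 L by apply: map_f.
have pF v : v \in e :: p -> v \in F'.
  by rewrite !inE => /orP [->//|/(allP Fp) /= ->]; rewrite orbT.
by rewrite unzip1L unzip2L mem_rcons => /pF ? /pF.
Qed.

(** The arcs leaving [B] are the swaps made in the first matroid, and the absence of tight shortcuts
    is the triangular condition of [exchange_pairs]. *)
Lemma exchange1 : [/\ indep N1 (symd B mask), #|symd B mask| = #|B|
  & (\sum_(v in symd B mask) w1 v = \sum_(v in B) w1 v)%R].
Proof.
pose L1 := [seq x <- L | x.1 \in B].
have subL : subseq L1 L by exact: filter_subseq.
have arcL x : x \in L1 -> [/\ x.1 \in B, x.2 \notin B, indep N1 (x.2 |: (B :\ x.1)) & w1 x.1 = w1 x.2].
  rewrite mem_filter => /andP [xB /tightL]; rewrite /tight arc_out // /red xB.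
  by case/andP => /andP [-> ->]; rewrite subr_eq0 => /eqP ->.
have -> : symd B mask = swapped B L1.
  have E1 z : (z \in unzip1 L1) = (z \in e :: p) && (z \in B).
    by rewrite -unzip1L -[unzip1 L1](@filter_map _ _ fst (mem B)) mem_filter andbC.
  have E2 z : (z \in unzip2 L1) = (z \in e :: p) && (z \notin B).
    have -> : L1 = [seq x <- L | x.2 \notin B].
      apply: eq_in_filter => x /tightL /andP [/arc_flip -> _]; by rewrite negbK.
    by rewrite -[unzip2 _](@filter_map _ _ snd (predC (mem B))) mem_filter [map _ _]unzip2L mem_rcons andbC.
  apply/setP => z; rewrite /swapped !(inE, E1, E2).
  by case: (z \in B); case: (z == e); case: (z \in p).
apply: exchange_pairs => //.
- by apply: subseq_uniq (map_subseq fst subL) _; rewrite [map _ _]unzip1L.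
- by apply: subseq_uniq (map_subseq snd subL) _; rewrite [map _ _]unzip2L rcons_uniq.
- move=> y x yB /mapP [z zL ->]; have [_ zB _ _] := arcL z zL.
  by apply: m1 => //; have [] := inL_F (mem_subseq subL zL).
have := subseq_pairwise subL pairwiseL.
apply: (@sub_in_pairwise _ (mem L1)); last by apply/allP.
move=> x y xL yL /=; apply: contra => /andP [I /eqP Ew].
have [xB _ _ _] := arcL x xL; have [_ yB _ _] := arcL y yL.
by rewrite /tight arc_out // yB I /red xB Ew subrr eqxx.
Qed.

(** As swaps, arcs entering [B] are read backwards; this inverts the direction of shortcuts, so the
    list is reversed. *)
Lemma exchange2 : [/\ indep N2 (symd B mask), #|symd B mask| = #|B|
  & (\sum_(v in symd B mask) w2 v = \sum_(v in B) w2 v)%R].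
Proof.
pose L1 := [seq x <- L | x.1 \notin B].
pose L2 := rev [seq (x.2, x.1) | x <- L1].
have subL : subseq L1 L by exact: filter_subseq.
have arcL x : x \in L1 -> [/\ x.2 \in B, x.1 \notin B, indep N2 (x.1 |: (B :\ x.2)) & w2 x.2 = w2 x.1].
  rewrite mem_filter => /andP [xB /tightL]; rewrite /tight arc_in // /red (negbTE xB).
  by case/andP => /andP [-> ->]; rewrite subr_eq0 => /eqP ->.
have Eu1 : unzip1 L2 = rev (unzip2 L1) by rewrite /unzip1 map_rev -map_comp.
have Eu2 : unzip2 L2 = rev (unzip1 L1) by rewrite /unzip2 map_rev -map_comp.
have -> : symd B mask = swapped B L2.
  have E2 z : (z \in unzip2 L2) = (z \in e :: p) && (z \notin B).
    by rewrite Eu2 mem_rev -unzip1L -[unzip1 L1](@filter_map _ _ fst (predC (mem B))) mem_filter andbC.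
  have E1 z : (z \in unzip1 L2) = (z \in e :: p) && (z \in B).
    rewrite Eu1 mem_rev; have -> : L1 = [seq x <- L | x.2 \in B].
      by apply: eq_in_filter => x /tightL /andP [/arc_flip -> _].
    by rewrite -[unzip2 _](@filter_map _ _ snd (mem B)) mem_filter [map _ _]unzip2L mem_rcons andbC.
  apply/setP => z; rewrite /swapped !(inE, E1, E2).
  by case: (z \in B); case: (z == e); case: (z \in p).
have memL2 x : x \in L2 -> (x.2, x.1) \in L1.
  by rewrite mem_rev => /mapP [[u v] uvL ->].
apply: exchange_pairs => //.
- by rewrite Eu1 rev_uniq; apply: subseq_uniq (map_subseq snd subL) _; rewrite [map _ _]unzip2L rcons_uniq.
- by rewrite Eu2 rev_uniq; apply: subseq_uniq (map_subseq fst subL) _; rewrite [map _ _]unzip1L.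
- by move=> x /memL2/arcL.
- move=> y x yB /mapP [z /memL2 zL ->]; have [_ zB _ _] := arcL _ zL.
  by apply: m2 => //; have [] := inL_F (mem_subseq subL zL).
rewrite pairwise_rev pairwise_map.
have := subseq_pairwise subL pairwiseL.
apply: (@sub_in_pairwise _ (mem L1)); last by apply/allP.
move=> x y xL yL /=; apply: contra => /andP [I /eqP Ew].
have [_ xB _ _] := arcL x xL; have [yB _ _ _] := arcL y yL.
by rewrite /tight arc_in // yB I /red (negbTE xB) Ew subrr eqxx.
Qed.

(** Tight swaps preserve the weight in each matroid, so the new set inherits minimality from [B]. *)
Lemma cycle_exchange : [/\ symd B mask \subset F', spanning_indep N1 (symd B mask),
  spanning_indep N2 (symd B mask), locally_min N1 w1 F' (symd B mask)
  & locally_min N2 w2 F' (symd B mask)].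
Proof.
have [I1 c1 s1] := exchange1; have [I2 c2 s2] := exchange2.
have sub : symd B mask \subset F'.
  apply/subsetP => v; rewrite inE; case: (boolP (v \in B)) => [/(subsetP sBF') //|_ /=].
  by rewrite !inE => /orP [->//|/(allP Fp) /= ->]; rewrite orbT.
split=> //.
- by split=> // S; rewrite c1; case: sp1 => _; apply.
- by split=> // S; rewrite c2; case: sp2 => _; apply.
- apply: min_locally_min => // S sS IS; rewrite c1 s1 => cS.
  exact: (locally_min_min (proj1 sp1) sBF' m1 sS IS cS).
apply: min_locally_min => // S sS IS; rewrite c2 s2 => cS.
exact: (locally_min_min (proj1 sp2) sBF' m2 sS IS cS).
Qed.

End Exchange.
Lemma walk_mask_uniq q : uniq (e :: q) -> walk_mask e q = [set v in e :: q].
Proof.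
elim/last_ind: q => [|q v IH]; first by move=> _; apply/setP => z; rewrite !inE.
rewrite -rcons_cons rcons_uniq => /andP [vq /IH {}IH].
rewrite /walk_mask foldl_rcons -/(walk_mask e q) IH; apply/setP => z.
rewrite /symd in_set !in_set mem_rcons in_set1 [z \in v :: _]inE.
by case: (eqVneq z v) vq => [-> /negbTE ->|]; rewrite ?addbF.
Qed.

Lemma wlen_tight w1 w2 u q : path (tight w1 w2) u q -> wlen (red B w1 w2) u q = 0%R.
Proof. by elim: q u => //= v q IH u /andP [/andP [_ /eqP ->] /IH ->]. Qed.

Lemma phase_correct (V : seq G) : #|G| <= size V ->
  (exists w1 w2, split_min [set v in F] B w1 w2) ->
  let B' := phase (indep N1) (indep N2) W V B e F in
  [/\ B' \subset F', spanning_indep N1 B', spanning_indep N2 B'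
    & exists w1 w2, split_min F' B' w1 w2].
Proof.
move=> leV [v1 [v2 /split_extend [w1 [w2 [E a0]]]]]; rewrite /phase.
have -> : foldl (fun T _ => relax (indep N1) (indep N2) W B e F T) [::] V =
    iter (size V) (relax (indep N1) (indep N2) W B e F) [::].
  elim: (V) ([::] : seq (G * entry G)) => //= x l IH T.
  by rewrite IH -iterSr.
(* [X] is chosen so that arcs from unreachable vertices into [e] satisfy the corrected
   inequality. *)
pose a := red B w1 w2; pose X : int := (\sum_v `|w1 v| + `|w1 e|)%R.
have XP y : (w1 y - w1 e <= X)%R.
  apply: lerD; last by rewrite -normrN ler_norm.
  apply: le_trans (ler_norm _) _; rewrite (bigD1 y) //= lerDl.
  by apply: sumr_ge0 => *; exact: normr_ge0.
have [d [de dP dX]] := potentials eF sBF E a0 X.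
pose w2' v : int := (w2 v + d v)%R.
have inF' v : (v \in F') = (v \in e :: F) by rewrite inE.
have memF v : v \in F -> v != e by move=> vF; apply: contraNneq eF => <-.
have lastB u : arcN B u e -> u \in B.
  by move=> /arc_flip; rewrite (negbTE eB) => /esym/negbFE.
have redE (w1' : G -> int) u v : (forall v, v != e -> w1' v = w1 v - d v)%R ->
    v \in F -> red B w1' w2' u v = (a u v + d u - d v)%R.
  move=> Hw vF; rewrite /red /a /red /w2'; case: (boolP (u \in B)) => uB; last by ring.
  by rewrite !Hw ?memF //; [ring | exact: sBF].
have min0 (w1' : G -> int) : (forall v, v != e -> w1' v = w1 v - d v)%R ->
    (forall u, u \in F -> u \in B -> arcN B u e -> (w1 u - d u <= w1' e)%R) ->
    forall u v, u \in F' -> v \in F' -> arcN B u v -> (0 <= red B w1' w2' u v)%R.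
  move=> Hw He u v; rewrite !inF' => uF; rewrite inE => /orP [/eqP -> aue|vF auv].
    have uB := lastB _ aue; have uF1 := sBF uB.
    by rewrite /red uB subr_ge0 Hw ?memF // He.
  by rewrite redE // subr_ge0 addrC dP.
have [[-> pos]|[p [cp -> neg minp]]] := best_cycleP (indep N1) (indep N2) W B e F (size V).
  have -> : symd B set0 = B by apply/setP => z; rewrite !inE addbF.
  split=> //; exists (fun v => w1 v - d v)%R, w2'.
  have [] := @arc_locally_min F' B (fun v => w1 v - d v)%R w2' sBF'; last first.
    by move=> l1 l2; split=> // v; rewrite -E /w2'; ring.
  (* For a reachable [u], the arc to [e] closes a shortest walk into a cycle, and the nonnegative
     length of that cycle is the required inequality. *)
  apply: min0 => // u uF uB aue; rewrite de subr0; case: (dX u uF) => [[p [wp lp Ep]]|]; last first.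
    by have := XP u; clear; lia.
  have cp : closedN p by rewrite closed_walkE wp lp.
  have [q [cq uq sq [le _]]] := shorten_closed a0 cp.
  have := pos q cq (leq_trans (ltnW sq) leV).
  rewrite (closed_costE eF sBF E cq) => h.
  have : (0 <= wlen a e (rcons q e))%R.
    by apply: (@scaled_le K 0 (size q).+1); [rewrite mulr0 addr0 | exact: leq_ltn_trans sq big_K].
  move/le_trans/(_ le); rewrite wlen_rcons lp Ep /red uB; clear; lia.
rewrite /=.
pose mu := wlen a e (rcons p e).
have min_closed q : closedN q -> (mu <= wlen a e (rcons q e))%R.
  move=> cq; have [q' [cq' uq' sq' [le _]]] := shorten_closed a0 cq.
  apply: le_trans le; have := minp q' cq' (leq_trans (ltnW sq') leV).
  rewrite !(closed_costE eF sBF E) // => /scaled_le; apply; exact: leq_ltn_trans sq' big_K.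
(* The lengths being equal, the summand that counts vertices decides. *)
have min_size q : closedN q ->
    (wlen a e (rcons q e) <= mu)%R -> size p <= size q.
  move=> cq le1; have [q' [cq' uq' sq' [le sz]]] := shorten_closed a0 cq.
  have Emu : wlen a e (rcons q' e) = mu.
    by apply/eqP; rewrite eq_le (le_trans le le1) min_closed.
  have := minp q' cq' (leq_trans (ltnW sq') leV).
  rewrite !(closed_costE eF sBF E) // -/a Emu -/mu lerD2l lez_nat ltnS => h.
  by apply: leq_trans h _; case: sz => [->|/ltnW].
have up : uniq (e :: p).
  have [q [cq uq sq [le [<- //|lt]]]] := shorten_closed a0 cp.
  by have := min_size q cq le; rewrite leqNgt lt.
have mu_lt0 : (mu < 0)%R.
  move: neg; rewrite (closed_costE eF sBF E cp) -/a -/mu; clear; move: (size p).+1 => n h.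
  by rewrite ltNge; apply/negP => mu0; have : (0 <= K%:Z * mu)%R; [exact: mulr_ge0 | move: h; lia].
(* Raising the weight of [e] by [- mu] makes the arcs into [e] nonnegative and [p] tight. Until the
   end, [w1'] and [w2'] thus split a weight that differs from [w] at [e]. *)
pose w1' v : int := (if v == e then w1 e - mu else w1 v - d v)%R.
have w1'E v : v != e -> (w1' v = w1 v - d v)%R by rewrite /w1' => /negbTE ->.
have red_ge0 : forall u v, u \in F' -> v \in F' -> arcN B u v -> (0 <= red B w1' w2' u v)%R.
  apply: min0 => // u uF uB aue; rewrite /w1' eqxx.
  case: (dX u uF) => [[q [wq lq Eq]]|]; last by have := XP u; move: mu_lt0; clear; lia.
  have /min_closed : closedN q by rewrite closed_walkE wq lq.
  rewrite wlen_rcons lq [wlen _ _ _]Eq /a /red uB; clear; lia.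
have [l1 l2] := arc_locally_min sBF' red_ge0.
have wlen' q : closedN q ->
    wlen (red B w1' w2') e (rcons q e) = (wlen a e (rcons q e) - mu)%R.
  rewrite closed_walkE => /andP [/andP [pq Fq] al].
  have H u r : all (mem F) r -> wlen (red B w1' w2') u r = (wlen a u r + d u - d (last u r))%R.
    elim: r u => [|v r IH] u /=; first by rewrite add0r subrr.
    by case/andP => vF /IH ->; rewrite redE //; ring.
  have lB := lastB _ al.
  rewrite !wlen_rcons H // de /a /red lB (w1'E (last e q)) ?memF //; last exact: sBF.
  by rewrite /w1' eqxx; ring.
have /andP [pp Fp] := cp.
have tp : path (tight w1' w2') e (rcons p e).
  apply: (@wlen_eq0 _ _ _ (mem (e :: F)) (mem (e :: F))) => //.
  - by move=> u v uF vF; apply: red_ge0; rewrite inF'.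
  - exact: mem_head.
  - rewrite all_rcons /= mem_head /=; apply/allP => v /(allP Fp) /= vF; exact: mem_behead.
  by rewrite wlen' // subrr.
have closed_tight q : path (tight w1' w2') e (rcons q e) -> all (mem F) q ->
    closedN q.
  move=> tq Fq; rewrite /closed_walk Fq andbT.
  by apply: sub_path tq => u v /andP [].
have min_tight q : path (tight w1' w2') e (rcons q e) -> all (mem F) q -> size p <= size q.
  move=> tq Fq; have cq := closed_tight q tq Fq; apply: min_size => //.
  by have := wlen' q cq; rewrite wlen_tight // => /eqP; rewrite eq_sym subr_eq0 => /eqP ->.
rewrite walk_mask_uniq //.
have [sub s1 s2 m1 m2] := cycle_exchange l1 l2 tp Fp up min_tight.
split=> //; exists (fun v => w1 v - d v)%R, w2'; split=> //.
  by move=> v; rewrite -E /w2'; ring.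
(* Back to a splitting of [w]: as [e] lies in the new basis, only the left-hand side can change, and
   it decreases. *)
move=> y x yB xF xB I; have := m1 y x yB xF xB I.
have xe : x != e by apply: contraNneq xB => ->; rewrite !inE (negbTE eB) eqxx.
rewrite (w1'E x) //; apply: le_trans; rewrite /w1'; case: eqP => // ->.
by rewrite de subr0; move: mu_lt0; clear; lia.
Qed.

End Step.
Lemma intersection_loop (V rest : seq G) B (F : seq G) : #|G| <= size V ->
  uniq (rest ++ F) -> {subset B <= F} -> spanning_indep N1 B -> spanning_indep N2 B ->
  (exists w1 w2, split_min [set v in F] B w1 w2) ->
  let r := foldl (intersection_step (indep N1) (indep N2) W V) (B, F) rest in
  [/\ r.2 =i rest ++ F, {subset r.1 <= r.2}, spanning_indep N1 r.1, spanning_indep N2 r.1 &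
    exists w1 w2, split_min [set v in r.2] r.1 w1 w2].
Proof.
move=> leV; elim: rest B F => [|e rest IH] B F // + sB sp1 sp2 spl.
rewrite cat_cons cons_uniq => /andP [eN uN].
have eF : e \notin F by apply: contra eN; rewrite mem_cat orbC => ->.
have [sB' sp1' sp2' spl'] := phase_correct eF sB sp1 sp2 leV spl.
have [||h1 h2 h3 h4 h5] := IH _ (e :: F) _ _ sp1' sp2' spl'.
- by rewrite -cat_rcons -cats1 -catA uniq_catCA /= eN uN.
- by move=> v /(subsetP sB'); rewrite inE.
split=> // v; rewrite h1 !(mem_cat, inE); exact: orbCA.
Qed.

Theorem min_common_basisP (V : seq G) B0 : uniq V -> (forall v, v \in V) ->
  spanning_indep N1 B0 -> spanning_indep N2 B0 ->
  let B := min_common_basis (indep N1) (indep N2) W V B0 in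
  [/\ spanning_indep N1 B, spanning_indep N2 B &
    forall S, indep N1 S -> indep N2 S -> #|S| = #|B| ->
    (\sum_(v in B) w v <= \sum_(v in S) w v)%R].
Proof.
move=> uV allV sp1 sp2; rewrite /min_common_basis.
have leV : #|G| <= size V.
  by rewrite -(card_uniqP uV); apply: subset_leq_card; apply/subsetP => v _; exact: allV.
have [|||] := @intersection_loop V [seq v <- V | v \notin B0] B0 [seq v <- V | v \in B0] leV _ _ sp1 sp2.
- rewrite cat_uniq !filter_uniq //= andbT; apply/hasPn => v.
  by rewrite !mem_filter => /andP [-> _].
- by move=> v vB; rewrite mem_filter vB allV.
(* As long as only elements of [B0] are present nothing can be exchanged, so every splitting is
   valid. *)
- exists w, (fun _ => 0%R); split=> [v|y x _|y x _]; first by rewrite addr0.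
    by rewrite inE mem_filter => /andP [->].
  by rewrite inE mem_filter => /andP [->].
set r := foldl _ _ _ => Er sB [I1 max1] [I2 max2] [w1 [w2 [E m1 m2]]].
split=> // S S1 S2 cS.
have allF v : v \in [set v in r.2].
  by rewrite inE Er mem_cat !mem_filter allV andbT; case: (v \in B0).
have subF (A : {set G}) : A \subset [set v in r.2] by apply/subsetP.
have Ew (A : {set G}) : (\sum_(v in A) w v = \sum_(v in A) w1 v + \sum_(v in A) w2 v)%R.
  by rewrite -big_split /=; apply: eq_bigr => v _; rewrite E.
by rewrite !Ew; apply: lerD; [apply: (locally_min_min I1 _ m1)|apply: (locally_min_min I2 _ m2)].
Qed.

End Phase.

(** * Reduction to matroid intersection *)

Section Bases.
Variables (E : finType) (M : matroid E).
Implicit Types X Y : {set E}.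

Lemma rank_ge X : indep M X -> #|X| <= rank M setT.
Proof. by move=> IX; apply: leq_bigmax_cond; rewrite subsetT. Qed.

Lemma basis_of_card X : (X \in bases M) = indep M X && (#|X| == rank M setT).
Proof.
rewrite inE; apply/maxsetP/andP => [[IX maxX]|[IX /eqP cX]].
  split=> //; rewrite eqn_leq rank_ge //=; apply/bigmax_leqP => W /andP [_ IW].
  rewrite leqNgt; apply/negP => lt; have [e] := indep_augment IX IW lt.
  rewrite inE => /andP [eX _] /maxX Ee; have := Ee (subsetUr _ _) => /setP/(_ e).
  by rewrite !inE eqxx (negbTE eX).
split=> // Y IY sXY; apply/eqP; rewrite eq_sym eqEcard sXY cX; exact: rank_ge.
Qed.

Lemma basis_indep X : X \in bases M -> indep M X.
Proof. by rewrite basis_of_card => /andP []. Qed.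

Lemma basis_card X : X \in bases M -> #|X| = rank M setT.
Proof. by rewrite basis_of_card => /andP [_ /eqP]. Qed.

End Bases.

(* The copies of an element e: (Some true, e) puts e into X only, (Some false, e) into
   Y only and (None, e) into both bases. *)
Notation copies E := (option bool * E)%type.

Section Copies.
Variable (E : finType).
Implicit Types (S : {set copies E}) (t : option bool).

Definition slice t S : {set E} := [set e | (t, e) \in S].

Definition glue (P : option bool -> {set E}) : {set copies E} := [set x | x.2 \in P x.1].

Lemma slice_glue P t : slice t (glue P) = P t.
Proof. by apply/setP => e; rewrite !inE. Qed.

Definition part b S : {set E} := slice (Some b) S :|: slice None S.

Lemma sum_slices (V : zmodType) (f : copies E -> V) S b :
  (\sum_(x in S) f x = \sum_(e in slice (Some b) S) f (Some b, e)
    + \sum_(e in slice None S) f (None, e)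
    + \sum_(e in slice (Some (~~ b)) S) f (Some (~~ b), e))%R.
Proof.
transitivity (\sum_t \sum_(e in slice t S) f (t, e))%R.
  rewrite pair_big_dep /=; apply: eq_big => [[t e]|[t e] _] //=.
  by rewrite inE.
rewrite (bigD1 (Some b)) //= (bigD1 None) //= (bigD1 (Some (~~ b))) /=.
  rewrite [X in (_ + (_ + (_ + X)))%R]big1; first by rewrite addr0 addrA.
  by move=> [[]|]; case: b.
by case: b.
Qed.

Lemma card_slices S b :
  #|S| = #|slice (Some b) S| + #|slice None S| + #|slice (Some (~~ b)) S|.
Proof.
apply: (@mulrIn int 1%R) => //; rewrite !mulrnDr -!sumr_const.
exact: sum_slices (fun _ => 1%R) S b.
Qed.

Lemma slice_setU1 t t' e S :
  slice t ((t', e) |: S) = if t == t' then e |: slice t S else slice t S.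
Proof.
apply/setP => x; case: eqP => [->|ne]; rewrite !inE /eq_op /= ?eqxx //.
by case: eqP.
Qed.

Lemma sub_slice t S S' : S \subset S' -> slice t S \subset slice t S'.
Proof. by move=> /subsetP s; apply/subsetP => e; rewrite !inE; exact: s. Qed.

End Copies.

(** * The two matroids on the copies *)

Section CopyMatroid.
Variables (E : finType) (M : matroid E) (k : nat) (b : bool).
Implicit Types (S : {set copies E}).

(** The direct sum of [M], with each element doubled in parallel, and a uniform matroid of rank
    [k]. *)
Definition copy_indep S : bool :=
  [&& slice (Some b) S :&: slice None S == set0, indep M (part b S)
    & #|slice (Some (~~ b)) S| <= k].

Lemma copy_indep0 : copy_indep set0.
Proof.
have s0 t : slice t (set0 : {set copies E}) = set0 by apply/setP => e; rewrite !inE.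
by rewrite /copy_indep /part !s0 setI0 setU0 eqxx indep_set0 cards0.
Qed.

Lemma copy_indep_sub S S' : S \subset S' -> copy_indep S' -> copy_indep S.
Proof.
move=> sS /and3P [d I c]; apply/and3P; split.
- by rewrite -subset0; apply: subset_trans (setISS (sub_slice _ sS) (sub_slice _ sS)) _; rewrite subset0.
- by apply: indep_sub I; exact: setUSS (sub_slice _ sS) (sub_slice _ sS).
by apply: leq_trans c; apply: subset_leq_card; exact: sub_slice.
Qed.

Lemma card_part S : slice (Some b) S :&: slice None S == set0 ->
  #|S| = #|part b S| + #|slice (Some (~~ b)) S|.
Proof. by move=> /eqP d; rewrite (card_slices S b) cardsU d cards0 subn0. Qed.

Lemma copy_indep_augment S S' : copy_indep S -> copy_indep S' -> #|S| < #|S'| ->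
  exists2 x, x \in S' :\: S & copy_indep (x |: S).
Proof.
move=> /and3P [d I c] /and3P [d' I' c'].
rewrite !card_part //.
case: (ltnP #|slice (Some (~~ b)) S| #|slice (Some (~~ b)) S'|) => [lt _|le lt].
  have : slice (Some (~~ b)) S' :\: slice (Some (~~ b)) S != set0.
    by apply: contraTneq lt => /eqP; rewrite setD_eq0 => /subset_leq_card; rewrite -leqNgt.
  case/set0Pn => e; rewrite !inE => /andP [eS eS']; exists (Some (~~ b), e); first by rewrite !inE eS.
  rewrite /copy_indep /part !slice_setU1 eqxx; have -> : (Some b == Some (~~ b)) = false by case: b.
  rewrite d I cardsU1 inE eS /=; exact: leq_trans lt c'.
have {}lt : #|part b S| < #|part b S'| by move: le lt; clear; lia.
have [e] := indep_augment I I' lt.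
rewrite !inE negb_or => /andP [/andP [e1 e2] e'] Ie.
(* Whichever of the two parallel copies of [e] occurs in [S']. *)
pose t : option bool := if (Some b, e) \in S' then Some b else None.
exists (t, e).
  by rewrite !inE /t; case: ifP e' => [h _|_ /= h]; rewrite h ?e1 ?e2.
have tb : (Some (~~ b) == t) = false by rewrite /t; case: ifP => _; case: b.
rewrite /copy_indep /part !slice_setU1 tb c andbT.
have -> : (if Some b == t then e |: slice (Some b) S else slice (Some b) S)
       :|: (if None == t then e |: slice None S else slice None S) = e |: part b S.
  by rewrite /t /part; case: (_ \in S'); rewrite eqxx; [rewrite -setUA | rewrite setUCA].
rewrite Ie andbT; apply/eqP/setP => x; rewrite !inE.
have /eqP/setP/(_ x) := d; rewrite !inE.
rewrite /t; case: (_ \in S'); rewrite eqxx /= !inE.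
  by case: (eqVneq x e) => [->|_] //=; rewrite (negbTE e2).
by case: (eqVneq x e) => [->|_] //=; rewrite (negbTE e1).
Qed.

Definition copy_matroid : matroid (copies E) :=
  Matroid copy_indep0 copy_indep_sub copy_indep_augment.

Lemma copy_card_le S : copy_indep S -> #|S| <= rank M setT + k.
Proof. by move=> /and3P [d I c]; rewrite card_part // leq_add ?rank_ge. Qed.

Lemma copy_basis S : copy_indep S -> #|S| = rank M setT + k ->
  part b S \in bases M /\ #|slice (Some (~~ b)) S| = k.
Proof.
move=> /and3P [d I c]; rewrite card_part // basis_of_card I /= => E0.
have le := rank_ge I; move: c le E0; clear; move: #|part b S| #|slice _ S| => x y.
move=> *; split; last by lia.
by apply/eqP; lia.
Qed.

End CopyMatroid.

(** * Recovery pairs as common bases *)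

Section Reduction.
Variables (E : finType) (M : matroid E) (k : nat) (R : realFieldType).
Implicit Types (X Y : {set E}) (S : {set copies E}).

Definition copy_weight (C w : E -> R) (x : copies E) : R :=
  match x.1 with
  | Some true => C x.2
  | Some false => w x.2
  | None => (C x.2 + w x.2)%R
  end.

Lemma copy_weight_sum C w S : copy_indep M k true S -> copy_indep M k false S ->
  (\sum_(x in S) copy_weight C w x = cost C (part true S) + cost w (part false S))%R.
Proof.
move=> /and3P [/eqP d _ _] /and3P [/eqP d' _ _].
rewrite (sum_slices _ _ true) /cost /part /copy_weight /= big_split /=.
have U (f : E -> R) b : slice (Some b) S :&: slice None S = set0 ->
    (\sum_(e in slice (Some b) S :|: slice None S) f e =
     \sum_(e in slice (Some b) S) f e + \sum_(e in slice None S) f e)%R.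
  move=> db; rewrite -bigU /=; last by rewrite -setI_eq0 db.
  by apply: eq_bigl => e; rewrite !inE.
by rewrite !U // [(\sum_(e in slice (Some false) S) _ + _)%R]addrC !addrA.
Qed.

(** Exactly [rank M setT - k] elements of [X :&: Y] are taken in the common copy; any further common
    elements are taken in both single copies, at the same total weight. *)
Lemma common_basis_of X Y : k <= rank M setT -> X \in bases M -> Y \in recoveries M k X ->
  exists S, [/\ copy_indep M k true S, copy_indep M k false S, #|S| = rank M setT + k,
    part true S = X & part false S = Y].
Proof.
move=> le bX; rewrite inE => /andP [bY cYX].
have cI : rank M setT - k <= #|X :&: Y|.
  have := cardsID X Y; rewrite setIC (basis_card bY); move: cYX; clear.
  by move: #|_| #|_| (rank _ _) => a b c; lia.
have [s [us sz sub]] := card_geqP cI.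
pose Z := [set x in s].
have cZ : #|Z| = rank M setT - k by rewrite cardsE (card_uniqP us).
have sZ : Z \subset X :&: Y by apply/subsetP => x; rewrite inE => /sub.
have [sZX sZY] : Z \subset X /\ Z \subset Y by apply/andP; rewrite -subsetI.
pose P t := if t is Some b then (if b then X else Y) :\: Z else Z.
have dZ (A : {set E}) : (A :\: Z) :&: Z == set0.
  by rewrite setIDAC setDIl setDv setI0.
have cD A : A \in bases M -> Z \subset A -> #|A :\: Z| = k.
  move=> bA sA; have := cardsID Z A; rewrite (setIidPr sA) cZ (basis_card bA).
  by move: le; clear; move: (rank _ _) => r; lia.
have UZ (A : {set E}) : Z \subset A -> A :\: Z :|: Z = A.
  by move=> sA; rewrite setUC -{1}(setIidPr sA) setID.
have I b : copy_indep M k b (glue P).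
  rewrite /copy_indep /part !slice_glue /= dZ; case: b; rewrite ?UZ //= cD //.
    by rewrite basis_indep ?leqnn.
  by rewrite basis_indep ?leqnn.
exists (glue P); split=> //; last 2 first.
- by rewrite /part !slice_glue UZ.
- by rewrite /part !slice_glue UZ.
by rewrite (card_slices _ true) !slice_glue /= !cD // cZ; move: le; clear; lia.
Qed.

Section RobustSolution.
Variables (C c d : E -> R).
Hypothesis d_ge0 : forall e, (0 <= d e)%R.
Let w e : R := (c e + d e)%R.

Lemma self_recovery X : X \in bases M -> X \in recoveries M k X.
Proof. by move=> bX; rewrite inE bX setDv cards0. Qed.

Lemma recovery_valueP (S : E -> R) X : X \in bases M ->
  (exists2 Y, Y \in recoveries M k X & recovery_value M k S X = cost S Y) /\
  (forall Y, Y \in recoveries M k X -> (recovery_value M k S X <= cost S Y)%R).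
Proof.
move=> /self_recovery XX; rewrite /recovery_value.
by case: (@arg_minP _ _ _ X (mem (recoveries M k X)) (cost S) XX) => Y YX minY; split=> //; exists Y.
Qed.

Lemma cost_le (f g : E -> R) X : (forall e, (f e <= g e)%R) -> (cost f X <= cost g X)%R.
Proof. by move=> H; apply: ler_sum. Qed.

(** Each recovery is most expensive at the upper bounds, hence so is the cheapest one. *)
Lemma worst_upper X : X \in bases M -> worst_scenario M c d k X w.
Proof.
move=> bX; split; first by move=> e; rewrite lexx andbT lerDl.
move=> S' HS'; have [[Y YX ->] _] := recovery_valueP w bX.
have [_ H] := recovery_valueP S' bX; apply: le_trans (H Y YX) _.
by apply: cost_le => e; case/andP: (HS' e).
Qed.

Lemma rr_solution_of_min X Y : X \in bases M -> Y \in recoveries M k X ->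
  (forall X' Y', X' \in bases M -> Y' \in recoveries M k X' ->
     (cost C X + cost w Y <= cost C X' + cost w Y')%R) ->
  rr_solution M C c d k X Y.
Proof.
move=> bX YX minXY.
have EY : recovery_value M k w X = cost w Y.
  have [[Y' Y'X E'] H] := recovery_valueP w bX; apply/eqP; rewrite eq_le H //= E'.
  by have := minXY X Y' bX Y'X; rewrite lerD2l.
split=> //.
- exists (cost C X + recovery_value M k w X)%R; first by exists w => //; exact: worst_upper.
  move=> X' bX'; exists (cost C X' + recovery_value M k w X')%R.
    by exists w => //; exact: worst_upper.
  by rewrite EY; have [[Y' Y'X ->] _] := recovery_valueP w bX'; exact: minXY.
(* For any worst scenario [S], the cost of [Y] is at most its cost at the upper bounds, which is the
   recovery value there, and that is at most the recovery value of [S]. *)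
move=> S [scS worstS]; apply/eqP; rewrite eq_le; have [_ H] := recovery_valueP S bX.
rewrite H // andbT; have [scw _] := worst_upper bX.
apply: le_trans (worstS w scw); rewrite EY.
by apply: cost_le => e; case/andP: (scS e).
Qed.

Lemma rr_solution_of_common_basis (wz : copies E -> int) (D : R) S :
  (0 < D)%R -> (forall x, (wz x)%:~R = D * copy_weight C w x)%R ->
  k <= rank M setT -> copy_indep M k true S -> copy_indep M k false S ->
  #|S| = rank M setT + k ->
  (forall S', copy_indep M k true S' -> copy_indep M k false S' -> #|S'| = #|S| ->
    (\sum_(x in S) wz x <= \sum_(x in S') wz x)%R) ->
  rr_solution M C c d k (part true S) (part false S).
Proof.
move=> D0 Ewz le I1 I2 cS minS.
have [bX cQ] := copy_basis I1 cS; have [bY cP] := copy_basis I2 cS.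
apply: rr_solution_of_min => //.
  (* Elements of [Y] outside [X] lie in the [Some false] slice; the slice may also meet [X], so this
     is an inequality only. *)
  rewrite inE bY -cQ; apply: subset_leq_card; apply/subsetP => x.
  by rewrite !inE negb_or /= => /andP [/andP [_ /negbTE ->]]; rewrite orbF.
move=> X' Y' bX' Y'X'; have [S' [I1' I2' cS' <- <-]] := common_basis_of le bX' Y'X'.
rewrite -!copy_weight_sum // -(ler_pM2l D0) !mulr_sumr.
have := minS S' I1' I2' ltac:(by rewrite cS cS').
rewrite -(ler_int R) !rmorph_sum /=.
by under eq_bigr do rewrite Ewz; under [X in (_ <= X)%R]eq_bigr do rewrite Ewz.
Qed.

End RobustSolution.
End Reduction.

(** * A common basis to start from *)

Section Greedy.
Variables (E : finType) (M : matroid E) (k : nat).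
Hypothesis le_k : k <= rank M setT.

Definition greedy_step (PZ : {set E} * {set E}) (e : E) : {set E} * {set E} :=
  if indep M (e |: (PZ.1 :|: PZ.2)) && (e \notin PZ.1 :|: PZ.2) then
    if #|PZ.1| < k then (e |: PZ.1, PZ.2) else (PZ.1, e |: PZ.2)
  else PZ.

(** Both bases are the greedy one; [PZ.1] is taken in both single copies and [PZ.2] in the common
    copy. *)
Definition greedy_glue (PZ : {set E} * {set E}) : {set copies E} :=
  glue (fun t => if t is Some _ then PZ.1 else PZ.2).

Lemma greedy_spanning (s : seq E) : (forall e, e \in s) ->
  let S := greedy_glue (foldl greedy_step (set0, set0) s) in
  [/\ copy_indep M k true S, copy_indep M k false S & #|S| = rank M setT + k].
Proof.
move=> alls.
pose Inv (t : seq E) (PZ : {set E} * {set E}) :=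
  [/\ indep M (PZ.1 :|: PZ.2), PZ.1 :&: PZ.2 == set0, #|PZ.1| <= k,
      PZ.2 != set0 -> #|PZ.1| = k &
      forall e, e \in t -> e \in PZ.1 :|: PZ.2 \/ ~~ indep M (e |: (PZ.1 :|: PZ.2))].
have step t PZ e : Inv t PZ -> Inv (rcons t e) (greedy_step PZ e).
  move=> [I d c z m]; rewrite /greedy_step.
  set U := PZ.1 :|: PZ.2 in I m *.
  have m' (U' : {set E}) : U \subset U' -> e \in U' \/ ~~ indep M (e |: U') ->
      forall x, x \in rcons t e -> x \in U' \/ ~~ indep M (x |: U').
    move=> sU He x; rewrite mem_rcons inE => /orP [/eqP -> //|/m [xU|nI]].
      by left; exact: (subsetP sU).
    by right; apply: contra nI; apply: indep_sub; exact: setUS.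
  case: ifP => [/andP [Ie eU]|nI].
    have [e1 e2] : e \notin PZ.1 /\ e \notin PZ.2 by move: eU; rewrite inE negb_or => /andP.
    case: ltnP => ck.
      have EU : (e |: PZ.1) :|: PZ.2 = e |: U by rewrite -setUA.
      split; rewrite /= ?EU //.
      - rewrite setIUl (eqP d) setU0; apply/eqP/setP => x; rewrite !inE.
        by case: eqP => [->|] //=; rewrite (negbTE e2).
      - by rewrite cardsU1 e1.
      - by move/z; rewrite cardsU1 e1; move: ck; clear; lia.
      by apply: m'; [exact: subsetUr | left; rewrite !inE eqxx].
    have EU : PZ.1 :|: (e |: PZ.2) = e |: U by rewrite setUCA.
    split; rewrite /= ?EU //.
    - rewrite setIUr (eqP d) setU0; apply/eqP/setP => x; rewrite !inE andbC.
      by case: eqP => [->|] //=; rewrite (negbTE e1).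
    - by move=> _; apply/eqP; rewrite eqn_leq c.
    by apply: m'; [exact: subsetUr | left; rewrite !inE eqxx].
  split=> //; apply: m' => //; move/negbT: nI; rewrite negb_and negbK => /orP []; by [right|left].
have [I d c z m] : Inv s (foldl greedy_step (set0, set0) s).
  elim/last_ind: (s) => [|t e IH]; last by rewrite foldl_rcons; exact: step.
  by split; rewrite /= ?setU0 ?setI0 ?cards0 ?indep_set0 // eqxx.
set PZ := foldl _ _ _ in I d c z m *.
have cU : #|PZ.1 :|: PZ.2| = rank M setT.
  apply/eqP; rewrite eqn_leq rank_ge //=; apply/bigmax_leqP => W /andP [_ IW].
  rewrite leqNgt; apply/negP => lt; have [e] := indep_augment I IW lt.
  rewrite inE => /andP [eU _] Ie; case: (m e (alls e)) => [|/negP //].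
  by rewrite (negbTE eU).
have cPk : #|PZ.1| = k.
  case: (eqVneq PZ.2 set0) => [Z0|/z //]; apply/eqP; rewrite eqn_leq c.
  by move: cU; rewrite Z0 setU0 => ->.
have cop b : copy_indep M k b (greedy_glue PZ).
  by rewrite /copy_indep /part !slice_glue d I c.
have dg : slice (Some true) (greedy_glue PZ) :&: slice None (greedy_glue PZ) == set0.
  by rewrite !slice_glue.
split=> //; rewrite (card_part dg) /part !slice_glue /=.
by rewrite cU cPk.
Qed.

End Greedy.

(** * Programs *)

Definition enc_copies m (S : {set copies 'I_m}) : data :=
  Node (enc_set (slice (Some true) S))
    (Node (enc_set (slice (Some false) S)) (enc_set (slice None S))).

Lemma dsize_copies m (S : {set copies 'I_m}) : dsize (enc_copies S) = 8 + 9 * m.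
Proof. by rewrite /= !dsize_set; clear; lia. Qed.

Section CopyPrograms.
Variables (A : Type) (dom : A -> Prop) (rho : A -> nat) (f : A -> data) (m : A -> nat).
Implicit Types S B : forall a, {set copies 'I_(m a)}.

Lemma pc_slice t S : polyc dom rho f (fun a => enc_copies (S a)) ->
  polyc dom rho f (fun a => enc_set (slice t (S a))).
Proof.
move=> HS; apply: (pc_trans HS); case: t => [[]|]; lookup.
Qed.

Lemma pc_copies S : (forall t, polyc dom rho f (fun a => enc_set (slice t (S a)))) ->
  polyc dom rho f (fun a => enc_copies (S a)).
Proof. by move=> H; apply: pc_node; last apply: pc_node; apply: H. Qed.

Lemma pc_setU (U V : forall a, {set 'I_(m a)}) :
  polyc dom rho f (fun a => enc_set (U a)) -> polyc dom rho f (fun a => enc_set (V a)) ->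
  polyc dom rho f (fun a => enc_set (U a :|: V a)).
Proof.
move=> HU HV; apply: pc_ext (pc_setop orb HU HV) => a _.
by congr enc_set; apply/setP => x; rewrite !inE.
Qed.

Lemma pc_setI (U V : forall a, {set 'I_(m a)}) :
  polyc dom rho f (fun a => enc_set (U a)) -> polyc dom rho f (fun a => enc_set (V a)) ->
  polyc dom rho f (fun a => enc_set (U a :&: V a)).
Proof.
move=> HU HV; apply: pc_ext (pc_setop andb HU HV) => a _.
by congr enc_set; apply/setP => x; rewrite !inE.
Qed.

(** [U] provides the length of the bit list. *)
Lemma pc_set0 (U : forall a, {set 'I_(m a)}) :
  polyc dom rho f (fun a => enc_set (U a)) -> polyc dom rho f (fun a => enc_set (set0 : {set 'I_(m a)})).
Proof.
move=> HU; apply: pc_ext (pc_setop addb HU HU) => a _.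
by congr enc_set; apply/setP => x; rewrite !inE addbb.
Qed.

Lemma pc_symd S S' :
  polyc dom rho f (fun a => enc_copies (S a)) -> polyc dom rho f (fun a => enc_copies (S' a)) ->
  polyc dom rho f (fun a => enc_copies (symd (S a) (S' a))).
Proof.
move=> HS HS'; apply: pc_copies => t.
apply: pc_ext (pc_setop addb (pc_slice t HS) (pc_slice t HS')) => a _.
by congr enc_set; apply/setP => x; rewrite !inE.
Qed.

(** A vertex is available as its singleton, so membership is the nonemptiness of an intersection. *)
Lemma pc_mem_copies (v : forall a, copies 'I_(m a)) B :
  polyc dom rho f (fun a => enc_copies [set v a]) -> polyc dom rho f (fun a => enc_copies (B a)) ->
  polyc dom rho f (fun a => enc_bool (v a \in B a)).
Proof.
move=> Hv HB.
have H t := pc_nonempty (pc_setI (pc_slice t Hv) (pc_slice t HB)).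
apply: pc_ext (pc_boolop orb (H (Some true)) (pc_boolop orb (H (Some false)) (H None))) => a _.
have E t : (slice t [set v a] :&: slice t (B a) != set0) = (t == (v a).1) && (v a \in B a).
  case: (v a) => t' e; apply/set0Pn/andP => [[x]|[/eqP -> eB]].
    by rewrite !inE => /andP [/eqP [-> ->]] ->.
  by exists e; rewrite !inE eqxx.
by rewrite !E; case: (v a) => -[[]|] e /=; rewrite ?orbF.
Qed.

End CopyPrograms.

(** * The program for matroid intersection *)

Section Intersection.
Variables (rep : representation) (rep_indep : indep_poly_time rep).

(** Bundled so that the ground set and the matroid can vary with the parameter of [polyc]; [irep]
    gives access to the independence test. *)
Record instance := Instance {
  im : nat;
  iD : data;
  iM : matroid 'I_im;
  ik : nat;
  iw : copies 'I_im -> int;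
  irep : rep iD iM
}.

(** Carrying the singleton and the weight along avoids indices and table lookups. *)
Definition enc_vertex (i : instance) (v : copies 'I_(im i)) : data :=
  Node (enc_copies [set v]) (Atom (iw v)).

Definition enc_entry m (x : entry (copies 'I_m)) : data :=
  Node (enc_bool x.1) (Node (Atom x.2.1) (enc_copies x.2.2)).

Definition enc_row (i : instance) (x : copies 'I_(im i) * entry (copies 'I_(im i))) : data :=
  Node (enc_vertex x.1) (enc_entry x.2).

Definition enc_inst (i : instance) : data := Node (iD i) (Atom (ik i)%:Z).

Definition iindep (i : instance) b : {set copies 'I_(im i)} -> bool := copy_indep (iM i) (ik i) b.

Definition iarc i := exarc (@iindep i true) (@iindep i false).

Section Rules.
Variables (A : Type) (dom : A -> Prop) (rho : A -> nat) (f : A -> data) (pi : A -> instance).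
Notation vert a := (copies 'I_(im (pi a))).
Implicit Types (B S : forall a, {set vert a}) (u v e : forall a, vert a).
Implicit Types (x y : forall a, entry (vert a)).

Lemma pc_indep (U : forall a, {set 'I_(im (pi a))}) :
  polyc dom rho f (fun a => enc_inst (pi a)) -> polyc dom rho f (fun a => enc_set (U a)) ->
  polyc dom rho f (fun a => enc_bool (indep (iM (pi a)) (U a))).
Proof.
move=> Hi HU; have [T [p HT]] := rep_indep.
apply: (@pc_trans _ _ _ (fun a => enc_query (iD (pi a)) (U a))).
  by apply: pc_node => //; exact: pc_fst Hi.
move=> bq; exists T, (fun a => p.[dsize (enc_query (iD (pi a)) (U a))]%R); split.
  exact: pbnd_horner bq.
by move=> a _; apply: HT; exact: irep.
Qed.

Lemma pc_iindep b S :
  polyc dom rho f (fun a => enc_inst (pi a)) -> polyc dom rho f (fun a => enc_copies (S a)) ->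
  polyc dom rho f (fun a => enc_bool (iindep b (S a))).
Proof.
move=> Hi HS; apply: pc_boolop; last apply: pc_boolop.
- apply: pc_ext (pc_neg (pc_nonempty (pc_setI (pc_slice (Some b) HS) (pc_slice None HS)))) => a _.
  by rewrite negbK.
- apply: pc_indep => //; apply: pc_setU; exact: pc_slice.
apply: (@pc_ext _ _ _ (fun a => enc_bool (#|slice (Some (~~ b)) (S a)|%:Z <= (ik (pi a))%:Z)%R)).
  by move=> a _; rewrite lez_nat.
by apply: pc_le; [apply: pc_card; exact: pc_slice | exact: pc_snd Hi].
Qed.

Lemma pc_vertex_set v : polyc dom rho f (fun a => enc_vertex (v a)) ->
  polyc dom rho f (fun a => enc_copies [set v a]).
Proof. exact: pc_fst. Qed.

Lemma pc_iarc B u v :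
  polyc dom rho f (fun a => enc_inst (pi a)) -> polyc dom rho f (fun a => enc_copies (B a)) ->
  polyc dom rho f (fun a => enc_vertex (u a)) -> polyc dom rho f (fun a => enc_vertex (v a)) ->
  polyc dom rho f (fun a => enc_bool (iarc (B a) (u a) (v a))).
Proof.
move=> Hi HB /pc_vertex_set Hu /pc_vertex_set Hv.
have HS := pc_symd (pc_symd HB Hu) Hv; have Hm := pc_mem_copies Hv HB.
exact: (@pc_eif _ _ _ _ _ (fun _ => bool) (fun _ => enc_bool) _ _ (pc_mem_copies Hu HB)
  (pc_boolop andb (pc_neg Hm) (pc_iindep true Hi HS)) (pc_boolop andb Hm (pc_iindep false Hi HS))).
Qed.

Lemma pc_vcost B v : polyc dom rho f (fun a => enc_copies (B a)) ->
  polyc dom rho f (fun a => enc_vertex (v a)) ->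
  polyc dom rho f (fun a => Atom (vcost (@iw (pi a)) (B a) (v a))).
Proof.
move=> HB Hv; have Hw := pc_snd Hv.
apply: (@pc_eif _ _ _ _ _ (fun _ => int) (fun _ => Atom)).
- exact: pc_mem_copies (pc_vertex_set Hv) HB.
- by apply: pc_sub => //; exact: pc_const.
by apply: pc_add => //; exact: pc_const.
Qed.

Lemma pc_cand B x u v :
  polyc dom rho f (fun a => enc_inst (pi a)) -> polyc dom rho f (fun a => enc_copies (B a)) ->
  polyc dom rho f (fun a => enc_entry (x a)) ->
  polyc dom rho f (fun a => enc_vertex (u a)) -> polyc dom rho f (fun a => enc_vertex (v a)) ->
  polyc dom rho f (fun a => enc_entry
    (cand (@iindep _ true) (@iindep _ false) (@iw (pi a)) (B a) (x a) (u a) (v a))).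
Proof.
move=> Hi HB Hx Hu Hv; apply: pc_node; last apply: pc_node.
- by apply: pc_boolop; [exact: pc_fst Hx | exact: pc_iarc].
- by apply: pc_add; [exact: pc_fst (pc_snd Hx) | exact: pc_vcost].
by apply: pc_symd; [exact: pc_snd (pc_snd Hx) | exact: pc_vertex_set].
Qed.

Lemma pc_min_entry x y :
  polyc dom rho f (fun a => enc_entry (x a)) -> polyc dom rho f (fun a => enc_entry (y a)) ->
  polyc dom rho f (fun a => enc_entry (min_entry (x a) (y a))).
Proof.
move=> Hx Hy; apply: (@pc_eif _ _ _ _ _ (fun a => entry (vert a)) (fun _ => @enc_entry _)) => //.
apply: pc_boolop; first exact: pc_fst Hy.
apply: pc_boolop; first by apply: pc_neg; exact: pc_fst Hx.
by apply: pc_lt; [exact: pc_fst (pc_snd Hy) | exact: pc_fst (pc_snd Hx)].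
Qed.

End Rules.

Lemma pc_foldl_min A dom rho f (pi : A -> instance)
    (z : forall a, entry (copies 'I_(im (pi a)))) (l : forall a, seq (entry (copies 'I_(im (pi a))))) :
  polyc dom rho f (fun a => enc_entry (z a)) ->
  polyc dom rho f (fun a => enc_seq [seq enc_entry t | t <- l a]) ->
  polyc dom rho f (fun a => enc_entry (foldl (@min_entry _) (z a) (l a))).
Proof.
move=> Hz Hl; apply: (@pc_foldl_select _ _ _ _ (fun a => entry (copies 'I_(im (pi a)))) (fun a => @enc_entry _) l z
  (fun a => @min_entry _)) => //.
  by move=> a x y; rewrite /min_entry; case: ifP; [right | left].
by apply: (@pc_min_entry _ _ _ _ (fun x => pi (projT1 x))); lookup.
Qed.


Definition enc_list (i : instance) (F : seq (copies 'I_(im i))) : data :=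
  enc_seq [seq enc_vertex v | v <- F].

Definition enc_table (i : instance) (T : seq (copies 'I_(im i) * entry (copies 'I_(im i)))) : data :=
  enc_seq [seq enc_row x | x <- T].

Definition irelax i := relax (@iindep i true) (@iindep i false) (@iw i).

Section Loops.
Variables (A : Type) (dom : A -> Prop) (rho : A -> nat) (f : A -> data) (pi : A -> instance).
Notation vert a := (copies 'I_(im (pi a))).
Variables (B : forall a, {set vert a}) (e : forall a, vert a) (F : forall a, seq (vert a)).
Variable T : forall a, seq (vert a * entry (vert a)).
Hypothesis Hi : polyc dom rho f (fun a => enc_inst (pi a)).
Hypothesis HB : polyc dom rho f (fun a => enc_copies (B a)).

Lemma pc_relax : polyc dom rho f (fun a => enc_vertex (e a)) ->
  polyc dom rho f (fun a => enc_list (F a)) -> polyc dom rho f (fun a => enc_table (T a)) ->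
  polyc dom rho f (fun a => enc_table (irelax (B a) (e a) (F a) (T a))).
Proof.
move=> He HF HT.
apply: (@pc_trans _ _ _ (fun a => Node (enc_inst (pi a)) (Node (enc_copies (B a))
  (Node (enc_vertex (e a)) (Node (enc_list (F a)) (enc_table (T a))))))).
  by do 4![apply: pc_node => //].
apply: (@pc_map _ _ _ _ (fun a => vert a) (fun a => @enc_vertex (pi a)) F
  (fun a => (vert a * entry (vert a))%type) (fun a => @enc_row (pi a))
  (fun a v => (v, foldl (@min_entry _)
     (cand (@iindep _ true) (@iindep _ false) (@iw (pi a)) (B a) (true, (vcost (@iw (pi a)) (B a) (e a), [set e a])) (e a) v)
     [seq cand (@iindep _ true) (@iindep _ false) (@iw (pi a)) (B a) x.2 x.1 v | x <- T a]))).
  by lookup.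
rewrite /enc_row /=; apply: pc_node; first by lookup.
apply: (@pc_foldl_min _ _ _ _ (fun x => pi (projT1 x))).
  apply: (@pc_cand _ _ _ _ (fun x => pi (projT1 x))); [lookup | lookup | | lookup | lookup].
  apply: pc_node; first exact: (pc_bool true).
  apply: pc_node; last by lookup.
  by apply: (@pc_vcost _ _ _ _ (fun x => pi (projT1 x))); lookup.
apply: (@pc_map _ _ _ _ (fun x => (vert (projT1 x) * entry (vert (projT1 x)))%type)
  (fun x => @enc_row (pi (projT1 x))) (fun x => T (projT1 x))
  (fun x => entry (vert (projT1 x))) (fun x => @enc_entry _)
  (fun x y => cand (@iindep _ true) (@iindep _ false) (@iw (pi (projT1 x))) (B (projT1 x)) y.2 y.1 (projT2 x))).
  by lookup.
by apply: (@pc_cand _ _ _ _ (fun y => pi (projT1 (projT1 y)))); lookup.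
Qed.

Lemma pc_best_cycle : polyc dom rho f (fun a => enc_vertex (e a)) ->
  polyc dom rho f (fun a => enc_table (T a)) ->
  polyc dom rho f (fun a => enc_entry (best_cycle (@iindep _ true) (@iindep _ false) (B a) (e a) (T a))).
Proof.
move=> He HT.
apply: (@pc_trans _ _ _ (fun a => Node (enc_inst (pi a)) (Node (enc_copies (B a))
  (Node (enc_vertex (e a)) (enc_table (T a)))))).
  by do 3![apply: pc_node => //].
apply: (@pc_foldl_min _ _ _ _ pi).
  apply: pc_node; first exact: (pc_bool true).
  apply: pc_node; first exact: (pc_const 0).
  apply: (@pc_ext _ _ _ (fun a => enc_copies (symd (B a) (B a)))).
    by move=> a _; congr enc_copies; apply/setP => x; rewrite !inE addbb.
  by apply: pc_symd; lookup.
apply: (@pc_map _ _ _ _ (fun a => (vert a * entry (vert a))%type)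
  (fun a => @enc_row (pi a)) T
  (fun a => entry (vert a)) (fun a => @enc_entry _)
  (fun a x => (x.2.1 && iarc (B a) x.1 (e a), x.2.2))).
  by lookup.
apply: pc_node; last by lookup.
apply: pc_boolop; first by lookup.
by apply: (@pc_iarc _ _ _ _ (fun x => pi (projT1 x))); lookup.
Qed.

End Loops.

Lemma vcost_size (i : instance) B (v : copies 'I_(im i)) :
  dsize (Atom (vcost (@iw i) B v)) <= dsize (enc_vertex v).
Proof.
have h1 : dsize (Atom 1) = 2 by rewrite /= /bits trunc_log1.
rewrite /vcost [dsize (enc_vertex v)]/= -[(bits (iw v)).+1]/(dsize (Atom (iw v))).
case: ifP => _; apply: leq_trans (dsize_add _ _) _; rewrite h1; last by clear; lia.
by rewrite [dsize (Atom (- _))]/= bits_opp /=; clear; lia.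
Qed.

Lemma list_size_mem (i : instance) (F : seq (copies 'I_(im i))) v : v \in F ->
  dsize (enc_vertex v) < dsize (enc_list F).
Proof.
by case/splitPr => p q; rewrite /enc_list map_cat; exact: dsize_seq_mem.
Qed.

Section Table.
Variables (A : Type) (dom : A -> Prop) (rho : A -> nat) (f : A -> data) (pi : A -> instance).
Notation vert a := (copies 'I_(im (pi a))).
Variables (B : forall a, {set vert a}) (e : forall a, vert a) (F V : forall a, seq (vert a)).

Lemma pc_table : polyc dom rho f (fun a => enc_inst (pi a)) ->
  polyc dom rho f (fun a => enc_copies (B a)) ->
  polyc dom rho f (fun a => enc_vertex (e a)) ->
  polyc dom rho f (fun a => enc_list (F a)) -> polyc dom rho f (fun a => enc_list (V a)) ->
  polyc dom rho f (fun a => enc_table (foldl (fun T _ => irelax (B a) (e a) (F a) T) [::] (V a))).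
Proof.
move=> Hi HB He HF HV.
pose env a := Node (enc_inst (pi a)) (Node (enc_copies (B a))
  (Node (enc_vertex (e a)) (Node (enc_list (F a)) (enc_list (V a))))).
apply: (@pc_trans _ _ _ env).
  by do 4![apply: pc_node => //].
move=> benv; move: (benv).
pose s a := dsize (enc_vertex (e a)) + dsize (enc_list (F a)).
(* Each round adds one vertex cost, so the size of the numbers grows only linearly with the
   rounds. *)
pose Inv a i (T : seq (vert a * entry (vert a))) := size T <= size (F a) /\
  all (fun x => (x.1 \in F a) && (dsize (Atom x.2.2.1) <= i.+1 * s a)) T.
have step a i (T : seq (vert a * entry (vert a))) : Inv a i T -> Inv a i.+1 (irelax (B a) (e a) (F a) T).
  move=> [sT /allP aT]; split; first by rewrite size_map.
  apply/allP => x /mapP [v vF ->] /=; rewrite vF -[(bits _).+1]/(dsize (Atom _)).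
  have vs : dsize (Atom (vcost (@iw (pi a)) (B a) v)) <= s a.
    apply: leq_trans (vcost_size _ _) _; apply: leq_trans (ltnW (list_size_mem vF)) _.
    exact: leq_addl.
  have es : dsize (Atom (vcost (@iw (pi a)) (B a) (e a))) <= s a.
    by apply: leq_trans (vcost_size _ _) _; exact: leq_addr.
  set z := cand _ _ _ _ _ _ _; set l := map _ _.
  have [[->|[/mapP [y yT ->] _]] _ _] := foldl_min_entryP z l.
    apply: leq_trans (dsize_add _ _) _; rewrite !mulSn addnA.
    by apply: leq_trans (leq_addr _ _); exact: leq_add.
  apply: leq_trans (dsize_add _ _) _; rewrite mulSn addnC.
  by apply: leq_add => //; have /andP [] := aT y yT.
apply: (@pc_foldl _ _ _ env (fun a => vert a) (fun a => seq (vert a * entry (vert a)))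
  (fun a => @enc_vertex (pi a)) (fun a => @enc_table (pi a)) V (fun a => [::])
  (fun a T _ => irelax (B a) (e a) (F a) T) Inv) => //.
- by lookup.
- exact: pc_nil.
- by move=> a p b q T _ _; exact: step.
- exists (fun a => 2 + dsize (env a) * (dsize (env a) + (2 + (dsize (env a) * dsize (env a) + dsize (env a))).+2).+2).
    have bc := pbnd_cst dom rho.
    apply: pbnd_add (bc 2) _; apply: (pbnd_mul benv); do 2!apply: pbnd_S.
    apply: (pbnd_add benv); do 2!apply: pbnd_S; apply: pbnd_add (bc 2) _.
    by apply: (fun h => pbnd_add h benv); exact: pbnd_mul.
  move=> a i T da lei [sT aT].
  have sF : size (F a) <= dsize (env a).
    have := dsize_seq_size [seq enc_vertex v | v <- F a]; rewrite size_map /env /= -/(enc_list (F a)); clear; lia.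
  have sV : i < dsize (env a).
    have := dsize_seq_size [seq enc_vertex v | v <- V a]; rewrite size_map /env /= -/(enc_list (V a)).
    by move: lei; clear; lia.
  have ss : s a <= dsize (env a) by rewrite /s /env /=; clear; lia.
  have sB : dsize (enc_copies (B a)) <= dsize (env a) by rewrite /env /=; clear; lia.
  have := @dsize_map_le _ (@enc_row (pi a)) _ T
    (dsize (env a) + (2 + (dsize (env a) * dsize (env a) + dsize (env a))).+2).+1 aT.
  move=> H; apply: leq_trans (H _) _ => {H}; last first.
    by rewrite leq_add2l leq_mul2r (leq_trans sT sF) orbT.
  move=> x /andP [xF xc].
  have h1 : dsize (enc_vertex x.1) <= dsize (env a).
    by apply: leq_trans (ltnW (list_size_mem xF)) _; rewrite /env /=; clear; lia.
  have h2 : dsize (enc_copies x.2.2.2) <= dsize (env a) by rewrite dsize_copies -(dsize_copies (B a)).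
  have h3 : dsize (Atom x.2.2.1) <= dsize (env a) * dsize (env a).
    by apply: leq_trans xc _; exact: leq_mul.
  rewrite /enc_row /enc_entry.
  rewrite -[dsize (Node _ _)]/((dsize (enc_vertex x.1) + (dsize (enc_bool x.2.1) +
     (dsize (Atom x.2.2.1) + dsize (enc_copies x.2.2.2)).+1).+1).+1) dsize_bool.
  by move: h1 h2 h3; clear; lia.
by apply: (@pc_relax _ _ _ _ (fun x => pi (projT1 x))); lookup.
Qed.

End Table.

Section MainLoop.
Variables (A : Type) (dom : A -> Prop) (rho : A -> nat) (f : A -> data) (pi : A -> instance).
Notation vert a := (copies 'I_(im (pi a))).

Lemma pc_phase (B : forall a, {set vert a}) (e : forall a, vert a) (F V : forall a, seq (vert a)) :
  polyc dom rho f (fun a => enc_inst (pi a)) ->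
  polyc dom rho f (fun a => enc_copies (B a)) ->
  polyc dom rho f (fun a => enc_vertex (e a)) ->
  polyc dom rho f (fun a => enc_list (F a)) -> polyc dom rho f (fun a => enc_list (V a)) ->
  polyc dom rho f (fun a => enc_copies
    (phase (@iindep _ true) (@iindep _ false) (@iw (pi a)) (V a) (B a) (e a) (F a))).
Proof.
move=> Hi HB He HF HV; apply: pc_symd => //.
exact: pc_snd (pc_snd (pc_best_cycle Hi HB He (pc_table Hi HB He HF HV))).
Qed.

Lemma pc_greedy (z : forall a, {set 'I_(im (pi a))}) :
  polyc dom rho f (fun a => enc_inst (pi a)) ->
  polyc dom rho f (fun a => enc_set (z a)) ->
  polyc dom rho f (fun a => enc_seq [seq enc_set [set e] | e <- enum 'I_(im (pi a))]) ->
  polyc dom rho f (fun a => enc_copies (greedy_glue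
    (foldl (greedy_step (iM (pi a)) (ik (pi a))) (set0, set0) (enum 'I_(im (pi a)))))).
Proof.
move=> Hi Hz Hu.
pose ea a (PZ : {set 'I_(im (pi a))} * {set 'I_(im (pi a))}) := Node (enc_set PZ.1) (enc_set PZ.2).
suff H : polyc dom rho f (fun a => ea a
    (foldl (greedy_step (iM (pi a)) (ik (pi a))) (set0, set0) (enum 'I_(im (pi a))))).
  apply: pc_copies => t.
  apply: (@pc_ext _ _ _ (fun a => enc_set (if t is Some _ then
    (foldl (greedy_step (iM (pi a)) (ik (pi a))) (set0, set0) (enum 'I_(im (pi a)))).1
    else (foldl (greedy_step (iM (pi a)) (ik (pi a))) (set0, set0) (enum 'I_(im (pi a)))).2))).
    by move=> a _; rewrite slice_glue.
  by case: t => [_|]; [exact: pc_fst H | exact: pc_snd H].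
apply: (@pc_trans _ _ _ (fun a => Node (enc_inst (pi a)) (Node (enc_set (z a))
   (enc_seq [seq enc_set [set e] | e <- enum 'I_(im (pi a))])))).
  by do 2![apply: pc_node => //].
apply: (@pc_foldl_grow _ _ _ _ (fun a => 'I_(im (pi a))) _ (fun a e => enc_set [set e]) ea
  (fun a => enum 'I_(im (pi a))) (fun a => (set0, set0))
  (fun a => greedy_step (iM (pi a)) (ik (pi a))) (fun _ => 0)).
- by lookup.
- by apply: pc_node; apply: (@pc_set0 _ _ _ _ _ z); lookup.
- exact: pbnd_cst.
- by move=> a p e q PZ _ _; rewrite /ea /= !dsize_set addn0.
pose XT := {a : A & ({set 'I_(im (pi a))} * {set 'I_(im (pi a))} * 'I_(im (pi a)))%type}.
pose pi' (x : XT) := pi (projT1 x).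
apply: (@pc_eif _ _ _ _ _ _ (fun x => ea (projT1 x))); last by lookup.
  apply: pc_boolop.
    apply: (@pc_indep _ _ _ _ pi'); first by lookup.
    by apply: (@pc_setU _ _ _ _ (fun x => im (pi' x))); last apply: pc_setU; lookup.
  apply: (@pc_ext _ _ _ (fun x : XT => enc_bool (~~ ([set (projT2 x).2] :&: ((projT2 x).1.1 :|: (projT2 x).1.2) != set0)))).
    move=> x _; congr (enc_bool (~~ _)); apply/set0Pn/idP => [[y]|h].
      by rewrite in_setI in_set1 => /andP [/eqP ->].
    by exists (projT2 x).2; rewrite in_setI in_set1 eqxx.
  apply: pc_neg; apply: (@pc_nonempty _ _ _ _ (fun x => im (pi' x))).
  by apply: pc_setI; last apply: pc_setU; lookup.
apply: (@pc_eif _ _ _ _ _ _ (fun x => ea (projT1 x))).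
- apply: (@pc_ext _ _ _ (fun x : XT => enc_bool (#|(projT2 x).1.1|%:Z < (ik (pi (projT1 x)))%:Z)%R)).
    by move=> x _; rewrite ltz_nat.
  by apply: pc_lt; [apply: (@pc_card _ _ _ _ (fun x => im (pi' x))) |]; lookup.
- apply: pc_node; last by lookup.
  by apply: (@pc_setU _ _ _ _ (fun x => im (pi' x))); lookup.
apply: pc_node; first by lookup.
by apply: (@pc_setU _ _ _ _ (fun x => im (pi' x))); lookup.
Qed.

End MainLoop.

Section Outer.
Variables (A : Type) (dom : A -> Prop) (rho : A -> nat) (f : A -> data) (pi : A -> instance).
Notation vert a := (copies 'I_(im (pi a))).

Lemma pc_min_common_basis (B0 : forall a, {set vert a}) (V : forall a, seq (vert a)) :
  polyc dom rho f (fun a => enc_inst (pi a)) ->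
  polyc dom rho f (fun a => enc_copies (B0 a)) -> polyc dom rho f (fun a => enc_list (V a)) ->
  polyc dom rho f (fun a => enc_copies
    (min_common_basis (@iindep _ true) (@iindep _ false) (@iw (pi a)) (V a) (B0 a))).
Proof.
move=> Hi HB HV.
pose ea a (BF : {set vert a} * seq (vert a)) := Node (enc_copies BF.1) (enc_list BF.2).
suff H : polyc dom rho f (fun a => ea a (foldl
    (intersection_step (@iindep _ true) (@iindep _ false) (@iw (pi a)) (V a))
    (B0 a, [seq v <- V a | v \in B0 a]) [seq v <- V a | v \notin B0 a])).
  exact: pc_fst H.
pose env0 a := Node (enc_inst (pi a)) (Node (enc_copies (B0 a)) (enc_list (V a))).
apply: (@pc_trans _ _ _ env0); first by do 2![apply: pc_node => //].
(* The elements to insert are computed beforehand and stored, so that the size of the environment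
   bounds what one insertion adds to the accumulator. *)
pose rest a := [seq v <- V a | v \notin B0 a].
pose env a := Node (env0 a) (enc_list (rest a)).
have Hmem (D : {a : A & vert a} -> Prop) : polyc D (fun x => rho (projT1 x))
    (fun x => Node (env0 (projT1 x)) (enc_vertex (projT2 x)))
    (fun x => enc_bool (projT2 x \in B0 (projT1 x))).
  by apply: (@pc_mem_copies _ _ _ _ (fun x => im (pi (projT1 x)))); lookup.
apply: (@pc_trans _ _ _ env).
  apply: pc_node; first exact: pc_id.
  apply: (@pc_filter _ _ _ _ (fun a => vert a) (fun a => @enc_vertex (pi a)) V (fun a v => v \notin B0 a)).
    by lookup.
  exact: pc_neg (Hmem _).
have HF0 : polyc dom rho env (fun a => enc_list [seq v <- V a | v \in B0 a]).
  apply: pc_left.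
  apply: (@pc_filter _ _ _ _ (fun a => vert a) (fun a => @enc_vertex (pi a)) V (fun a v => v \in B0 a)).
    by lookup.
  exact: Hmem.
move=> benv; move: (benv).
apply: (@pc_foldl_grow _ _ _ _ (fun a => vert a) _ (fun a => @enc_vertex (pi a)) ea rest
  (fun a => (B0 a, [seq v <- V a | v \in B0 a]))
  (fun a => intersection_step (@iindep _ true) (@iindep _ false) (@iw (pi a)) (V a))
  (fun a => dsize (env a))).
- by lookup.
- by apply: pc_node => //; lookup.
- exact: benv.
- move=> a p e q [B F] _ E.
  have eR : e \in rest a by rewrite E mem_cat mem_head orbT.
  have := list_size_mem eR; rewrite /ea /intersection_step.
  rewrite -[dsize (Node _ _)]/((dsize (enc_copies (phase (@iindep _ true) (@iindep _ false) (@iw (pi a)) (V a) B e F))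
     + (dsize (enc_vertex e) + dsize (enc_list F)).+1).+1) dsize_copies.
  rewrite -[dsize (Node (enc_copies _) _)]/((dsize (enc_copies B) + dsize (enc_list F)).+1) dsize_copies.
  have : dsize (enc_list (rest a)) <= dsize (env a) by rewrite /env /=; clear; lia.
  by clear; move: (dsize _) (dsize _) (dsize _) (dsize _) => x1 x2 x3 x4; lia.
apply: pc_node; last by apply: pc_node; lookup.
by apply: (@pc_phase _ _ _ _ (fun x => pi (projT1 x))); lookup.
Qed.

End Outer.
End Intersection.

(** * Clearing denominators *)

Section Scaling.
Variables (T : eqType) (C c d : T -> rat).

(** The common denominator is the product of all denominators met so far, and earlier numerators are
    multiplied up; no division or gcd is used. *)
Definition scale_step (acc : int * seq (int * int)) (e : T) : int * seq (int * int) :=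
  let dd := (denq (c e) * denq (d e))%R in
  let den := (denq (C e) * dd)%R in
  ((acc.1 * den)%R,
   (numq (C e) * dd * acc.1, (numq (c e) * denq (d e) + numq (d e) * denq (c e)) * denq (C e) * acc.1)%R
   :: [seq (x.1 * den, x.2 * den)%R | x <- acc.2]).

Definition scale (s : seq T) := foldl scale_step (1%R, [::]) (rev s).

(** For the [D] computed by [scale] the arguments of [numq] are integral, so [numq] merely converts
    them. *)
Definition scaled (D : int) (e : T) : int * int :=
  (numq (C e * D%:~R), numq ((c e + d e) * D%:~R))%R.

Lemma scaleP (s : seq T) : [/\ (0 < (scale s).1)%R, (scale s).2 = [seq scaled (scale s).1 e | e <- s]
  & {in s, forall e, ((scaled (scale s).1 e).1%:~R = C e * (scale s).1%:~R /\
                      (scaled (scale s).1 e).2%:~R = (c e + d e) * (scale s).1%:~R)%R}].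
Proof.
rewrite /scale foldl_rev; elim: s => [|e s] //=; set r := foldr _ _ _ => -[D0 E H].
pose dd := (denq (c e) * denq (d e))%R; pose den := (denq (C e) * dd)%R.
have den0 q : ((denq q)%:~R != 0 :> rat)%R by rewrite intr_eq0 denq_neq0.
have qE q : q = ((numq q)%:~R / (denq q)%:~R)%R by rewrite divq_num_den.
have Ee : scaled (r.1 * den) e = (numq (C e) * dd * r.1,
    (numq (c e) * denq (d e) + numq (d e) * denq (c e)) * denq (C e) * r.1)%R
    /\ ((scaled (r.1 * den) e).1%:~R = C e * (r.1 * den)%:~R /\
        (scaled (r.1 * den) e).2%:~R = (c e + d e) * (r.1 * den)%:~R)%R.
  have E1 : (C e * (r.1 * den)%:~R = (numq (C e) * dd * r.1)%:~R)%R.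
    by rewrite {1}(qE (C e)) /den /dd !rmorphM /=; field; exact: den0.
  have E2 : ((c e + d e) * (r.1 * den)%:~R =
     ((numq (c e) * denq (d e) + numq (d e) * denq (c e)) * denq (C e) * r.1)%:~R)%R.
    by rewrite {1}(qE (c e)) {1}(qE (d e)) /den /dd !(rmorphM, rmorphD) /=; field; rewrite !den0.
  by rewrite /scaled E1 E2 !numq_int.
have Es x : x \in s -> scaled (r.1 * den) x = ((scaled r.1 x).1 * den, (scaled r.1 x).2 * den)%R
    /\ ((scaled (r.1 * den) x).1%:~R = C x * (r.1 * den)%:~R /\
        (scaled (r.1 * den) x).2%:~R = (c x + d x) * (r.1 * den)%:~R)%R.
  case/H; rewrite /scaled /= => h1 h2.
  have E1 : (C x * (r.1 * den)%:~R = (numq (C x * r.1%:~R) * den)%:~R)%R.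
    by rewrite [in LHS]intrM [in RHS]intrM h1 mulrA.
  have E2 : ((c x + d x) * (r.1 * den)%:~R = (numq ((c x + d x) * r.1%:~R) * den)%:~R)%R.
    by rewrite [in LHS]intrM [in RHS]intrM h2 mulrA.
  by rewrite E1 E2 !numq_int.
split.
- by rewrite !mulr_gt0 ?denq_gt0.
- rewrite /= -/dd -/den (proj1 Ee) E -map_comp; congr cons.
  by apply/eq_in_map => x /Es [->].
by move=> x; rewrite inE => /orP [/eqP ->|/Es [_ H2]]; [exact: (proj2 Ee) | exact: H2].
Qed.

End Scaling.

Definition enc_rates (x : int * int) : data := Node (Atom x.1) (Atom x.2).

Definition enc_cost_row m (C c d : 'I_m -> rat) (e : 'I_m) : data :=
  Node (enc_rat (C e)) (Node (enc_rat (c e)) (enc_rat (d e))).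

(** * The complete program *)

Section Assembly.
Variables (rep : representation) (rep_indep : indep_poly_time rep).

Record problem := Problem {
  pm : nat;
  pD : data;
  pM : matroid 'I_pm;
  pC : 'I_pm -> rat;
  pc : 'I_pm -> rat;
  pd : 'I_pm -> rat;
  pk : nat;
  prep : rep pD pM
}.

Definition enc_problem (p : problem) : data := enc_input (pD p) (pk p) (@pC p) (@pc p) (@pd p).

Let dom (p : problem) : Prop := True.
Let rho (p : problem) : nat := dsize (enc_problem p).
Let comp g := polyc dom rho enc_problem g.

Definition pscale (p : problem) := scale (@pC p) (@pc p) (@pd p) (enum 'I_(pm p)).

(** One more than the number of copies, as required of the factor [K]. *)
Definition pmultiplier p : nat := (3 * pm p).+1.

Definition pweight (p : problem) (x : copies 'I_(pm p)) : int :=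
  let z := scaled (@pC p) (@pc p) (@pd p) (pscale p).1 x.2 in
  match x.1 with Some true => z.1 | Some false => z.2 | None => (z.1 + z.2)%R end.

Definition pinst (p : problem) : instance rep :=
  @Instance rep (pm p) (pD p) (pM p) (pk p)
    (fun x => ((pmultiplier p)%:Z * pweight x)%R) (prep p).

Definition pverts p : seq (copies 'I_(pm p)) :=
  [seq (Some true, e) | e <- enum 'I_(pm p)] ++ [seq (Some false, e) | e <- enum 'I_(pm p)]
  ++ [seq (None, e) | e <- enum 'I_(pm p)].

Lemma comp_inst : comp (fun p => enc_inst (pinst p)).
Proof. by apply: pc_node; lookup. Qed.

Lemma comp_costs : comp (fun p => enc_seq [seq enc_cost_row (@pC p) (@pc p) (@pd p) e | e <- enum 'I_(pm p)]).
Proof. by rewrite /comp; lookup. Qed.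

Lemma comp_units : comp (fun p => enc_seq [seq enc_set [set e] | e <- enum 'I_(pm p)]).
Proof.
by apply: (pc_units _ comp_costs) => p _; rewrite size_map size_enum_ord.
Qed.

Lemma comp_set0 : comp (fun p => enc_set (set0 : {set 'I_(pm p)})).
Proof.
apply: (@pc_ext _ _ _ (fun p => enc_seq [seq enc_bool b | b <- [seq false | e <- enum 'I_(pm p)]])).
  move=> p _; rewrite /enc_set -map_comp; congr enc_seq; apply: eq_map => e /=.
  by rewrite inE.
apply: (@pc_map _ _ _ _ _ _ _ (fun _ => bool) (fun _ => enc_bool) (fun _ _ => false) comp_units).
exact: pc_bool.
Qed.

Lemma comp_factor : comp (fun p => Atom (pmultiplier p)%:Z).
Proof.
apply: (@pc_ext _ _ _ (fun p => Atom (3%:Z * (size (enum 'I_(pm p)))%:Z + 1)%R)).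
  by move=> p _; rewrite size_enum_ord; congr Atom; rewrite /pmultiplier; clear; lia.
apply: pc_add; last exact: pc_const.
by apply: pc_mul; [exact: pc_const | exact: (pc_size comp_costs)].
Qed.

Lemma comp_scale : comp (fun p => enc_seq [seq enc_rates x | x <- (pscale p).2]).
Proof.
pose ea (acc : int * seq (int * int)) := Node (Atom acc.1) (enc_seq [seq enc_rates x | x <- acc.2]).
suff H : comp (fun p => ea (pscale p)) by exact: pc_snd H.
rewrite /comp.
pose row p := enc_cost_row (@pC p) (@pc p) (@pd p).
pose s p := rev (enum 'I_(pm p)).
have Hrow : polyc dom rho enc_problem (fun p => enc_seq [seq row p e | e <- s p]).
  apply: (@pc_ext _ _ _ (fun p => enc_seq (rev [seq row p e | e <- enum 'I_(pm p)]))).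
    by move=> p _; rewrite map_rev.
  exact: pc_rev comp_costs.
pose L p := dsize (enc_seq [seq row p e | e <- s p]).
move=> bf; have bL : pbnd dom rho L := polyc_bnd Hrow bf; move: (bf).
(* The factors entering one step are together smaller than a row of the input, hence linear growth
   with slope [L p]. *)
pose Inv p i (acc : int * seq (int * int)) := [/\ dsize (Atom acc.1) <= 2 + i * L p, size acc.2 <= i &
  all (fun x => (dsize (Atom x.1) <= 2 + i * L p) && (dsize (Atom x.2) <= 2 + i * L p)) acc.2].
apply: (@pc_foldl _ _ _ _ (fun p => 'I_(pm p)) (fun _ => (int * seq (int * int))%type) row (fun _ => ea) s
  (fun _ => (1%R, [::])) (fun p => scale_step (@pC p) (@pc p) (@pd p)) Inv) => //.
- by apply: pc_node; [exact: pc_const | exact: pc_nil].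
- move=> p l e q acc _ E [h1 h2 h3].
  have lerow : dsize (row p e) < L p.
    by rewrite /L E map_cat; exact: dsize_seq_mem.
  move: lerow; rewrite /row /enc_cost_row /enc_rat.
  rewrite -[dsize (Node _ _)]/((dsize (Atom (numq (pC e))) + dsize (Atom (denq (pC e)))).+1 +
    ((dsize (Atom (numq (pc e))) + dsize (Atom (denq (pc e)))).+1 +
     (dsize (Atom (numq (pd e))) + dsize (Atom (denq (pd e)))).+1).+1).+1 => lerow.
  have mulS x y n1 n2 : dsize (Atom x) <= n1 -> dsize (Atom y) <= n2 -> dsize (Atom (x * y)%R) <= n1 + n2.
    by move=> l1 l2; apply: leq_trans (dsize_mul _ _) _; exact: leq_add.
  have addS x y n1 n2 : dsize (Atom x) <= n1 -> dsize (Atom y) <= n2 -> dsize (Atom (x + y)%R) <= n1 + n2.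
    by move=> l1 l2; apply: leq_trans (dsize_add _ _) _; exact: leq_add.
  have le1 x : dsize (Atom x) <= dsize (Atom x) by [].
  have dens := mulS _ _ _ _ (le1 (denq (pC e))) (mulS _ _ _ _ (le1 (denq (pc e))) (le1 (denq (pd e)))).
  rewrite /Inv mulSn; split; rewrite /scale_step /=.
  + by apply: leq_trans (mulS _ _ _ _ h1 dens) _; move: lerow; clear; lia.
  + by rewrite size_map.
  apply/andP; split.
    apply/andP; split.
      apply: leq_trans (mulS _ _ _ _ (mulS _ _ _ _ (le1 _) (mulS _ _ _ _ (le1 _) (le1 _))) h1) _.
      by move: lerow; clear; lia.
    apply: leq_trans (mulS _ _ _ _ (mulS _ _ _ _ (addS _ _ _ _ (mulS _ _ _ _ (le1 _) (le1 _))
      (mulS _ _ _ _ (le1 _) (le1 _))) (le1 _)) h1) _.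
    by move: lerow; clear; lia.
  rewrite all_map; apply: sub_all h3 => x /andP [x1 x2] /=.
  apply/andP; split.
    by apply: leq_trans (mulS _ _ _ _ x1 dens) _; move: lerow; clear; lia.
  by apply: leq_trans (mulS _ _ _ _ x2 dens) _; move: lerow; clear; lia.
- exists (fun p => (2 + L p * L p + (2 + L p * ((2 + L p * L p) + (2 + L p * L p)).+2)).+1).
    have bc := pbnd_cst dom rho; have bLL := pbnd_add (bc 2) (pbnd_mul bL bL).
    apply: pbnd_S; apply: (pbnd_add bLL); apply: (pbnd_add (bc 2)); apply: (pbnd_mul bL).
    by do 2!apply: pbnd_S; exact: pbnd_add.
  move=> p i acc _ lei [h1 h2 h3].
  have lt : i < L p by apply: leq_ltn_trans lei _; have := dsize_seq_size [seq row p e | e <- s p]; rewrite size_map.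
  have leLL : 2 + i * L p <= 2 + L p * L p by rewrite leq_add2l leq_mul2r (ltnW lt) orbT.
  rewrite /ea -[dsize (Node _ _)]/((dsize (Atom acc.1) + dsize (enc_seq [seq enc_rates x | x <- acc.2])).+1) ltnS.
  apply: leq_add; first exact: leq_trans h1 leLL.
  apply: leq_trans (dsize_map_le h3 (b := ((2 + L p * L p) + (2 + L p * L p)).+1) _) _.
    move=> x /andP [x1 x2]; rewrite /enc_rates -[dsize (Node _ _)]/((dsize (Atom x.1) + dsize (Atom x.2)).+1) ltnS.
    by apply: leq_add; [exact: leq_trans x1 leLL | exact: leq_trans x2 leLL].
  by rewrite leq_add2l leq_mul2r (leq_trans h2 (ltnW lt)) orbT.
rewrite /ea /scale_step /=.
have num X (D : X -> Prop) r (h : X -> data) q : polyc D r h (fun x => enc_rat (q x)) ->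
    polyc D r h (fun x => Atom (numq (q x))) by exact: pc_fst.
have den X (D : X -> Prop) r (h : X -> data) q : polyc D r h (fun x => enc_rat (q x)) ->
    polyc D r h (fun x => Atom (denq (q x))) by exact: pc_snd.
apply: pc_node.
  apply: pc_mul; first by lookup.
  by apply: pc_mul; [|apply: pc_mul]; apply: den; lookup.
apply: pc_node.
  apply: pc_node.
    apply: pc_mul; last by lookup.
    apply: pc_mul; first by apply: num; lookup.
    by apply: pc_mul; apply: den; lookup.
  apply: pc_mul; last by lookup.
  apply: pc_mul; last by apply: den; lookup.
  by apply: pc_add; apply: pc_mul; (apply: num; lookup) || (apply: den; lookup).
pose den' (x : {p : problem & ((int * seq (int * int)) * 'I_(pm p))%type}) : int :=
  (denq (pC (projT2 x).2) * (denq (pc (projT2 x).2) * denq (pd (projT2 x).2)))%R.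
apply: (@pc_map _ _ _ _ (fun _ => (int * int)%type) (fun _ => enc_rates) (fun x => (projT2 x).1.2)
  (fun _ => (int * int)%type) (fun _ => enc_rates) (fun x y => (y.1 * den' x, y.2 * den' x)%R)).
  by lookup.
by apply: pc_node; (apply: pc_mul; first by lookup); apply: pc_mul; [|apply: pc_mul| |apply: pc_mul];
  apply: den; lookup.
Qed.

Lemma comp_copies (t : option bool) :
  comp (fun p => enc_seq [seq @enc_vertex rep (pinst p) v | v <- [seq (t, e) | e <- enum 'I_(pm p)]]).
Proof.
pose z p e := scaled (@pC p) (@pc p) (@pd p) (pscale p).1 e.
pose eb p (e : 'I_(pm p)) := Node (enc_set [set e]) (enc_rates (z p e)).
have Hzip : comp (fun p => enc_seq [seq eb p e | e <- enum 'I_(pm p)]).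
  apply: (@pc_ext _ _ _ (fun p => enc_seq [seq Node x.1 x.2 | x <-
     zip [seq enc_set [set e] | e <- enum 'I_(pm p)] [seq enc_rates x | x <- (pscale p).2]])).
    move=> p _; congr enc_seq; have [_ -> _] := scaleP (@pC p) (@pc p) (@pd p) (enum 'I_(pm p)).
    by rewrite -map_comp zip_map -map_comp.
  apply: pc_zip comp_units comp_scale => p _; rewrite !size_map /pscale.
  have [_ E _] := scaleP (@pC p) (@pc p) (@pd p) (enum 'I_(pm p)).
  by rewrite [in RHS]E size_map enumT.
apply: (@pc_trans _ _ _ (fun p => Node (Atom (pmultiplier p)%:Z) (enc_seq [seq eb p e | e <- enum 'I_(pm p)]))).
  by apply: pc_node => //; exact: comp_factor.
apply: (@pc_map _ _ _ _ (fun p => 'I_(pm p)) eb (fun p => enum 'I_(pm p))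
  (fun p => copies 'I_(pm p)) (fun p => @enc_vertex rep (pinst p)) (fun p e => (t, e))).
  by lookup.
pose XT := {p : problem & 'I_(pm p)}.
apply: pc_node; last first.
  apply: pc_mul; first by lookup.
  have H : polyc (map_dom dom (fun p => enum 'I_(pm p))) (fun x : XT => rho (projT1 x))
     (fun x => Node (Node (Atom (pmultiplier (projT1 x))%:Z)
        (enc_seq [seq eb (projT1 x) e | e <- enum 'I_(pm (projT1 x))])) (eb _ (projT2 x)))
     (fun x => enc_rates (z _ (projT2 x))) by lookup.
  rewrite /pweight /= -/(z _ _); case: t => [[]|]; [exact: pc_fst H | exact: pc_snd H |].
  by apply: pc_add; [exact: pc_fst H | exact: pc_snd H].
apply: (@pc_copies _ _ _ _ (fun x : XT => pm (projT1 x))) => t'.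
apply: (@pc_ext _ _ _ (fun x : XT => enc_set (if t' == t then [set projT2 x] else set0))).
  move=> x _; congr enc_set; apply/setP => y; rewrite !inE /eq_op /= -/(t' == t).
  by case: (t' == t); rewrite !inE.
case: (t' == t); first by lookup.
by apply: (@pc_set0 _ _ _ _ (fun x : XT => pm (projT1 x)) (fun x => [set projT2 x])); lookup.
Qed.

Lemma comp_verts : comp (fun p => @enc_list rep (pinst p) (pverts p)).
Proof.
apply: (@pc_ext _ _ _ (fun p =>
  enc_seq ([seq @enc_vertex rep (pinst p) v | v <- [seq (Some true, e) | e <- enum 'I_(pm p)]] ++
    ([seq @enc_vertex rep (pinst p) v | v <- [seq (Some false, e) | e <- enum 'I_(pm p)]] ++
     [seq @enc_vertex rep (pinst p) v | v <- [seq (None, e) | e <- enum 'I_(pm p)]])))).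
  by move=> p _; rewrite /enc_list /pverts !map_cat.
by apply: pc_cat; [|apply: pc_cat]; exact: comp_copies.
Qed.

Definition pstart p : {set copies 'I_(pm p)} :=
  greedy_glue (foldl (greedy_step (pM p) (pk p)) (set0, set0) (enum 'I_(pm p))).

Definition psolution p : {set copies 'I_(pm p)} :=
  min_common_basis (copy_indep (pM p) (pk p) true) (copy_indep (pM p) (pk p) false)
    (fun x => ((pmultiplier p)%:Z * pweight x)%R) (pverts p) (pstart p).

Lemma comp_solution : comp (fun p => Node (enc_set (part true (psolution p)))
                                          (enc_set (part false (psolution p)))).
Proof.
have HB : comp (fun p => enc_copies (pstart p)).
  exact: (@pc_greedy _ rep_indep _ _ _ _ pinst _ comp_inst comp_set0 comp_units).
have HS : comp (fun p => enc_copies (psolution p)).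
  exact: (@pc_min_common_basis _ rep_indep _ _ _ _ pinst _ _ comp_inst HB comp_verts).
by apply: pc_node; apply: (@pc_setU _ _ _ _ pm); exact: pc_slice.
Qed.

Lemma psolution_correct (R : realFieldType) p :
  (forall e, 0 <= pd (p := p) e)%R -> pk p <= rank (pM p) setT ->
  rr_solution (pM p) (fun e => ratr (pC (p := p) e) : R) (fun e => ratr (pc (p := p) e))
    (fun e => ratr (pd (p := p) e)) (pk p) (part true (psolution p)) (part false (psolution p)).
Proof.
move=> d0 lek.
have [I1 I2 c0] := greedy_spanning lek (s := enum 'I_(pm p)) (fun e => mem_enum _ e).
have sp b : copy_indep (pM p) (pk p) b (pstart p) ->
    spanning_indep (copy_matroid (pM p) (pk p) b) (pstart p).
  by move=> I; split=> // S /copy_card_le; rewrite c0.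
have bigK : #|{: copies 'I_(pm p)}| < pmultiplier p.
  by rewrite card_prod card_option card_bool card_ord.
have uV : uniq (pverts p).
  have uC t : uniq [seq (t : option bool, e) | e <- enum 'I_(pm p)].
    by rewrite map_inj_uniq ?enum_uniq // => x y [].
  have dC t t' : t != t' :> option bool ->
      has (in_mem^~ (mem [seq (t, e) | e <- enum 'I_(pm p)])) [seq (t', e) | e <- enum 'I_(pm p)] = false.
    by move=> /eqP ne; apply/negbTE/hasPn => _ /mapP [x _ ->]; apply/negP => /mapP [y _ [E _]]; case: ne.
  by rewrite /pverts !cat_uniq !uC has_cat !dC.
have allV v : v \in pverts p.
  case: v => t e; rewrite /pverts !mem_cat.
  have H t' : (t', e) \in [seq (t', e) | e <- enum 'I_(pm p)] by apply: map_f; rewrite mem_enum.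
  by case: t => [[]|]; rewrite H ?orbT.
have [[S1 max1] [S2 max2] minS] := @min_common_basisP _ _ _ (@pweight p) _ bigK _ _ uV allV (sp _ I1) (sp _ I2).
have [D0 _ HD] := scaleP (@pC p) (@pc p) (@pd p) (enum 'I_(pm p)).
apply: (@rr_solution_of_common_basis _ _ _ _ _ _ _ _ (@pweight p) (ratr (pscale p).1%:~R)) => //.
- by move=> e; rewrite ler0q.
- by rewrite ltr0q ltr0z.
- move=> [t e]; have [h1 h2] := HD e ltac:(by rewrite mem_enum); rewrite -/(pscale p) in h1 h2.
  have H1 : ((scaled (@pC p) (@pc p) (@pd p) (pscale p).1 e).1%:~R = ratr (pscale p).1%:~R * ratr (pC e) :> R)%R.
    by rewrite -[LHS]ratr_int h1 rmorphM /= mulrC.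
  have H2 : ((scaled (@pC p) (@pc p) (@pd p) (pscale p).1 e).2%:~R =
     ratr (pscale p).1%:~R * (ratr (pc e) + ratr (pd e)) :> R)%R.
    by rewrite -[LHS]ratr_int h2 rmorphM rmorphD /= mulrC.
  case: t => [[]|]; [exact: H1 | exact: H2 |].
  by rewrite /pweight intrD H1 H2 -mulrDr.
have le := copy_card_le (S1 : copy_indep (pM p) (pk p) true (psolution p)).
by apply/eqP; rewrite eqn_leq le -c0 max1.
Qed.


End Assembly.

Local Open Scope ring_scope.

Theorem theorem2 (rep : representation)
    (rep_indep : indep_poly_time rep) :
  exists (A : prog) (q : {poly nat}),
  forall (R : realFieldType) (m : nat) (D : data) (M : matroid 'I_m)
         (C c d : 'I_m -> rat)
         (k : nat),
    (0 < m)%N ->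
    rep m D M ->
    (forall e, 0 <= C e) -> (forall e, 0 <= c e) -> (forall e, 0 <= d e) ->
    (k <= rank M setT)%N ->
    exists X Y : {set 'I_m},
      runs_within A (enc_input D k C c d) (Node (enc_set X) (enc_set Y))
        q.[dsize (enc_input D k C c d)] /\
      rr_solution M (fun e => ratr (C e) : R) (fun e => ratr (c e) : R)
        (fun e => ratr (d e) : R) k X Y.
Proof.
(* Here [rho] is the size of the input itself, so the premise of [polyc] is immediate. *)
have [A [t [[q tq] HA]]] := comp_solution rep_indep (pbnd_rho _ _).
exists A, q => R m D M C c d k _ repM _ _ d0 lek.
pose p := @Problem rep m D M C c d k repM.
exists (part true (psolution p)), (part false (psolution p)); split.
  exact: runs_within_le (HA p I) (tq p I).
exact: (@psolution_correct rep R p d0 lek).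
Qed.
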